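(* Let $n>1$ and let $q$ be a prime power with $q^n>4$. Let $\mathcal{E}$ be a weak egg in $\mathrm{PG}(4n-1,q)$. Then $\mathcal{E}$ is elementary if and only if there exist an element $E\in\mathcal{E}$ and distinct elements $E_1,E_2,E_3,E_4,E_5\in\mathcal{E}$ such that the following three properties hold: (1) $\mathcal{E}$ is good at $E$; (2) there exists a $(3n-1)$-space, disjoint from $E$, containing $E_1,E_2,E_3,E_4,E_5$; (3) all pseudo-ovals of $\mathcal{E}$ containing $\{E,E_1\}$, $\{E,E_2\}$ or $\{E,E_3\}$ are elementary.
   Context: $\mathrm{PG}(r,q)$ is the $r$-dimensional projective space over $\mathbb{F}_q$; dimensions are projective. A cap in $\mathrm{PG}(r,q)$ is a set of points such that every three points span a plane. A pseudo-cap in $\mathrm{PG}(2n+m-1,q)$ is a set of $(n-1)$-spaces such that any three elements span a $(3n-1)$-space. A weak egg in $\mathrm{PG}(4n-1,q)$ is a pseudo-cap of size $q^{2n}+1$. A weak egg $\mathcal{E}$ is good at $E\in\mathcal{E}$ if every $(3n-1)$-space containing $E$ and at least two other elements of $\mathcal{E}$ contains exactly $q^n+1$ elements of $\mathcal{E}$. A pseudo-oval in $\mathrm{PG}(3n-1,q)$ is a pseudo-cap with exactly $q^n+1$ elements. A pseudo-oval of $\mathcal{E}$ is a subset of $\mathcal{E}$ of $q^n+1$ elements contained in a $(3n-1)$-space (so that it is a pseudo-oval of that $(3n-1)$-space). Field reduction: viewing $\mathbb{F}_{q^n}^{r}$ as an $rn$-dimensional $\mathbb{F}_q$-vector space, each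 point of $\mathrm{PG}(r-1,q^n)$ corresponds to an $(n-1)$-space of $\mathrm{PG}(rn-1,q)$. A pseudo-cap in $\mathrm{PG}(rn-1,q)$ is elementary if it is obtained (up to choice of identification) by field reduction from a cap of $\mathrm{PG}(r-1,q^n)$; for a pseudo-oval of $\mathcal{E}$ this is applied with $r=3$ in the $(3n-1)$-space it spans. *)

(* Defs.v *)
From HB Require Import structures.
From mathcomp Require Import all_boot all_order all_algebra all_field.
From mathcomp Require Import finmap.

Set Implicit Arguments.
Unset Strict Implicit.
Unset Printing Implicit Defensive.

Import GRing.Theory.
Local Open Scope ring_scope.

(* A projective (k-1)-space is a vector subspace of dimension k.  Thus an
   (n-1)-space has \dim n, a (3n-1)-space has \dim 3n, and two projective
   spaces are disjoint when the vector subspaces meet in 0. *)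

Section SubspaceSets.

Variables (K : fieldType) (V : vectType K).
Implicit Types (S : {fset {vspace V}}) (U : {vspace V}).

Definition span_of S : {vspace V} := (\sum_(X <- S) X)%VS.

Definition contained_in S U : Prop := forall X, X \in S -> (X <= U)%VS.

Definition is_pseudo_cap (n : nat) S : Prop :=
  (forall X, X \in S -> \dim X = n) /\
  (forall X Y Z, X \in S -> Y \in S -> Z \in S -> uniq [:: X; Y; Z] ->
     \dim (X + Y + Z)%VS = (3 * n)%N).

Definition is_cap S : Prop :=
  (forall P, P \in S -> \dim P = 1%N) /\
  (forall P Q R, P \in S -> Q \in S -> R \in S -> uniq [:: P; Q; R] ->
     \dim (P + Q + R)%VS = 3%N).

End SubspaceSets.

Section FieldReduction.

Variables (F : fieldType) (V : vectType F).

(* phi identifies L^r, regarded as a vector space over F, with U. *)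
Definition is_identification (L : fieldExtType F) (r : nat)
    (U : {vspace V}) (phi : 'rV[L]_r -> V) : Prop :=
  [/\ {morph phi : x y / x + y},
      forall (c : F) (x : 'rV[L]_r), phi (c%:A *: x) = c *: phi x,
      injective phi
    & forall y : V, y \in U <-> exists x, phi x = y].

(* X is the F-subspace corresponding to the L-subspace P under phi. *)
Definition is_reduction_of (L : fieldExtType F) (r : nat)
    (phi : 'rV[L]_r -> V) (P : {vspace 'rV[L]_r}) (X : {vspace V}) : Prop :=
  forall y : V, y \in X <-> exists2 x, x \in P & phi x = y.

(* U has dimension r n over F.  If F has q elements, then L, of degree n over
   F, is the field with q^n elements. *)
Definition is_elementary_in (n r : nat) (U : {vspace V})
    (S : {fset {vspace V}}) : Prop :=
  exists (L : fieldExtType F) (phi : 'rV[L]_r -> V)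
         (C : {fset {vspace 'rV[L]_r}}),
    [/\ \dim {:L} = n,
        is_identification U phi,
        is_cap C
      & forall X, X \in S <-> exists2 P, P \in C & is_reduction_of phi P X].

End FieldReduction.

Section WeakEggs.

Variables (F : finFieldType) (n : nat).

Local Notation q := #|F|.
Local Notation V := 'rV[F]_(4 * n).

Implicit Types (S O : {fset {vspace V}}) (E : {vspace V}).

Definition is_weak_egg S : Prop :=
  is_pseudo_cap n S /\ #|` S| = (q ^ (2 * n) + 1)%N.

Definition is_good_at S E : Prop :=
  forall U : {vspace V}, \dim U = (3 * n)%N -> (E <= U)%VS ->
    (exists X Y, [/\ X \in S, Y \in S, uniq [:: E; X; Y],
                     (X <= U)%VS & (Y <= U)%VS]) ->
    #|` [fset X in S | (X <= U)%VS]%fset| = (q ^ n + 1)%N.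

Definition is_pseudo_oval_of S O : Prop :=
  [/\ (O `<=` S)%fset,
      #|` O| = (q ^ n + 1)%N
    & exists2 U : {vspace V}, \dim U = (3 * n)%N & contained_in O U].

Definition is_elementary_weak_egg S : Prop := is_elementary_in n 4 fullv S.

(* Any three elements of a pseudo-oval of a weak egg span its (3n-1)-space,
   so that space is the span. *)
Definition is_elementary_pseudo_oval O : Prop :=
  is_elementary_in n 3 (span_of O) O.

End WeakEggs.

(* Main.v *)
Require Import Defs.
From HB Require Import structures.
From mathcomp Require Import all_boot all_order all_algebra all_field.
From mathcomp Require Import finmap zify.

(* Write Q = q^n.  If the weak egg is elementary, it comes from a (Q^2+1)-cap of
   PG(3,Q), and it is good at a point all of whose planes meet the cap in at
   most Q+1 points, by counting the planes through a secant.  For Q odd there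
   are no hyperoval sections.  For Q even, take an oval section and its nucleus
   N: if N lies on a secant, then all tangents through N are coplanar and some
   plane is tangent to the cap; otherwise every nucleus extends the cap, and
   the cap together with all its nuclei would be a set of Q^2+Q+2 points met by
   every plane in 0 or Q+2 points, which is impossible for Q > 2.

   Conversely, project from E onto the (3n-1)-space U containing E_1, ..., E_5.
   By goodness the projections of the other elements form an affine plane of
   order Q whose lines are (2n-1)-spaces.  After possibly exchanging E_1 and
   E_2, the lines E_2E_4 and E_3E_5 meet.  The pseudo-oval of E and the line
   E_2E_4 being elementary, it carries an action of the field with Q elements
   on the span of E, E_2, E_4, which extends uniquely to an action on the whole
   space that stabilises E, E_1 and all the projected elements.  If a
   pseudo-oval through E and E_1, E_2 or E_3 has three stable elements other
   than E, then the action that makes it elementary agrees with the global one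
   on the span, so all its elements are stable.  This applies to the line
   E_3E_5, then to all but three lines through E_1, then to the lines through
   E_2, and finally to the lines through E_3.  Hence every element is stable,
   that is, the weak egg comes from PG(3,Q). *)

Set Implicit Arguments.
Unset Strict Implicit.
Unset Printing Implicit Defensive.

Import GRing.Theory.
Local Open Scope fset_scope.
Local Open Scope ring_scope.

(** The bound [4 < q ^ n] is used as [5 < q ^ n]: for n > 1 the prime 5 is no n-th power. Six is
    what the propagation needs. A line through E_2 may lose three of its Q elements to exceptional
    lines through E_1, and it must keep three, because three elements of a pseudo-oval span it and
    actions that agree on them agree on the whole span.

    The obstacle is that each elementary pseudo-oval brings its own field and its own action, with
    no relation assumed between them. They are compared on the projected line: a global
    multiplication preserves each of the Q elements there, so it acts as a scalar of the local
    field. On a stable element of the pseudo-oval, the difference of the two multiplications then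
    takes values both in E and in that element, hence vanishes.

    In the other direction one good point suffices, so it is not necessary to determine all plane
    sections of the cap. The restriction Q > 2 in the final count is genuine: for Q = 2 the
    complement of a plane has Q^2+Q+2 = 8 points and meets every plane in 0 or Q+2 = 4 points. *)

Lemma exponent_gt5 q n : (1 < q -> 1 < n -> 4 < q ^ n -> 5 < q ^ n)%N.
Proof.
case: n => [|[|n]] // q1 _; rewrite !expnS.
have [q2|q2] := leqP q 2; last first.
  move=> _; have : (0 < q ^ n)%N by rewrite expn_gt0; lia.
  by move: (q ^ n)%N => k k0; nia.
have -> : q = 2 by lia.
case: n => [|n]; first by rewrite expn0.
move=> _; have : (0 < 2 ^ n)%N by rewrite expn_gt0.
by rewrite expnS; move: (2 ^ n)%N => k; lia.
Qed.

(** * Finite sets *)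

Section FiniteSets.

Lemma in_sep (T : choiceType) (S : {fset T}) (p : pred T) x :
  (x \in [fset y in S | p y]) = (x \in S) && p x.
Proof. by rewrite !inE. Qed.

Lemma card_fibers (T T' : choiceType) (f : T -> T') (S : {fset T}) :
  #|` S| = (\sum_(y <- f @` S) #|` [fset x in S | f x == y]|)%N.
Proof.
rewrite card_fset_sum1 (partition_big_imfset _ f); apply: eq_bigr => y _.
rewrite card_fset_sum1 big_fset_condE.
by apply: eq_fbigl => x; rewrite !inE.
Qed.

Lemma leq_card_fibers (T T' : choiceType) (f : T -> T') (S : {fset T}) k :
  (forall y, y \in f @` S -> #|` [fset x in S | f x == y]| <= k)%N ->
  (#|` S| <= #|` f @` S| * k)%N.
Proof.
move=> hk; rewrite (card_fibers f) mulnC.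
have ->: (k * #|` f @` S| = \sum_(y <- f @` S) k)%N.
  by rewrite card_fset_sum1 big_distrr /=; apply: eq_bigr => y _; rewrite muln1.
by rewrite big_seq [leqRHS]big_seq; apply: leq_sum => y /hk.
Qed.

Lemma eq_card_fibers (T T' : choiceType) (f : T -> T') (S : {fset T}) k :
  (forall y, y \in f @` S -> #|` [fset x in S | f x == y]| = k)%N ->
  (#|` S| = #|` f @` S| * k)%N.
Proof.
move=> hk; rewrite (card_fibers f) mulnC.
have ->: (k * #|` f @` S| = \sum_(y <- f @` S) k)%N.
  by rewrite card_fset_sum1 big_distrr /=; apply: eq_bigr => y _; rewrite muln1.
by rewrite big_seq [RHS]big_seq; apply: eq_bigr => y /hk.
Qed.

(** Equality case of [leq_card_fibers]: one missing or one deficient fibre would leave fewer than N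
    k elements. *)
Lemma max_card_fibers (T T' : choiceType) (f : T -> T') (S : {fset T}) N k :
  (forall y, y \in f @` S -> #|` [fset x in S | f x == y]| <= k)%N ->
  (#|` f @` S| <= N)%N -> #|` S| = (N * k)%N -> (0 < k)%N ->
  #|` f @` S| = N /\
  (forall y, y \in f @` S -> #|` [fset x in S | f x == y]| = k)%N.
Proof.
move=> hk hN hS k_gt0.
have eN : #|` f @` S| = N.
  apply/eqP; rewrite eqn_leq hN /=.
  by rewrite -(leq_pmul2r k_gt0) -hS leq_card_fibers.
split=> // y yS; apply/eqP; rewrite eqn_leq hk //= leqNgt; apply/negP => lt.
suff: (#|` S| < N * k)%N by rewrite hS ltnn.
rewrite (card_fibers f) -eN mulnC.
have ->: (k * #|` f @` S| = \sum_(y <- f @` S) k)%N.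
  by rewrite card_fset_sum1 big_distrr /=; apply: eq_bigr => z _; rewrite muln1.
rewrite (big_fsetD1 y yS) [ltnRHS](big_fsetD1 y yS) /=.
rewrite -addSn leq_add // big_seq [leqRHS]big_seq; apply: leq_sum => z.
by rewrite !inE => /andP[_ /hk].
Qed.

Lemma card_imfset_in (T T' : choiceType) (f : T -> T') (S : {fset T}) :
  {in S &, injective f} -> #|` f @` S| = #|` S|.
Proof. by move=> inj; rewrite card_in_imfset. Qed.

Lemma card_imfset_le (T T' : choiceType) (f : T -> T') (S : {fset T}) :
  (#|` f @` S| <= #|` S|)%N.
Proof. exact: leq_imfset_card. Qed.

Lemma imfset_onto (T T' : choiceType) (f : T -> T') (S : {fset T}) (B : {fset T'}) :
  {in S &, injective f} -> {in S, forall x, f x \in B} ->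
  (#|` B| <= #|` S|)%N -> f @` S = B.
Proof.
move=> inj sub le; apply/eqP; rewrite eqEfcard card_in_imfset // le andbT.
by apply/fsubsetP => _ /imfsetP[x xS ->]; apply: sub.
Qed.

(** Choosing a partner for each element of [A] gives an injection into [B], which is onto by
    cardinality. Any partner [b] of [a] is therefore the chosen partner of some [x], and injectivity
    of the relation gives [x = a]. *)
Lemma matching_functional (T T' : choiceType) (r : T -> T' -> bool)
    (A : {fset T}) (B : {fset T'}) :
  (forall a, a \in A -> exists2 b, b \in B & r a b) ->
  (forall a a' b, a \in A -> a' \in A -> b \in B -> r a b -> r a' b -> a = a') ->
  (#|` B| <= #|` A|)%N ->
  forall a b b', a \in A -> b \in B -> b' \in B -> r a b -> r a b' -> b = b'.
Proof.
move=> ex inj le a b b' aA bB b'B rb rb'.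
(* The default [b] only makes [f] total; it is never taken on [A]. *)
pose f x := odflt b (omap val [pick y : B | r x (val y)]).
have fP x : x \in A -> f x \in B /\ r x (f x).
  move=> xA; rewrite /f; case: pickP => [y ry | none] /=.
    by split=> //; apply: valP.
  by have [y yB ry] := ex x xA; have /= := none [` yB]; rewrite ry.
have fA : f @` A = B.
  apply: imfset_onto => // [x x' xA x'A e | x /fP[] //].
  by apply: (inj _ _ (f x)) => //; [case: (fP x) | case: (fP x) | rewrite e; case: (fP x')].
have fE y : y \in B -> r a y -> f a = y.
  move=> yB ry; move: (yB); rewrite -fA => /imfsetP[x xA ey].
  by rewrite ey; congr f; apply: (inj _ _ y) => //; rewrite ey; case: (fP x).
by rewrite -(fE b) // -(fE b').
Qed.

Lemma card_ge2_fset (T : choiceType) (S : {fset T}) :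
  (1 < #|` S|)%N -> forall x, exists2 y, y \in S & y != x.
Proof.
move=> gt1 x; have: S `\ x != fset0.
  by rewrite -cardfs_gt0; move: gt1; rewrite (cardfsD1 x); case: (x \in S) => //=;
     rewrite ?add0n ?add1n //; apply: leq_trans.
by case/fset0Pn => y; rewrite !inE => /andP[yx yS]; exists y.
Qed.

Lemma card_gt2_fset (T : choiceType) (S : {fset T}) : (2 < #|` S|)%N ->
  exists x y z, [/\ x \in S, y \in S, z \in S & uniq [:: x; y; z]].
Proof.
have := fset_uniq S; have mem x : (x \in S) = (x \in enum_fset S) by [].
move=> + gt2; move: gt2 mem; case: (enum_fset S) => [|x [|y [|z s]]] //= _ mem.
rewrite !inE !negb_or -!andbA => /and4P[xy xz _ /and3P[yz _ _]].
exists x, y, z; rewrite !mem !inE !eqxx !orbT; split=> //.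
by rewrite negb_or xy xz yz.
Qed.

End FiniteSets.

(** * Counting subspaces over a finite field *)

Section VectorCounting.

Variables (F : finFieldType) (m : nat).
Local Notation V := 'rV[F]_m.
Local Notation q := #|F|.
Implicit Types (A B U X Y : {vspace V}) (S : {fset {vspace V}}).

Lemma card_vs U : #|U| = (q ^ \dim U)%N.
Proof. exact: card_vspace. Qed.

Lemma card_vs_set U : #|[set v in U]| = (q ^ \dim U)%N.
Proof. by rewrite cardsE card_vs. Qed.

Lemma q_gt1 : (1 < q)%N. Proof. exact: finNzRing_gt1. Qed.

(** Outside [A] the subspaces are pairwise disjoint, so each contributes the same number of new
    vectors. *)
Lemma card_cover_seq A k (s : seq {vspace V}) : uniq s ->
  (forall X, X \in s -> (A <= X)%VS /\ \dim X = k) ->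
  (forall X Y, X \in s -> Y \in s -> X != Y -> (X :&: Y <= A)%VS) ->
  #|[set v | (v \notin A) && has (fun X : {vspace V} => v \in X) s]|
    = (size s * (q ^ k - q ^ \dim A))%N.
Proof.
elim: s => [|X s IH] /=.
  by move=> _ _ _; apply: eq_card0 => v; rewrite !inE andbF.
case/andP => Xs us hA hI.
have := cardsUI [set v | (v \notin A) && (v \in X)]
  [set v | (v \notin A) && has (fun X : {vspace V} => v \in X) s].
rewrite IH //; first last.
- by move=> Y Z Ys Zs; apply: hI; rewrite inE ?Ys ?Zs orbT.
- by move=> Y Ys; apply: hA; rewrite inE Ys orbT.
rewrite [X in (_ + X)%N = _ -> _]eq_card0 ?addn0; last first.
  move=> v; rewrite !inE; apply/negbTE/negP => /andP[/andP[vA vX] /andP[_ /hasP[Y Ys vY]]].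
  have XY : X != Y by apply: contraNneq Xs => ->.
  have := hI X Y; rewrite !inE eqxx Ys orbT => /(_ isT isT XY)/subvP/(_ v).
  by rewrite memv_cap vX vY (negPf vA) => /(_ isT).
have [AX dX] : (A <= X)%VS /\ \dim X = k by apply: hA; rewrite inE eqxx.
have -> : #|[set v | (v \notin A) && (v \in X)]| = (q ^ k - q ^ \dim A)%N.
  rewrite -dX -!card_vs_set -cardsDS; last first.
    by apply/subsetP => v; rewrite !inE; apply/subvP.
  by apply: eq_card => v; rewrite !inE.
rewrite mulSn => <-; apply: eq_card => v; rewrite !inE.
by case: (v \in A).
Qed.

Lemma card_cover A k S :
  (forall X, X \in S -> (A <= X)%VS /\ \dim X = k) ->
  (forall X Y, X \in S -> Y \in S -> X != Y -> (X :&: Y <= A)%VS) ->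
  #|[set v | (v \notin A) && has (fun X : {vspace V} => v \in X) S]|
    = (#|` S| * (q ^ k - q ^ \dim A))%N.
Proof. by move=> hA hI; apply: card_cover_seq; rewrite ?fset_uniq. Qed.

Lemma dim_add_line A v : v \notin A -> \dim (A + <[v]>) = (\dim A).+1.
Proof.
move=> vA; rewrite dimv_disjoint_sum ?dim_vline.
  by case: eqP vA => [->|_ _]; rewrite ?mem0v ?addn1.
apply/eqP; rewrite -subv0; apply/subvP => w; rewrite memv_cap memv0.
case/andP => wA /vlineP[c ew]; rewrite ew scaler_eq0; case: eqP => //= /eqP c0.
by case/negP: vA; rewrite -[v](scalerK c0) -ew memvZ.
Qed.

(** For [A] contained in [B] these are the subspaces between them of dimension one more than [A]. In
    particular [pencil 0 m] is the set of points of [m]. *)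
Definition pencil A B : {fset {vspace V}} :=
  (fun v => (A + <[v]>)%VS) @` [fset v in B | v \notin A].

Lemma pencilP A B X : (A <= B)%VS ->
  reflect [/\ (A <= X)%VS, (X <= B)%VS & \dim X = (\dim A).+1] (X \in pencil A B).
Proof.
move=> AB; apply: (iffP (imfsetP _ _ _ _)) => [[v /=] | [AX XB dX]].
  rewrite !inE /= => /andP[vB vA] ->; split; rewrite ?addvSl ?dim_add_line //.
  by rewrite subv_add AB -memvE.
have: ~~ (X <= A)%VS by apply/negP => /dimvS; rewrite dX ltnn.
case/subvPn => v vX vA; exists v; first by rewrite /= !inE /= (subvP XB _ vX) vA.
by apply/eqP; rewrite eq_sym eqEdim subv_add AX -memvE vX dX dim_add_line ?leqnn.
Qed.

(** The members of the pencil partition the vectors of [B] outside [A]. The form with a successor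
    avoids the division in (q^r-1)/(q-1). *)
Lemma card_pencil A B r : (A <= B)%VS -> \dim B = (\dim A + r)%N ->
  (#|` pencil A B| * q.-1).+1 = (q ^ r)%N.
Proof.
move=> AB dB.
have h1 X : X \in pencil A B -> (A <= X)%VS /\ \dim X = (\dim A).+1.
  by case/(pencilP _ AB).
have := @card_cover A _ (pencil A B) h1 _.
have -> : #|[set v | (v \notin A) && has (fun X : {vspace V} => v \in X) (pencil A B)]|
    = (q ^ \dim B - q ^ \dim A)%N.
  rewrite -!card_vs_set -cardsDS; last first.
    by apply/subsetP => v; rewrite !inE; apply/subvP.
  apply: eq_card => v; rewrite !inE; case vA: (v \in A) => //=.
  apply/hasP/idP => [[X /(pencilP _ AB)[_ /subvP XB _] /XB] //|vB].
  exists (A + <[v]>)%VS; last by rewrite memvE addvSr.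
  by apply/pencilP => //; split; rewrite ?addvSl ?dim_add_line ?vA // subv_add AB -memvE.
move=> e; have q1 := q_gt1; have {}e := e _.
have qa : (0 < q ^ \dim A)%N by rewrite expn_gt0; lia.
apply/eqP; rewrite -(eqn_pmul2l qa); apply/eqP.
rewrite -expnD -dB mulnS mulnCA.
have -> : (q ^ \dim A * q.-1 = q ^ (\dim A).+1 - q ^ \dim A)%N.
  by rewrite expnSr -subn1 mulnBr muln1.
rewrite -e; first by rewrite subnKC // leq_exp2l // dimvS.
move=> X Y /(pencilP _ AB)[AX XB dX] /(pencilP _ AB)[AY YB dY] XY.
have AI : (A <= X :&: Y)%VS by rewrite subv_cap AX.
rewrite -(geq_leqif (dimv_leqif_sup AI)) -ltnS -dX ltn_neqAle dimvS ?capvSl // andbT.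
apply: contraNneq XY => e'; have /eqP eX : (X :&: Y)%VS == X.
  by rewrite eqEdim capvSl e' leqnn.
by rewrite eqEdim dX dY leqnn andbT -eX capvSr.
Qed.

Lemma card_pencil2 A B : (A <= B)%VS -> \dim B = (\dim A).+2 ->
  #|` pencil A B| = (q + 1)%N.
Proof.
move=> AB dB; have := card_pencil (r := 2) AB; rewrite addn2 => /(_ dB) e.
have q1 := q_gt1; have [k hk] : exists k, q = k.+2 by exists q.-2; lia.
move: e; rewrite hk /=; nia.
Qed.

Lemma card_pencil3 A B : (A <= B)%VS -> \dim B = (\dim A).+3 ->
  #|` pencil A B| = (q ^ 2 + q + 1)%N.
Proof.
move=> AB dB; have := card_pencil (r := 3) AB; rewrite addn3 => /(_ dB) e.
have q1 := q_gt1; have [k hk] : exists k, q = k.+2 by exists q.-2; lia.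
move: e; rewrite hk /= !expnS expn0; nia.
Qed.

End VectorCounting.

(** * Caps of size Q^2+1 in PG(3,Q) *)

Section Points.

Variables (K : fieldType) (V : vectType K).
Implicit Types (A B P R W : {vspace V}).

Lemma pt_capv P A : \dim P = 1%N -> ~~ (P <= A)%VS -> (A :&: P)%VS = 0%VS.
Proof.
move=> dP nPA; apply/eqP; rewrite -dimv_eq0 eqn0Ngt; apply: contra nPA => gt0.
have /eqP <- : (A :&: P)%VS == P by rewrite eqEdim capvSr dP.
exact: capvSl.
Qed.

Lemma dim_add_pt P A : \dim P = 1%N -> ~~ (P <= A)%VS ->
  \dim (A + P) = (\dim A).+1.
Proof. by move=> dP nPA; rewrite dimv_disjoint_sum ?pt_capv // dP addn1. Qed.

Lemma pt_eq P R : \dim P = 1%N -> \dim R = 1%N -> (P <= R)%VS -> P = R.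
Proof. by move=> dP dR PR; apply/eqP; rewrite eqEdim PR dP dR. Qed.

Lemma dim_add_pts P R : \dim P = 1%N -> \dim R = 1%N -> P != R ->
  \dim (P + R) = 2.
Proof.
move=> dP dR PR; rewrite dim_add_pt ?dP //.
by apply: contra PR => /(pt_eq dR dP) ->.
Qed.

Lemma add_pt_eq P A B : \dim P = 1%N -> ~~ (P <= A)%VS -> (A <= B)%VS ->
  (P <= B)%VS -> \dim B = (\dim A).+1 -> (A + P)%VS = B.
Proof.
move=> dP nPA AB PB dB; apply/eqP.
by rewrite eqEdim subv_add AB PB dB dim_add_pt ?leqnn.
Qed.

Lemma join_pts P R l : \dim P = 1%N -> \dim R = 1%N -> P != R ->
  (P <= l)%VS -> (R <= l)%VS -> \dim l = 2 -> (P + R)%VS = l.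
Proof.
move=> dP dR PR Pl Rl dl; apply: add_pt_eq; rewrite ?dP //.
by apply: contra PR => /(pt_eq dR dP) ->.
Qed.

Lemma dim_cap_eq A B W k : (A <= W)%VS -> (B <= W)%VS -> A != B ->
  \dim A = k.+1 -> \dim B = k.+1 -> \dim W = k.+2 -> \dim (A :&: B) = k.
Proof.
move=> AW BW AB dA dB dW.
have le : (\dim (A + B) <= k.+2)%N by rewrite -dW dimvS // subv_add AW.
have := dimv_sum_cap A B; rewrite dA dB.
suff : (k.+1 < \dim (A + B))%N by lia.
rewrite -dA ltn_neqAle dimvS ?addvSl // andbT; apply: contra AB => /eqP e.
have /eqP eA : A == (A + B)%VS by rewrite eqEdim addvSl e leqnn.
by rewrite eq_sym eqEdim dA dB leqnn andbT eA addvSr.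
Qed.

End Points.

Section Caps.

Opaque subsetv dimv addv capv pencil.

Variables (K : finFieldType).
Local Notation V := 'rV[K]_4.
Local Notation Q := #|K|.
Variable C : {fset {vspace V}}.
Hypothesis capC : is_cap C.
Hypothesis cardC : #|` C| = (Q ^ 2 + 1)%N.
Implicit Types (P R X Y Z N l s t W : {vspace V}).

Let Q_gt1 : (1 < Q)%N := q_gt1 K.

Lemma dimC P : P \in C -> \dim P = 1%N.
Proof. by case: capC => h _; apply: h. Qed.

Lemma dimV4 : \dim {:V} = 4%N.
Proof. by rewrite dimvf dim_matrix. Qed.

Lemma cap_line X Y Z : X \in C -> Y \in C -> X != Y -> Z \in C ->
  (Z <= X + Y)%VS -> Z = X \/ Z = Y.
Proof.
move=> XC YC XY ZC ZXY.
have [|ZX] := eqVneq Z X; first by left.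
have [|ZY] := eqVneq Z Y; first by right.
have [_ /(_ _ _ _ XC YC ZC)] := capC.
rewrite /= !inE negb_or XY eq_sym ZX eq_sym ZY /= => /(_ isT).
by rewrite (addv_idPl ZXY) dim_add_pts ?dimC.
Qed.

Definition sec W : {fset {vspace V}} := [fset Z in C | (Z <= W)%VS].

Lemma in_sec Z W : (Z \in sec W) = (Z \in C) && (Z <= W)%VS.
Proof. exact: in_sep. Qed.

Lemma secS W W' : (W <= W')%VS -> sec W `<=` sec W'.
Proof.
move=> WW; apply/fsubsetP => Z; rewrite !in_sec => /andP[-> ZW].
exact: subv_trans WW.
Qed.

Lemma sec_line X Y : X \in C -> Y \in C -> X != Y -> sec (X + Y) = [fset X; Y].
Proof.
move=> XC YC XY; apply/fsetP => Z; rewrite in_sec in_fset2.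
apply/andP/orP => [[ZC /(cap_line XC YC XY ZC)[]->]|[]/eqP ->].
- by left.
- by right.
- by split; last exact: addvSl.
- by split; last exact: addvSr.
Qed.

Definition tan l P := (\dim l == 2) && (sec l == [fset P]).

Lemma tanP l P : tan l P -> [/\ \dim l = 2, P \in C, (P <= l)%VS &
  forall Z, Z \in C -> (Z <= l)%VS -> Z = P].
Proof.
case/andP => /eqP dl /eqP sl; have : P \in sec l by rewrite sl in_fset1.
rewrite in_sec => /andP[PC Pl]; split=> // Z ZC Zl.
by apply/eqP; rewrite -in_fset1 -sl in_sec ZC.
Qed.

Lemma tanI l P : \dim l = 2 -> P \in C -> (P <= l)%VS ->
  (forall Z, Z \in C -> (Z <= l)%VS -> Z = P) -> tan l P.
Proof.
move=> dl PC Pl h; rewrite /tan dl eqxx; apply/eqP/fsetP => Z.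
rewrite in_sec in_fset1; apply/andP/eqP => [[ZC Zl]|-> //]; exact: h.
Qed.

Lemma join_inj P X Y : P \in C -> X \in C -> Y \in C -> X != P -> Y != P ->
  (P + X = P + Y)%VS -> X = Y.
Proof.
move=> PC XC YC XP YP e.
have : (Y <= P + X)%VS by rewrite e addvSr.
rewrite eq_sym in XP; case/(cap_line PC XC XP YC) => // eY.
by rewrite eY eqxx in YP.
Qed.

Definition secants P W := (fun Z => (P + Z)%VS) @` (sec W `\ P).

(** No three points of the cap are collinear, so different points have different joins with [P]. *)
Lemma card_secants P W : P \in C -> (P <= W)%VS ->
  #|` sec W| = (#|` secants P W|).+1.
Proof.
move=> PC PW; rewrite (cardfsD1 P) in_sec PC PW add1n /secants card_imfset_in //.
move=> X Y; rewrite /= !in_fsetD1 !in_sec => /and3P[XP XC _] /and3P[YP YC _].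
exact: join_inj.
Qed.

Lemma secants_sub P W : P \in C -> (P <= W)%VS -> secants P W `<=` pencil P W.
Proof.
move=> PC PW; apply/fsubsetP => _ /imfsetP[Z /= + ->].
rewrite !in_fsetD1 in_sec => /and3P[ZP ZC ZW]; apply/pencilP => //.
by rewrite addvSl subv_add PW ZW dim_add_pts ?dimC // eq_sym.
Qed.

Lemma tan_secants P W l : P \in C -> (P <= W)%VS ->
  (tan l P && (l <= W)%VS) = (l \in pencil P W `\` secants P W).
Proof.
move=> PC PW; rewrite in_fsetD; apply/andP/andP => [[/tanP[dl _ Pl h] lW]|].
  split; last by apply/(pencilP _ PW); rewrite (dimC PC).
  by apply/negP => /imfsetP[Z /=]; rewrite in_fsetD1 in_sec => /and3P[ZP ZC _] e;
     case/eqP: ZP; apply: h => //; rewrite e addvSr.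
case=> nsec /(pencilP _ PW)[Pl lW]; rewrite (dimC PC) => dl; split=> //.
apply: tanI => // Z ZC Zl; apply/eqP; apply: contraNT nsec => ZP.
apply/imfsetP; exists Z; first by rewrite /= in_fsetD1 ZP in_sec ZC (subv_trans Zl).
by rewrite (@join_pts _ _ P Z l) ?(dimC PC) ?(dimC ZC) // eq_sym.
Qed.

(** The secants at a point of the section are among the Q+1 lines of the plane through it. *)
Lemma arc_max s : \dim s = 3 -> (#|` sec s| <= Q + 2)%N.
Proof.
move=> ds; have [->|[P]] := fset_0Vmem (sec s); first by rewrite cardfs0.
rewrite in_sec => /andP[PC Ps]; rewrite (card_secants PC Ps).
have := fsubset_leq_card (secants_sub PC Ps).
by rewrite card_pencil2 ?(dimC PC) // addn2 addn1 ltnS.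
Qed.

(** The tangent takes up one of the Q+1 lines at its point of contact, leaving at most Q secants. *)
Lemma arc_tangent s l P : \dim s = 3 -> (l <= s)%VS -> tan l P ->
  (#|` sec s| <= Q + 1)%N.
Proof.
move=> ds ls tl; have [_ PC Pl _] := tanP tl; have Ps := subv_trans Pl ls.
have : l \in pencil P s `\` secants P s by rewrite -tan_secants // tl ls.
move=> lin; have gt0 : (0 < #|` pencil P s `\` secants P s|)%N.
  by rewrite cardfs_gt0; apply/fset0Pn; exists l.
move: gt0; rewrite cardfsDS ?secants_sub // subn_gt0 card_pencil2 ?(dimC PC) //.
by rewrite (card_secants PC Ps).
Qed.

Lemma oval_tangent s P : \dim s = 3 -> #|` sec s| = (Q + 1)%N -> P \in sec s ->
  exists l, [/\ (l <= s)%VS, tan l P &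
    forall l', (l' <= s)%VS -> tan l' P -> l' = l].
Proof.
move=> ds cs; rewrite in_sec => /andP[PC Ps].
have /eqP/cardfs1P[l el] : #|` pencil P s `\` secants P s| = 1%N.
  rewrite cardfsDS ?secants_sub // card_pencil2 ?(dimC PC) //.
  by move: cs; rewrite (card_secants PC Ps); lia.
have in_l l' : (tan l' P && (l' <= s)%VS) = (l' == l).
  by rewrite tan_secants // el in_fset1.
have /andP[tl ls] : tan l P && (l <= s)%VS by rewrite in_l.
by exists l; split=> // l' ls' tl'; apply/eqP; rewrite -in_l tl' ls'.
Qed.

Lemma hyperoval_tangent s l P : \dim s = 3 -> (l <= s)%VS ->
  #|` sec s| = (Q + 2)%N -> ~~ tan l P.
Proof. by move=> ds ls cs; apply/negP => /(arc_tangent ds ls); rewrite cs; lia. Qed.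

(* The lines joining [R] to the points of the section partition it into parts of
   size one or two. *)
Lemma odd_tangent s R : \dim R = 1%N -> R \notin C -> (R <= s)%VS ->
  odd #|` sec s| -> exists2 X, X \in sec s & tan (R + X) X.
Proof.
move=> dR RC Rs os.
case: (boolP [exists X : sec s, tan (R + val X) (val X)]).
  by case/existsP => -[X XC] /= h; exists X.
rewrite negb_exists => /forallP none; suff: ~~ odd #|` sec s| by rewrite os.
have nR X : X \in C -> R != X by move=> XC; apply: contraNneq RC => ->.
have dRX X : X \in C -> \dim (R + X) = 2 by move=> XC; rewrite dim_add_pts ?(dimC XC) ?dR ?nR.
have eRX X Y : X \in C -> Y \in C -> (Y <= R + X)%VS -> (R + Y = R + X)%VS.
  by move=> XC YC Yl; rewrite (@join_pts _ _ R Y (R + X)) ?dR ?(dimC YC) ?nR ?addvSl ?dRX.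
rewrite (@eq_card_fibers _ _ (fun X => (R + X)%VS) _ 2) ?muln2 ?odd_double //.
move=> _ /imfsetP[X /= Xs ->]; have := none [` Xs] => /= nt.
move: (Xs); rewrite in_sec => /andP[XC Xl].
have [Y YC [Yl XY]] : exists2 Y, Y \in C & (Y <= R + X)%VS /\ X != Y.
  move: nt; rewrite /tan dRX //= => ns.
  have : sec (R + X) `\ X != fset0.
    apply: contraNneq ns => e; apply/eqP; rewrite -(@fsetD1K _ X (sec (R + X))) ?e ?fsetU0 //.
    by rewrite in_sec XC addvSr.
  case/fset0Pn => Y; rewrite in_fsetD1 in_sec => /and3P[YX YC Yl].
  by exists Y => //; split=> //; rewrite eq_sym.
rewrite (_ : [fset _ in _ | _] = [fset X; Y]) ?cardfs2 ?XY //.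
apply/fsetP => Z; rewrite in_sep in_fset2 in_sec; apply/idP/idP.
  case/andP => /andP[ZC Zs] /eqP e.
  have : (Z <= X + Y)%VS.
    rewrite (@join_pts _ _ X Y (R + X)) ?(dimC XC) ?(dimC YC) ?addvSr ?dRX //.
    by rewrite -e addvSr.
  by case/(cap_line XC YC XY ZC) => ->; rewrite eqxx ?orbT.
case/orP => /eqP ->; rewrite ?XC ?Xl ?eqxx //=.
by rewrite YC (eRX X Y XC YC Yl) eqxx andbT (subv_trans Yl) // subv_add Rs.
Qed.

(** A section of Q+2 points would have odd size, so every point of the plane off the cap would lie
    on a tangent; but such a section leaves no line for a tangent. The secant through two of its
    points supplies a point off the cap, since it has Q+1 > 2 points. *)
Lemma odd_arc_max s : odd Q -> \dim s = 3 -> (#|` sec s| <= Q + 1)%N.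
Proof.
move=> oQ ds; have := arc_max ds; rewrite leq_eqVlt => /orP[/eqP cs|]; last by lia.
have gt1 : (1 < #|` sec s|)%N by rewrite cs; lia.
have [P Ps] : exists P, P \in sec s.
  by apply/fset0Pn; rewrite -cardfs_gt0; lia.
have [X Xs XP] := card_ge2_fset gt1 P.
move: (Ps) (Xs); rewrite !in_sec => /andP[PC Pl] /andP[XC Xl].
have dPX : \dim (P + X) = 2 by rewrite dim_add_pts ?dimC // eq_sym.
have sl : (P + X <= s)%VS by rewrite subv_add Pl.
have : (#|` sec (P + X)| < #|` pencil 0 (P + X)|)%N.
  have PX : P != X by rewrite eq_sym.
  rewrite card_pencil2 ?sub0v ?dimv0 // (sec_line PC XC) // cardfs2 PX.
  by rewrite addn1 ltnS.
move=> lt; have [R Rp RC] : exists2 R, R \in pencil 0 (P + X) & R \notin sec (P + X).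
  have : ~~ (pencil 0 (P + X) `<=` sec (P + X)).
    by apply/negP => /fsubset_leq_card; rewrite leqNgt lt.
  by case/fsubsetPn => R; exists R.
have [_ Rl] := pencilP _ (sub0v _) Rp; rewrite dimv0 => dR.
have nRC : R \notin C by move: RC; rewrite in_sec Rl andbT.
have os : odd #|` sec s| by rewrite cs oddD oQ.
have [Y Ys tY] := odd_tangent dR nRC (subv_trans Rl sl) os.
have := hyperoval_tangent (l := (R + Y)%VS) Y ds _ cs.
rewrite tY subv_add (subv_trans Rl sl); move: Ys; rewrite in_sec => /andP[_ ->].
by move=> /(_ isT).
Qed.

Lemma card_sec_gt P k : (k < #|` sec P|)%N -> exists X, X \in sec P.
Proof. by move=> gt; apply/fset0Pn; rewrite -cardfs_gt0; lia. Qed.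

(** Each point off [l] lies on exactly one plane through [l], so counting over these planes is
    counting fibres of the join with [l]. *)
Lemma plane_fiber l t : \dim l = 2 -> (l <= t)%VS -> \dim t = 3 ->
  [fset Z in C `\` sec l | (l + Z)%VS == t] = sec t `\` sec l.
Proof.
move=> dl lt dt; apply/fsetP => Z; rewrite in_sep !in_fsetD !in_sec.
case ZC: (Z \in C) => //=; case Zl: (Z <= l)%VS => //=; apply/eqP/idP => [<-|Zt].
  exact: addvSr.
by apply: add_pt_eq; rewrite ?Zl ?dl ?(dimC ZC).
Qed.

Lemma plane_image l : \dim l = 2 ->
  (fun Z => (l + Z)%VS) @` (C `\` sec l) `<=` pencil l fullv.
Proof.
move=> dl; apply/fsubsetP => _ /imfsetP[Z /= + ->].
rewrite in_fsetD in_sec => /andP[+ ZC]; rewrite ZC /= => Zl.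
by apply/pencilP; rewrite ?subvf //; split; rewrite ?subvf ?addvSl ?dim_add_pt ?(dimC ZC).
Qed.

Lemma card_planes l : \dim l = 2 -> #|` pencil l fullv| = (Q + 1)%N.
Proof. by move=> dl; rewrite card_pencil2 ?subvf // dl dimV4. Qed.

Lemma planes_max l k : \dim l = 2 -> (0 < k)%N ->
  #|` C `\` sec l| = ((Q + 1) * k)%N ->
  (forall t, \dim t = 3 -> (l <= t)%VS -> #|` sec t `\` sec l| <= k)%N ->
  forall t, \dim t = 3 -> (l <= t)%VS -> #|` sec t `\` sec l| = k.
Proof.
move=> dl k0 cC hk.
have fib y : y \in (fun Z => (l + Z)%VS) @` (C `\` sec l) ->
    (l <= y)%VS /\ \dim y = 3.
  by move/(fsubsetP (plane_image dl))/(pencilP _ (subvf l)) => [? _]; rewrite dl.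
have le y : y \in (fun Z => (l + Z)%VS) @` (C `\` sec l) ->
    (#|` [fset Z in C `\` sec l | (l + Z)%VS == y]| <= k)%N.
  by move=> /fib[ly dy]; rewrite plane_fiber ?hk.
have := max_card_fibers le _ cC k0; rewrite -(card_planes dl).
rewrite fsubset_leq_card ?plane_image // => /(_ isT)[eN ek] t dt lt.
have ti : t \in (fun Z => (l + Z)%VS) @` (C `\` sec l).
  have /eqP -> : (fun Z => (l + Z)%VS) @` (C `\` sec l) == pencil l fullv.
    by rewrite eqEfcard plane_image // eN leqnn.
  by apply/pencilP; rewrite ?subvf // dl.
by rewrite -plane_fiber // ek.
Qed.

Lemma card_secD l t : (l <= t)%VS -> #|` sec t `\` sec l| = (#|` sec t| - #|` sec l|)%N.
Proof. by move=> lt; rewrite cardfsDS ?secS. Qed.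

Lemma sec_full : sec fullv = C.
Proof. by apply/fsetP => Z; rewrite in_sec subvf andbT. Qed.

Lemma card_CD l : #|` C `\` sec l| = (Q ^ 2 + 1 - #|` sec l|)%N.
Proof. by rewrite -{1}sec_full card_secD ?subvf // sec_full cardC. Qed.

Lemma secant_planes X Y : X \in C -> Y \in C -> X != Y ->
  (forall t, \dim t = 3 -> (X + Y <= t)%VS -> #|` sec t| <= Q + 1)%N ->
  forall t, \dim t = 3 -> (X + Y <= t)%VS -> #|` sec t| = (Q + 1)%N.
Proof.
move=> XC YC XY hk t dt lt.
have dl : \dim (X + Y) = 2 by rewrite dim_add_pts ?(dimC XC) ?(dimC YC).
have cl : #|` sec (X + Y)| = 2 by rewrite sec_line // cardfs2 XY.
have := @planes_max (X + Y) Q.-1 dl _ _ _ t dt lt.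
rewrite card_secD // cl => h.
suff : (#|` sec t| - 2 = Q.-1)%N by lia.
apply: h; first by lia.
  by rewrite card_CD cl; move: Q_gt1; case: Q => // k _; rewrite expnS expn1 /=; lia.
by move=> u du lu; rewrite card_secD // cl; have := hk u du lu; lia.
Qed.

(* The Q^2-1 points of [C] off a secant lie on the Q+1 planes through it, each
   of which contains at most Q-1 of them. *)
Lemma good_of_arcs P : P \in C ->
  (forall t, \dim t = 3 -> (P <= t)%VS -> #|` sec t| <= Q + 1)%N ->
  forall X Y, X \in C -> Y \in C -> uniq [:: P; X; Y] ->
  #|` sec (P + X + Y)| = (Q + 1)%N.
Proof.
move=> PC hk X Y XC YC u; apply: (@secant_planes P X); rewrite ?addvSl //.
- by move: u; rewrite /= !inE negb_or => /andP[/andP[]].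
- by move=> t dt lt; apply: hk => //; apply: subv_trans lt; apply: addvSl.
- by case: capC => _; apply.
Qed.

(** Otherwise each of the Q+1 planes through [l] has at most Q points, hence at most Q-1 besides
    [P]. This accounts for at most Q^2-1 of the Q^2 points of the cap other than [P]. *)
Lemma tangent_oval l P : tan l P -> exists t,
  [/\ \dim t = 3, (l <= t)%VS & #|` sec t| = (Q + 1)%N].
Proof.
move=> tl; have [dl PC Pl _] := tanP tl.
have cl : #|` sec l| = 1%N by case/andP: tl => _ /eqP ->; rewrite cardfs1.
case: (boolP (has (fun t => #|` sec t| == Q + 1)%N (pencil l fullv))).
  case/hasP => t /(pencilP _ (subvf l))[lt _]; rewrite dl => dt /eqP ct.
  by exists t.
move/hasPn => none; exfalso.
have : (#|` C `\` sec l| <= (Q + 1) * Q.-1)%N.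
  apply: leq_trans (leq_card_fibers (f := fun Z => (l + Z)%VS) (k := Q.-1) _) _.
    move=> t /(fsubsetP (plane_image dl)) tp.
    have [lt _] := pencilP _ (subvf l) tp; rewrite dl => dt.
    rewrite plane_fiber // card_secD // cl.
    by have := none t tp; have := arc_tangent dt lt tl; lia.
  by rewrite leq_mul2r -(card_planes dl) fsubset_leq_card ?plane_image ?orbT.
rewrite card_CD cl; move: Q_gt1; case: Q => // k _; rewrite expnS expn1 /=; lia.
Qed.

Lemma oval_tangent_uniq s P l l' : \dim s = 3 -> #|` sec s| = (Q + 1)%N ->
  (l <= s)%VS -> (l' <= s)%VS -> tan l P -> tan l' P -> l = l'.
Proof.
move=> ds cs ls ls' tl tl'.
have Ps : P \in sec s.
  by have [_ PC Pl _] := tanP tl; rewrite in_sec PC (subv_trans Pl).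
have [l0 [_ _ h]] := oval_tangent ds cs Ps.
by rewrite (h l ls tl) (h l' ls' tl').
Qed.

Definition nucleus N s := [/\ \dim N = 1%N, N \notin C, (N <= s)%VS &
  forall X, X \in sec s -> tan (N + X) X].

(** The candidate is the intersection of the tangents at two points [P] and [P']. A secant [m]
    through it is refuted by comparing the points of [m] off the oval with the points of the oval
    off [m]. *)
Lemma exists_nucleus s : ~~ odd Q -> \dim s = 3 -> #|` sec s| = (Q + 1)%N ->
  exists N, nucleus N s.
Proof.
move=> eQ ds cs.
have os : odd #|` sec s| by rewrite cs oddD (negPf eQ).
have [P Ps] : exists P, P \in sec s by apply: (@card_sec_gt _ 0); lia.
have [P' P's PP'] := card_ge2_fset (ltac:(lia) : 1 < #|` sec s|)%N P.
move: (Ps) (P's); rewrite !in_sec => /andP[PC Pl] /andP[P'C P'l].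
have [l [ls tl _]] := oval_tangent ds cs Ps.
have [l' [ls' tl' _]] := oval_tangent ds cs P's.
have [[dl _ Plt hl] [dl' _ P'l' hl']] := (tanP tl, tanP tl').
have ll' : l != l' by apply: contraNneq PP' => e; rewrite (hl P') ?e.
have dN : \dim (l :&: l') = 1%N by apply: (dim_cap_eq ls ls').
set N := (l :&: l')%VS in dN *.
have NC : N \notin C.
  apply/negP => NC; have := hl N NC (capvSl _ _); have := hl' N NC (capvSr _ _).
  by move=> -> e; rewrite e eqxx in PP'.
have Ns : (N <= s)%VS by apply: subv_trans ls; apply: capvSl.
exists N; split; [exact: dN|exact: NC|exact: Ns|].
move=> X Xs; apply: contraT => nt.
move: (Xs); rewrite in_sec => /andP[XC Xl].
have nN Z : Z \in C -> N != Z by move=> ZC; apply: contraNneq NC => ->.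
have dNX : \dim (N + X) = 2 by rewrite dim_add_pts ?dN ?(dimC XC) ?nN.
have [Y YC [Yl XY]] : exists2 Y, Y \in C & (Y <= N + X)%VS /\ X != Y.
  move: nt; rewrite /tan dNX /= => ns.
  have : sec (N + X) `\ X != fset0.
    apply: contraNneq ns => e; apply/eqP; rewrite -(@fsetD1K _ X (sec (N + X))) ?e ?fsetU0 //.
    by rewrite in_sec XC addvSr.
  case/fset0Pn => Y; rewrite in_fsetD1 in_sec => /and3P[YX YC Yl].
  by exists Y => //; split=> //; rewrite eq_sym.
set m := (N + X)%VS in dNX Yl nt *.
have mXY : (X + Y)%VS = m.
  by apply: join_pts; rewrite ?(dimC XC) ?(dimC YC) ?addvSr.
have ms : (m <= s)%VS by rewrite subv_add Ns.
have Ys : Y \in sec s by rewrite in_sec YC (subv_trans Yl).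
have sm : sec m = [fset X; Y] by rewrite -mXY sec_line.
have smp : sec m `<=` pencil 0 m.
  apply/fsubsetP => Z; rewrite in_sec => /andP[ZC Zm]; apply/pencilP.
    exact: sub0v.
  by rewrite sub0v dimv0 (dimC ZC).
have offP R : R \in pencil 0 m `\` sec m -> [/\ \dim R = 1%N, (R <= m)%VS & R \notin C].
  rewrite in_fsetD in_sec => /andP[+ /(pencilP _ (sub0v _))[_ Rm]].
  by rewrite dimv0 Rm andbT.
have offI R Z : R \in pencil 0 m `\` sec m -> Z \in C -> tan (R + Z) Z -> ~~ (Z <= m)%VS.
  move=> /offP[dR Rm RC] ZC tZ; apply/negP => Zm.
  have e : (R + Z)%VS = m.
    by apply: join_pts; rewrite ?(dimC ZC) //; apply: contraNneq RC => ->.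
  have [_ _ _ h] := tanP tZ; rewrite e in h.
  have hX : X = Z by apply: h XC _; exact: addvSr.
  by case/eqP: XY; rewrite hX (h Y YC Yl).
have off_sm Z l0 : tan l0 Z -> (N <= l0)%VS -> Z \notin sec m.
  move=> t0 Nl0; have [dl0 ZC Zl0 h] := tanP t0; apply/negP.
  rewrite in_sec ZC /= => Zm.
  have e : m = l0.
    by rewrite -(@join_pts _ _ N Z m) ?(dimC ZC) ?nN ?addvSl //;
       apply: join_pts; rewrite ?(dimC ZC) ?nN.
  have hX : X = Z by apply: h XC _; rewrite -e; exact: addvSr.
  have hY : Y = Z by apply: h YC _; rewrite -e.
  by case/eqP: XY; rewrite hX hY.
have Nl : (N <= l)%VS by apply: capvSl.
have Nl' : (N <= l')%VS by apply: capvSr.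
have tN Z l0 : tan l0 Z -> (N <= l0)%VS -> tan (N + Z) Z.
  move=> t0 Nl0; have [dl0 ZC Zl0 _] := tanP t0.
  by rewrite (@join_pts _ _ N Z l0) ?(dimC ZC) ?nN.
case/eqP: PP'.
(* Each of the Q-1 points off [C] on the secant [m] is on a tangent at one of the
   Q-1 remaining points of the oval, whereas [N] is on two tangents. *)
apply: (@matching_functional _ _ (fun R Z => tan (R + Z) Z)
  (pencil 0 m `\` sec m) (sec s `\` sec m) _ _ _ N).
- move=> R Rp; have [dR Rm RC] := offP R Rp.
  have [Z' Z's tZ'] := odd_tangent dR RC (subv_trans Rm ms) os.
  exists Z' => //; rewrite in_fsetD Z's andbT in_sec.
  move: Z's; rewrite in_sec => /andP[Z'C _]; rewrite Z'C /=.
  exact: offI tZ'.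
- move=> R R' Z' Rp R'p; rewrite in_fsetD !in_sec => /and3P[_ _ Z's] tR tR'.
  have [[dR Rm RC] [dR' R'm R'C]] := (offP R Rp, offP R' R'p).
  apply/eqP; apply: contraT => RR'.
  have [dRZ Z'C _ _] := tanP tR.
  case/negP: (offI R Z' Rp Z'C tR).
  have e : (R + Z' = R' + Z')%VS.
    apply: (oval_tangent_uniq ds cs _ _ tR tR').
      by rewrite subv_add Z's (subv_trans Rm ms).
    by rewrite subv_add Z's (subv_trans R'm ms).
  rewrite -(join_pts dR dR' RR' Rm R'm dNX).
  by rewrite (join_pts dR dR' RR' _ _ dRZ) ?addvSl ?addvSr // e addvSl.
- rewrite card_secD // cardfsDS // cs sm cardfs2 XY card_pencil2 ?sub0v //.
  by rewrite dimv0.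
- rewrite in_fsetD in_sec (negPf NC) /=; apply/(pencilP _ (sub0v _)).
  by split; [exact: sub0v | exact: addvSl | rewrite dimv0].
- by rewrite in_fsetD P's andbT; apply: off_sm tl' _.
- by rewrite in_fsetD Ps andbT; apply: off_sm tl _.
- exact: tN tl' _.
- exact: tN tl _.
Qed.

Lemma not_tan l P : \dim l = 2 -> P \in C -> (P <= l)%VS -> ~~ tan l P ->
  exists Y, [/\ Y \in C, Y != P & (Y <= l)%VS].
Proof.
move=> dl PC Pl; rewrite /tan dl /= => ns.
have : sec l `\ P != fset0.
  apply: contraNneq ns => e; apply/eqP.
  by rewrite -(@fsetD1K _ P (sec l)) ?e ?fsetU0 // in_sec PC.
case/fset0Pn => Y; rewrite in_fsetD1 in_sec => /and3P[YP YC Yl].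
by exists Y.
Qed.

Lemma dim_join_pt N X : \dim N = 1%N -> N \notin C -> X \in C -> \dim (N + X) = 2.
Proof.
by move=> dN NC XC; rewrite dim_add_pts ?dN ?(dimC XC) //; apply: contraNneq NC => ->.
Qed.

Lemma join_pt N X l : \dim N = 1%N -> N \notin C -> X \in C -> (N <= l)%VS ->
  (X <= l)%VS -> \dim l = 2 -> (N + X)%VS = l.
Proof.
move=> dN NC XC Nl Xl dl; apply: join_pts; rewrite ?(dimC XC) //.
by apply: contraNneq NC => ->.
Qed.

Lemma cap_planes s t : \dim s = 3 -> \dim t = 3 -> s != t -> \dim (s :&: t) = 2.
Proof. by move=> ds dt st; apply: (dim_cap_eq (W := fullv)); rewrite ?subvf ?dimV4. Qed.

(** Any other plane through [P] meets [s] in a tangent at [P]. *)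
Lemma tangent_plane_arcs P s : \dim s = 3 -> sec s = [fset P] ->
  forall t, \dim t = 3 -> (P <= t)%VS -> (#|` sec t| <= Q + 1)%N.
Proof.
move=> ds ss t dt Pt; have [->|ts] := eqVneq t s.
  by rewrite ss cardfs1 addn1.
have : P \in sec s by rewrite ss inE.
rewrite in_sec => /andP[PC Ps].
apply: (@arc_tangent t (t :&: s) P); rewrite ?capvSl //.
apply: tanI; rewrite ?cap_planes ?subv_cap ?Pt //.
move=> Z ZC; rewrite subv_cap => /andP[_ Zs]; apply/eqP.
by rewrite -in_fset1 -ss in_sec ZC.
Qed.

(** * Caps of PG(3,Q) for even Q *)

Section EvenOrder.

Hypothesis evenQ : ~~ odd Q.

Section Nucleus.

Variables (N s : {vspace V}).
Hypotheses (nucN : nucleus N s) (ds : \dim s = 3) (cs : #|` sec s| = (Q + 1)%N).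

Let dN : \dim N = 1%N. Proof. by case: nucN. Qed.
Let NC : N \notin C. Proof. by case: nucN. Qed.
Let Ns : (N <= s)%VS. Proof. by case: nucN. Qed.
Let tN X : X \in sec s -> tan (N + X) X. Proof. by case: nucN => _ _ _; apply. Qed.

(** The tangents at the Q+1 points of the oval all pass through [N] and are different, so they
    exhaust the Q+1 lines of [s] through [N]. *)
Lemma nucleus_lines l : \dim l = 2 -> (N <= l)%VS -> (l <= s)%VS ->
  exists2 X, X \in sec s & l = (N + X)%VS.
Proof.
move=> dl Nl ls; have : l \in (fun X => (N + X)%VS) @` sec s.
  rewrite (@imfset_onto _ _ _ _ (pencil N s)).
  - by apply/pencilP => //; rewrite dN.
  - move=> X Y Xs Ys e; have [_ XC _ h] := tanP (tN Xs).
    have [_ YC _ _] := tanP (tN Ys).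
    by apply/esym/h => //; rewrite e addvSr.
  - move=> X Xs; have [dX _ _ _] := tanP (tN Xs); apply/pencilP => //.
    by move: Xs; rewrite in_sec dX dN addvSl subv_add Ns => /andP[_ ->].
  by rewrite card_pencil2 ?dN // cs.
by case/imfsetP => X /= Xs ->; exists X.
Qed.

(** Another plane through [N] meets [s] in a line through [N], which is a tangent. *)
Lemma nucleus_planes t : \dim t = 3 -> (N <= t)%VS -> (#|` sec t| <= Q + 1)%N.
Proof.
move=> dt Nt; have [->|ts] := eqVneq t s; first by rewrite cs.
have dl := cap_planes dt ds ts.
have Nl : (N <= t :&: s)%VS by rewrite subv_cap Nt.
have [X Xs eX] := nucleus_lines dl Nl (capvSr _ _).
by apply: (@arc_tangent t (N + X) X); rewrite -?eX ?capvSl // eX tN.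
Qed.

Variables (X0 Y0 : {vspace V}).
Hypotheses (X0C : X0 \in C) (Y0C : Y0 \in C) (XY0 : X0 != Y0)
  (NXY : (N <= X0 + Y0)%VS).

Lemma secant_nucleus_planes X Y t : X \in C -> Y \in C -> X != Y ->
  (N <= X + Y)%VS -> \dim t = 3 -> (X + Y <= t)%VS -> #|` sec t| = (Q + 1)%N.
Proof.
move=> XC YC XY Nl; apply: secant_planes => // u du lu.
by apply: nucleus_planes => //; apply: subv_trans lu.
Qed.

(* Otherwise the plane spanned by the secant and the tangent is an oval section with two
   tangents through [N], so that [N] is its nucleus and lies on no secant of it. *)
Lemma nucleus_tangents Z : Z \in C -> tan (N + Z) Z -> (N + Z <= s)%VS.
Proof.
move=> ZC tZ; apply: contraT => nZs.
pose m := (X0 + Y0)%VS; have Nm : (N <= m)%VS := NXY.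
have dm : \dim m = 2 by rewrite dim_add_pts ?(dimC X0C) ?(dimC Y0C).
have Zm : ~~ (Z <= m)%VS.
  apply/negP => Zm; have e := join_pt dN NC ZC Nm Zm dm.
  have [_ _ _ h] := tanP tZ; rewrite e in h; move/eqP: XY0; apply.
  by rewrite (h X0 X0C (addvSl _ _)) (h Y0 Y0C (addvSr _ _)).
have dt : \dim (m + Z) = 3 by rewrite dim_add_pt ?dm ?(dimC ZC).
set t := (m + Z)%VS in dt.
have mt : (m <= t)%VS by apply: addvSl.
have ct : #|` sec t| = (Q + 1)%N by apply: (secant_nucleus_planes X0C Y0C).
have lt : (N + Z <= t)%VS by rewrite subv_add addvSr (subv_trans Nm).
have ts : t != s by apply: contraNneq nZs => <-.
have dl := cap_planes dt ds ts.
have Nl : (N <= t :&: s)%VS by rewrite subv_cap Ns (subv_trans Nm).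
have [W Ws eW] := nucleus_lines dl Nl (capvSr _ _).
have [N' [dN' N'C N't tN']] := exists_nucleus evenQ dt ct.
have tW := tN Ws.
have Zt : Z \in sec t by rewrite in_sec ZC addvSr.
have Wt : W \in sec t.
  move: Ws; rewrite !in_sec => /andP[-> _] /=.
  by apply: (@subv_trans _ _ (t :&: s)%VS); rewrite ?capvSl // eW addvSr.
have eZ : (N' + Z)%VS = (N + Z)%VS.
  by apply: (oval_tangent_uniq dt ct _ _ (tN' Z Zt) tZ); rewrite // subv_add N't addvSr.
have eW' : (N' + W)%VS = (N + W)%VS.
  apply: (oval_tangent_uniq dt ct _ _ (tN' W Wt) tW); last by rewrite -eW capvSl.
  by rewrite subv_add N't; move: Wt; rewrite in_sec => /andP[].
have NN' : N = N'.
  apply/eqP; apply: contraT => NN'; case/negP: nZs.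
  have -> : (N + Z = N + W)%VS; last by rewrite -eW capvSr.
  have [[dZ _ _ _] [dW _ _ _]] := (tanP tZ, tanP tW).
  rewrite -(join_pts dN dN' NN' _ _ dZ) ?addvSl -?eZ ?addvSl //.
  by apply: (join_pts dN dN' NN' _ _ dW); rewrite ?addvSl -?eW' ?addvSl.
have : tan (N' + X0) X0 by apply: tN'; rewrite in_sec X0C (subv_trans _ mt) ?addvSl.
rewrite -NN' (join_pt dN NC X0C Nm (addvSl _ _) dm) => /tanP[_ _ _ h].
by case/eqP: XY0; rewrite (h Y0 Y0C (addvSr _ _)).
Qed.

(** Let [l] be a tangent of the oval through [N], and suppose that no plane through it is tangent to
    the cap. Such a plane other than [s] contains a further point [Z]. The line [N + Z] is not a
    tangent, since it would lie in [s] and force [Z] onto [l]; so it is a secant through [N], and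
    the plane has Q+1 points. The planes through [l] would then contain (Q+1)Q points off [l], but
    the cap has only Q^2. *)
Lemma exists_tangent_plane : exists P t, \dim t = 3 /\ sec t = [fset P].
Proof.
have [P Ps] : exists P, P \in sec s by apply: (@card_sec_gt _ 0); rewrite cs addn1.
have [dl PC Pl hl] := tanP (tN Ps).
have cl : #|` sec (N + P)| = 1%N by case/andP: (tN Ps) => _ /eqP ->; rewrite cardfs1.
set l := (N + P)%VS in dl Pl hl cl.
have ls : (l <= s)%VS by move: Ps; rewrite in_sec subv_add Ns => /andP[].
case: (boolP (has (fun t => sec t == [fset P]) (pencil l fullv))).
  case/hasP => t /(pencilP _ (subvf l))[lt _]; rewrite dl => dt /eqP ct.
  by exists P, t.
move/hasPn => none; exfalso.
have big t : t \in pencil l fullv -> #|` sec t| = (Q + 1)%N.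
  move=> tp; have [lt _] := pencilP _ (subvf l) tp; rewrite dl => dt.
  have Pt : P \in sec t by rewrite in_sec PC (subv_trans Pl).
  have [->|ts] := eqVneq t s; first exact: cs.
  have : sec t `\ P != fset0.
    apply: contraNneq (none t tp) => e.
    by rewrite -(@fsetD1K _ P (sec t)) ?e ?fsetU0.
  case/fset0Pn => Z; rewrite in_fsetD1 in_sec => /and3P[ZP ZC Zt].
  have NZt : (N + Z <= t)%VS by rewrite subv_add Zt (subv_trans _ lt) ?addvSl.
  have dNZ := dim_join_pt dN NC ZC.
  case tZ : (tan (N + Z) Z).
    have NZs := nucleus_tangents ZC tZ.
    case/eqP: ZP; apply: hl => //.
    have /eqP -> : l == (t :&: s)%VS.
      by rewrite eqEdim subv_cap lt ls cap_planes ?dl.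
    by rewrite subv_cap Zt (subv_trans _ NZs) ?addvSr.
  have [W [WC WZ WNZ]] := not_tan dNZ ZC (addvSr _ _) (negbT tZ).
  have eZW : (Z + W = N + Z)%VS.
    by apply: join_pts; rewrite ?(dimC ZC) ?(dimC WC) ?addvSr // eq_sym.
  apply: (secant_nucleus_planes ZC WC); rewrite ?eZW ?addvSl //.
  by rewrite eq_sym.
have fib t : t \in pencil l fullv ->
    #|` [fset Z in C `\` sec l | (l + Z)%VS == t]| = Q.
  move=> tp; have [lt _] := pencilP _ (subvf l) tp; rewrite dl => dt.
  by rewrite plane_fiber // card_secD // cl big // addnK.
have im : (fun Z => (l + Z)%VS) @` (C `\` sec l) = pencil l fullv.
  apply/eqP; rewrite eqEfsubset plane_image //; apply/fsubsetP => t tp.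
  have : [fset Z in C `\` sec l | (l + Z)%VS == t] != fset0.
    by rewrite -cardfs_gt0 fib // ltnW.
  case/fset0Pn => Z; rewrite in_sep => /andP[h /eqP <-].
  by apply/imfsetP; exists Z.
have := @eq_card_fibers _ _ (fun Z => (l + Z)%VS) (C `\` sec l) Q _.
rewrite im card_CD cl card_planes // => /(_ fib).
by clear; rewrite expnS expn1; have := q_gt1 K; nia.
Qed.

End Nucleus.

(** * Even order when no nucleus lies on a secant: the cap together with its nuclei *)

Section NoSecantNucleus.

Hypothesis Q_gt2 : (2 < Q)%N.
Hypothesis noS : forall N s, nucleus N s -> \dim s = 3 -> #|` sec s| = (Q + 1)%N ->
  forall X, X \in C -> tan (N + X) X.

Definition nuclei := [fset N in pencil 0 fullv |
  (N \notin C) && all (fun X => tan (N + X) X) C].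

Lemma nucleiP N : reflect
  [/\ \dim N = 1%N, N \notin C & forall X, X \in C -> tan (N + X) X] (N \in nuclei).
Proof.
rewrite /nuclei !inE /=; apply: (iffP idP).
  case/and3P => /(pencilP _ (subvf _))[_ _]; rewrite dimv0 => dN NC /allP h.
  by split=> // X XC; apply: h.
case=> dN NC h; apply/and3P; split=> //; last by apply/allP.
by apply/(pencilP _ (subvf _)); rewrite sub0v subvf dimv0.
Qed.

(** The nucleus of an oval section through [l] lies on [l] by uniqueness of the tangent at [P]. If
    [N] and [N'] were two nuclei on [l], then at a point [X] of the section off [l] both would lie
    on the one tangent, so this tangent would be [l]. *)
Lemma tangent_nucleus l P : tan l P -> exists2 N, N \in nuclei &
  (N <= l)%VS /\ forall N', N' \in nuclei -> (N' <= l)%VS -> N' = N.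
Proof.
move=> tl; have [dl PC Pl hl] := tanP tl.
have [s [ds ls cs]] := tangent_oval tl.
have [N nN] := exists_nucleus evenQ ds cs.
have [dN NC Ns tN] := nN; have hN := noS nN ds cs.
have Ps : P \in sec s by rewrite in_sec PC (subv_trans Pl).
have eP : (N + P)%VS = l.
  apply: (oval_tangent_uniq ds cs _ ls (tN P Ps) tl).
  by rewrite subv_add Ns (subv_trans Pl).
have Nl : (N <= l)%VS by rewrite -eP addvSl.
exists N; first by apply/nucleiP.
split=> // N' /nucleiP[dN' N'C hN'] N'l.
have gt1 : (1 < #|` sec s|)%N by rewrite cs addn1 ltnS ltnW.
have [X Xs XP] := card_ge2_fset gt1 P.
have Xl : ~~ (X <= l)%VS.
  apply: contra XP => Xl; apply/eqP/hl => //.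
  by move: Xs; rewrite in_sec => /andP[].
move: (Xs); rewrite in_sec => /andP[XC Xs'].
apply/eqP; apply: contraT => NN'; case/negP: Xl.
rewrite -(join_pts dN' dN NN' N'l Nl dl).
have eX : (N' + X)%VS = (N + X)%VS.
  apply: (oval_tangent_uniq ds cs _ _ (hN' X XC) (tN X Xs)).
    by rewrite subv_add (subv_trans N'l ls) Xs'.
  by rewrite subv_add Ns.
by rewrite (@join_pts _ _ N' N (N + X)) ?addvSl ?addvSr ?dim_join_pt // -eX addvSl.
Qed.

Local Notation M := (C `|` nuclei).

Lemma dimM X : X \in M -> \dim X = 1%N.
Proof. by rewrite in_fsetU => /orP[/dimC|/nucleiP[]]. Qed.

(** On a secant the second point is in the cap, and no nucleus lies there because its joins with the
    cap are tangents. On a tangent the second point is the unique nucleus. *)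
Lemma second_pt l P : \dim l = 2 -> P \in C -> (P <= l)%VS ->
  exists Y, [/\ Y \in M, Y != P, (Y <= l)%VS &
    forall Z, Z \in M -> Z != P -> (Z <= l)%VS -> Z = Y].
Proof.
move=> dl PC Pl; case tl: (tan l P).
  have [N Nn [Nl hN]] := tangent_nucleus tl; have [_ _ _ hl] := tanP tl.
  have [_ NC _] := nucleiP _ Nn.
  exists N; split=> //; first by rewrite in_fsetU Nn orbT.
    by apply: contraNneq NC => ->.
  by move=> Z; rewrite in_fsetU => /orP[ZC /eqP + Zl|/hN h _ /h //]; case; apply: hl.
have [Y [YC YP Yl]] := not_tan dl PC Pl (negbT tl).
exists Y; split=> //; first by rewrite in_fsetU YC.
have PY : P != Y by rewrite eq_sym.
have el : (P + Y)%VS = l by apply: join_pts; rewrite ?(dimC PC) ?(dimC YC).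
move=> Z; rewrite in_fsetU => /orP[ZC ZP|/nucleiP[dZ ZC hZ] _ Zl].
  by rewrite -el => /(cap_line PC YC PY ZC)[] // e; rewrite e eqxx in ZP.
have := hZ P PC; rewrite (join_pt dZ ZC PC Zl Pl dl) => /tanP[_ _ _ h].
by case/eqP: YP; apply: h YC Yl.
Qed.

Definition msec W := [fset Z in M | (Z <= W)%VS].

Lemma in_msec Z W : (Z \in msec W) = (Z \in M) && (Z <= W)%VS.
Proof. exact: in_sep. Qed.

Lemma card_msec P W : P \in C -> (P <= W)%VS ->
  #|` msec W| = (#|` pencil P W|).+1.
Proof.
move=> PC PW; rewrite (cardfsD1 P) in_msec in_fsetU PC PW add1n; congr _.+1.
have joinP Z : Z \in msec W `\ P -> [/\ Z \in M, Z != P, (Z <= W)%VS & \dim (P + Z) = 2].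
  rewrite in_fsetD1 in_msec => /and3P[ZP ZM ZW].
  by split=> //; rewrite dim_add_pts ?(dimC PC) ?(dimM ZM) // eq_sym.
rewrite -(@card_imfset_in _ _ (fun Z => (P + Z)%VS) (msec W `\ P)).
  congr #|` _|; apply/fsetP => l; apply/imfsetP/(pencilP _ PW).
    case=> Z /= /joinP[ZM ZP ZW dPZ] ->.
    by rewrite addvSl subv_add PW ZW dPZ (dimC PC).
  case=> Pl lW; rewrite (dimC PC) => dl.
  have [Y [YM YP Yl _]] := second_pt dl PC Pl.
  exists Y; first by rewrite /= in_fsetD1 YP in_msec YM (subv_trans Yl).
  by rewrite (@join_pts _ _ P Y l) ?(dimC PC) ?(dimM YM) // eq_sym.
move=> X Y /joinP[XM XP XW dX] /joinP[YM YP YW dY] /= e.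
have [Z [_ _ _ h]] := second_pt dX PC (addvSl _ _).
have YX : (Y <= P + X)%VS by rewrite e addvSr.
by rewrite (h X XM XP (addvSr _ _)) (h Y YM YP YX).
Qed.

(** By [card_msec] it is enough to find a point of the cap in [s]. If [s] contains a nucleus [N],
    then the Q^2+1 tangents through [N] and the Q+1 lines of [s] through [N] are too many to be
    distinct among the Q^2+Q+1 lines through [N]. *)
Lemma card_msec_plane s : \dim s = 3 -> msec s != fset0 -> #|` msec s| = (Q + 2)%N.
Proof.
move=> ds ne; have [P PC Ps] : exists2 P, P \in C & (P <= s)%VS.
  case/fset0Pn: ne => N; rewrite in_msec in_fsetU => /andP[/orP[NC|/nucleiP[dN NC tN]] Ns].
    by exists N.
  pose A := (fun X => (N + X)%VS) @` C.
  have cA : #|` A| = (Q ^ 2 + 1)%N.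
    rewrite /A card_imfset_in // => X Y XC YC e.
    by have [_ _ _ h] := tanP (tN Y YC); apply: h; rewrite // -e addvSr.
  have AF : A `<=` pencil N fullv.
    apply/fsubsetP => _ /imfsetP[X /= XC ->]; apply/(pencilP _ (subvf _)).
    by rewrite addvSl subvf dim_join_pt ?dN.
  have BF : pencil N s `<=` pencil N fullv.
    apply/fsubsetP => l /(pencilP _ Ns)[Nl ls dl].
    by apply/(pencilP _ (subvf _)); rewrite subvf.
  have : A `&` pencil N s != fset0.
    rewrite -cardfs_gt0; have := cardfsUI A (pencil N s).
    have : (#|` A `|` pencil N s| <= #|` pencil N fullv|)%N.
      by rewrite fsubset_leq_card // fsubUset AF BF.
    rewrite card_pencil3 ?subvf ?dN ?dimV4 // card_pencil2 ?dN // cA.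
    by clear; lia.
  case/fset0Pn => l; rewrite in_fsetI => /andP[/imfsetP[X /= XC ->]].
  case/(pencilP _ Ns) => _ + _; rewrite subv_add => /andP[_ Xs].
  by exists X.
by rewrite (card_msec PC Ps) card_pencil2 ?(dimC PC) // addn1 addn2.
Qed.

(** Take a plane that meets the extended cap in Q+2 points, and in it a point [R] off the extended
    cap on a secant [P + X]. The joins of [R] with these points include two coincidences, so at most
    Q of the Q+1 lines through [R] are hit. *)
Lemma external_line : exists2 m, \dim m = 2 & msec m = fset0.
Proof.
have [P PC] : exists P, P \in C by apply/fset0Pn; rewrite -cardfs_gt0 cardC addn1.
have C_gt1 : (1 < #|` C|)%N by rewrite cardC addn1 ltnS expn_gt0 ltnW.
have [X XC XP] := card_ge2_fset C_gt1 P.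
have PX : P != X by rewrite eq_sym.
have dl : \dim (P + X) = 2 by rewrite dim_add_pts ?(dimC PC) ?(dimC XC).
have [Y YC Yl] : exists2 Y, Y \in C & ~~ (Y <= P + X)%VS.
  have : C `\` sec (P + X) != fset0.
    rewrite -cardfs_gt0 card_CD sec_line // cardfs2 PX.
    by clear -Q_gt2; move: Q_gt2; move: #|K| => k; rewrite expnS expn1; nia.
  case/fset0Pn => Y; rewrite in_fsetD in_sec => /andP[+ YC]; rewrite YC /= => Yl.
  by exists Y.
have ds : \dim (P + X + Y) = 3 by rewrite dim_add_pt ?dl ?(dimC YC).
set s := (P + X + Y)%VS in ds.
have ls : (P + X <= s)%VS by apply: addvSl.
have ml : msec (P + X) = [fset P; X].
  have [W [WM WP Wl hW]] := second_pt dl PC (addvSl _ _).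
  have eX : X = W by apply: hW; rewrite ?in_fsetU ?XC ?addvSr.
  apply/fsetP => Z; rewrite in_msec !in_fset2; apply/andP/orP.
    case=> ZM Zl; have [->|ZP] := eqVneq Z P; first by left.
    by right; rewrite (hW Z ZM ZP Zl) eX.
  by case=> /eqP ->; rewrite in_fsetU ?PC ?XC ?addvSl ?addvSr.
have [R Rp RM] : exists2 R, R \in pencil 0 (P + X) & R \notin msec (P + X).
  apply/fsubsetPn/negP => /fsubset_leq_card.
  rewrite card_pencil2 ?sub0v ?dimv0 // ml cardfs2 PX addn1 ltnS => le.
  by have := leq_trans Q_gt1 le.
have [_ Rl] := pencilP _ (sub0v _) Rp; rewrite dimv0 => dR.
have nRM : R \notin M by move: RM; rewrite in_msec Rl andbT.
have nRC : R \notin C by move: nRM; rewrite in_fsetU negb_or => /andP[].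
have Rs : (R <= s)%VS := subv_trans Rl ls.
have nR Z : Z \in M -> R != Z by move=> ZM; apply: contraNneq nRM => ->.
have Ys : (Y <= s)%VS by apply: addvSr.
have dRY := dim_join_pt dR nRC YC.
have [Y' [Y'M Y'Y Y'l _]] := second_pt dRY YC (addvSr _ _).
have XY' : X != Y'.
  apply: contraNneq Yl => e; apply: (@subv_trans _ _ (R + X)%VS).
    by rewrite e (@join_pts _ _ R Y' (R + Y)) ?addvSl ?addvSr ?(dimM Y'M) ?nR.
  by rewrite subv_add Rl addvSr.
have Xs : (X <= s)%VS by apply: subv_trans ls; apply: addvSr.
have Y's : (Y' <= s)%VS by apply: subv_trans Y'l _; rewrite subv_add Rs.
(* [X] and [Y'] are dropped because they give the same lines through [R] as [P] and [Y]. *)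
pose S' := msec s `\` [fset X; Y'].
pose f Z := (R + Z)%VS.
have cs : #|` msec s| = (Q + 2)%N.
  by apply: card_msec_plane => //; apply/fset0Pn; exists X; rewrite in_msec in_fsetU XC.
have cS' : #|` S'| = Q.
  rewrite cardfsDS ?cs ?cardfs2 ?XY'; first by rewrite addnK.
  apply/fsubsetP => Z; rewrite in_fset2 in_msec => /orP[]/eqP ->.
    by rewrite in_fsetU XC Xs.
  by rewrite Y'M Y's.
have [m mp mf] : exists2 m, m \in pencil R s & m \notin f @` S'.
  apply/fsubsetPn/negP => /fsubset_leq_card.
  rewrite card_pencil2 ?dR // => le; have := leq_trans le (card_imfset_le f S').
  by rewrite cS' addn1 ltnn.
have [Rm ms] := pencilP _ Rs mp; rewrite dR => dm; exists m => //.
apply/fsetP => Z; rewrite in_fset0 in_msec; apply/negP => /andP[ZM Zm].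
have eZ : (R + Z)%VS = m by apply: join_pts; rewrite ?(dimM ZM) ?nR.
have fS T : T \in M -> (T <= s)%VS -> T != X -> T != Y' -> f T = m -> False.
  move=> TM Ts TX TY' eT; case/negP: mf; apply/imfsetP; exists T => //=.
  by rewrite in_fsetD in_fset2 negb_or TX TY' in_msec TM.
have [ZX|ZX] := eqVneq Z X.
  apply: (fS P); rewrite ?in_fsetU ?PC ?(subv_trans _ ls) ?addvSl //.
    apply: contraNneq Yl => e; apply: (@subv_trans _ _ (R + P)%VS).
      by rewrite e (@join_pts _ _ R Y' (R + Y)) ?addvSl ?addvSr ?(dimM Y'M) ?nR.
    by rewrite subv_add Rl addvSl.
  have PM : P \in M by rewrite in_fsetU PC.
  have XM : X \in M by rewrite in_fsetU XC.
  rewrite /f -eZ ZX (@join_pts _ _ R P (P + X)) ?(dimC PC) ?nR ?addvSl //.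
  by apply/esym/join_pts; rewrite ?(dimC XC) ?nR ?addvSr.
have [ZY'|ZY'] := eqVneq Z Y'.
  apply: (fS Y); rewrite ?in_fsetU ?YC // 1?eq_sym //.
    by apply: contraNneq Yl => <-; rewrite addvSr.
  by rewrite /f -eZ ZY' (@join_pts _ _ R Y' (R + Y)) ?(dimM Y'M) ?nR ?addvSl.
by apply: (fS Z) => //; apply: subv_trans ms.
Qed.

(* Counting over the planes through an external line gives Q+2 | Q^2+Q+2, hence
   Q+2 | 4. *)
Lemma no_secant_nucleus_false : False.
Proof.
have [m dm mM] := external_line.
have [P PC] : exists P, P \in C by apply/fset0Pn; rewrite -cardfs_gt0 cardC addn1.
have cM : #|` M| = (Q ^ 2 + Q + 2)%N.
  have <- : msec fullv = M by apply/fsetP => Z; rewrite in_msec subvf andbT.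
  rewrite (card_msec PC (subvf P)) card_pencil3 ?subvf ?(dimC PC) ?dimV4 //.
  by rewrite addn1 addn2.
have nm Z : Z \in M -> ~~ (Z <= m)%VS.
  move=> ZM; have : Z \notin msec m by rewrite mM.
  by rewrite in_msec ZM.
have := @eq_card_fibers _ _ (fun Z => (m + Z)%VS) M (Q + 2) _.
rewrite cM => h; have {h}/h : forall t, t \in (fun Z => (m + Z)%VS) @` M ->
    #|` [fset Z in M | (m + Z)%VS == t]| = (Q + 2)%N.
  move=> _ /imfsetP[Z /= ZM ->].
  have dt : \dim (m + Z) = 3 by rewrite dim_add_pt ?dm ?(dimM ZM) ?nm.
  rewrite -(card_msec_plane dt); last first.
    by apply/fset0Pn; exists Z; rewrite in_msec ZM addvSr.
  congr #|` _|; apply/fsetP => T; rewrite in_msec in_sep.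
  case TM: (T \in M) => //=; apply/eqP/idP => [<-|Tt].
    exact: addvSr.
  by apply: add_pt_eq; rewrite ?(dimM TM) ?nm ?addvSl ?dt ?dm.
move: #|` _| => k.
clear -Q_gt2; have [j ->] : exists j, Q = (j + 3)%N by exists (Q - 3)%N; rewrite subnK.
(* The number Q^2+Q+2 = (Q-1)(Q+2)+4 lies strictly between the multiples of Q+2 by Q-1 = j+2 and by
   Q. *)
rewrite !expnS expn0 muln1; have [|] := leqP k (j + 2); nia.
Qed.

End NoSecantNucleus.
End EvenOrder.

(** For even Q, a nucleus on a secant gives a plane tangent to the cap, whose point of contact is
    good. Hence, if no point is good, every nucleus extends the cap, and [no_secant_nucleus_false]
    applies. *)
Lemma ovoid_good_point : (2 < Q)%N -> exists2 P, P \in C &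
  forall X Y, X \in C -> Y \in C -> uniq [:: P; X; Y] ->
    #|` sec (P + X + Y)| = (Q + 1)%N.
Proof.
move=> Q2.
have [P0 P0C] : exists P, P \in C by apply/fset0Pn; rewrite -cardfs_gt0 cardC addn1.
case: (boolP (odd Q)) => [oQ|eQ].
  by exists P0 => //; apply: good_of_arcs => // t dt _; apply: odd_arc_max.
(* Goodness is written as a boolean so that the existence of a good point can be decided. *)
pose good P := all (fun X => all (fun Y =>
  uniq [:: P; X; Y] ==> (#|` sec (P + X + Y)| == Q + 1)%N) C) C.
case: (boolP (has good C)) => [/hasP[P PC /allP gP]|/hasPn ng].
  exists P => // X Y XC YC u; apply/eqP.
  by have /allP/(_ Y YC) := gP X XC; rewrite u.
exfalso; apply: (no_secant_nucleus_false eQ Q2) => N s nN ds cs X XC.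
apply: contraT => nt; have [dN NC _ _] := nN.
have dl := dim_join_pt dN NC XC.
have [Y [YC YX Yl]] := not_tan dl XC (addvSr _ _) nt.
have XY : X != Y by rewrite eq_sym.
have NXY : (N <= X + Y)%VS.
  by rewrite (@join_pts _ _ X Y (N + X)) ?(dimC XC) ?(dimC YC) ?addvSl ?addvSr.
have [P [t [dt st]]] := exists_tangent_plane eQ nN ds cs XC YC XY NXY.
have : P \in sec t by rewrite st inE.
rewrite in_sec => /andP[PC _]; have /negP[] := ng P PC.
apply/allP => A AC; apply/allP => B BC; apply/implyP => u; apply/eqP.
by apply: good_of_arcs => // ? ?; apply: (tangent_plane_arcs dt st).
Qed.

(** Consider the planes through a secant [X + Y] missing [P]. The one through [P] has Q+1 points. If
    each of the other Q had at most four, hence two off the secant, then Q^2-Q would be at most 2Q,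
    against Q > 3. *)
Lemma exists_big_plane P : (3 < Q)%N -> P \in C ->
  (forall X Y, X \in C -> Y \in C -> uniq [:: P; X; Y] ->
    #|` sec (P + X + Y)| = (Q + 1)%N) ->
  exists t, [/\ \dim t = 3, ~~ (P <= t)%VS & (4 < #|` sec t|)%N].
Proof.
move=> Q3 PC gP.
have C_gt1 : (1 < #|` C|)%N by rewrite cardC addn1 ltnS expn_gt0 ltnW.
have [X XC XP] := card_ge2_fset C_gt1 P.
have [Y YC Yl] : exists2 Y, Y \in C & ~~ (Y <= P + X)%VS.
  have : C `\` sec (P + X) != fset0.
    have PX : P != X by rewrite eq_sym.
    rewrite -cardfs_gt0 card_CD sec_line // cardfs2 PX.
    by clear -Q3; move: Q3; move: #|K| => k; rewrite expnS expn1; nia.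
  case/fset0Pn => Y; rewrite in_fsetD in_sec => /andP[+ YC]; rewrite YC /= => Yl.
  by exists Y.
have YX : Y != X by apply: contraNneq Yl => ->; rewrite addvSr.
have YP : Y != P by apply: contraNneq Yl => ->; rewrite addvSl.
have XY : X != Y by rewrite eq_sym.
have dl : \dim (X + Y) = 2 by rewrite dim_add_pts ?(dimC XC) ?(dimC YC).
have cl : #|` sec (X + Y)| = 2 by rewrite sec_line // cardfs2 XY.
have u : uniq [:: P; X; Y] by rewrite /= !inE negb_or eq_sym XP eq_sym YP XY.
have dp : \dim (P + X + Y) = 3 by case: capC => _; apply.
have lp : (X + Y <= P + X + Y)%VS by rewrite -addvA addvSr.
case: (boolP (has (fun t => ~~ (P <= t)%VS && (4 < #|` sec t|)%N) (pencil (X + Y) fullv))).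
  case/hasP => t /(pencilP _ (subvf _))[lt _]; rewrite dl => dt /andP[? ?].
  by exists t.
move/hasPn => none; exfalso.
have im : (fun Z => (X + Y + Z)%VS) @` (C `\` sec (P + X + Y)) `<=`
    pencil (X + Y) fullv `\ (P + X + Y)%VS.
  apply/fsubsetP => _ /imfsetP[Z /= + ->].
  rewrite in_fsetD in_sec => /andP[+ ZC]; rewrite ZC /= => Zp.
  rewrite in_fsetD1; apply/andP; split.
    by apply: contraNneq Zp => <-; rewrite addvSr.
  apply/(pencilP _ (subvf _)); rewrite addvSl subvf dim_add_pt ?(dimC ZC) //.
  by apply: contra Zp => /subv_trans; apply.
have pin : (P + X + Y)%VS \in pencil (X + Y) fullv.
  by apply/(pencilP _ (subvf _)); rewrite lp subvf dl.
have e1 : #|` pencil (X + Y) fullv `\ (P + X + Y)%VS| = Q.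
  have := cardfsD1 (P + X + Y)%VS (pencil (X + Y) fullv).
  by rewrite pin (card_planes dl) addn1 add1n => -[<-].
have e2 : #|` C `\` sec (P + X + Y)| = (Q ^ 2 - Q)%N.
  by rewrite card_CD (gP X Y XC YC u) subnDr.
have h : forall t,
    t \in (fun Z => (X + Y + Z)%VS) @` (C `\` sec (P + X + Y)) ->
    (#|` [fset Z in C `\` sec (P + X + Y) | (X + Y + Z)%VS == t]| <= 2)%N.
  move=> t /(fsubsetP im); rewrite in_fsetD1 => /andP[tp tpen].
  have [lt _] := pencilP _ (subvf _) tpen; rewrite dl => dt.
  have nP : ~~ (P <= t)%VS.
    apply: contra tp => Pt; rewrite eq_sym eqEdim dp dt leqnn andbT.
    by rewrite -addvA subv_add Pt.
  have := none t tpen; rewrite nP /= -leqNgt => c4.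
  apply: (@leq_trans #|` sec t `\` sec (X + Y)|); last first.
    rewrite card_secD // cl; move: c4; move: #|` sec t| => k; clear; lia.
  rewrite -(plane_fiber dl lt dt); apply: fsubset_leq_card.
  apply/fsubsetP => Z; rewrite !in_sep !in_fsetD !in_sec => /andP[/andP[+ ZC] ->].
  by rewrite ZC /= andbT => Zp; rewrite andbT; apply: contra Zp => /subv_trans; apply.
have := leq_card_fibers h; rewrite e2.
have := fsubset_leq_card im; rewrite e1.
move: #|` _ @` _| => a; clear -Q3; move: Q3.
by move: #|K| => k; rewrite expnS expn1; nia.
Qed.

End Caps.

(** * Normal partial spreads with Q^2 elements *)

(* Q^2 pairwise disjoint (n-1)-spaces of a (3n-1)-space such that the span of any two
   contains exactly Q of them: the points of an affine plane of order Q. *)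
Record normal_spread (F : finFieldType) (m n : nat) (U : {vspace 'rV[F]_m})
    (S : {fset {vspace 'rV[F]_m}}) : Prop := NormalSpread {
  ns_gt2 : (2 < #|F| ^ n)%N;
  ns_dimU : \dim U = (3 * n)%N;
  ns_dim : forall X, X \in S -> \dim X = n;
  ns_sub : forall X, X \in S -> (X <= U)%VS;
  ns_cap : forall X Y, X \in S -> Y \in S -> X != Y -> (X :&: Y)%VS = 0%VS;
  ns_card : #|` S| = ((#|F| ^ n) ^ 2)%N;
  ns_line : forall X Y, X \in S -> Y \in S -> X != Y ->
    #|` [fset Z in S | (Z <= X + Y)%VS]| = (#|F| ^ n)%N }.

Section NormalPartialSpread.

Variables (F : finFieldType) (m n : nat).
Local Notation V := 'rV[F]_m.
Local Notation q := #|F|.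
Local Notation Q := (q ^ n)%N.
Variables (U : {vspace V}) (S : {fset {vspace V}}).
Hypothesis nsS : normal_spread n U S.
Implicit Types (A B X Y Z T M N I J : {vspace V}).

Let Q_gt2 := ns_gt2 nsS.
Let dimU := ns_dimU nsS.
Let dimS := ns_dim nsS.
Let subU := ns_sub nsS.
Let capS := ns_cap nsS.
Let cardS := ns_card nsS.
Let cardL := ns_line nsS.

Let n_gt0 : (0 < n)%N.
Proof. by move: Q_gt2; case: (n) => // ; rewrite expn0. Qed.

Definition is_line M := exists X Y, [/\ X \in S, Y \in S, X != Y & M = (X + Y)%VS].

Definition on M := [fset Z in S | (Z <= M)%VS].

Lemma in_on Z M : (Z \in on M) = (Z \in S) && (Z <= M)%VS.
Proof. exact: in_sep. Qed.

Lemma dim_join A B : \dim A = n -> \dim B = n -> (A :&: B)%VS = 0%VS ->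
  \dim (A + B) = (2 * n)%N.
Proof. by move=> dA dB AB; rewrite dimv_disjoint_sum // dA dB mul2n addnn. Qed.

Lemma line_dim M : is_line M -> \dim M = (2 * n)%N.
Proof. by case=> X [Y [XS YS XY ->]]; rewrite dim_join ?dimS ?capS. Qed.

Lemma line_card M : is_line M -> #|` on M| = Q.
Proof. by case=> X [Y [XS YS XY ->]]; apply: cardL. Qed.

Lemma line_sub M : is_line M -> (M <= U)%VS.
Proof. by case=> X [Y [XS YS XY ->]]; rewrite subv_add !subU. Qed.

Lemma join_is_line X Y : X \in S -> Y \in S -> X != Y -> is_line (X + Y).
Proof. by exists X, Y. Qed.

Lemma join_eq A B M : \dim A = n -> \dim B = n -> (A :&: B)%VS = 0%VS ->
  (A <= M)%VS -> (B <= M)%VS -> \dim M = (2 * n)%N -> (A + B)%VS = M.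
Proof.
move=> dA dB AB AM BM dM; apply/eqP.
by rewrite eqEdim subv_add AM BM dM dim_join ?leqnn.
Qed.

Lemma line_join X Y M : is_line M -> X \in S -> Y \in S -> X != Y ->
  (X <= M)%VS -> (Y <= M)%VS -> (X + Y)%VS = M.
Proof. by move=> lM XS YS XY XM YM; apply: join_eq; rewrite ?(line_dim lM) ?(dimS XS) ?(dimS YS) ?capS. Qed.

(** Each line through [T] uses up Q-1 of the Q^2-1 other elements. *)
Lemma lines_through T : T \in S -> #|` (fun B => (T + B)%VS) @` (S `\ T)| = (Q + 1)%N.
Proof.
move=> TS; have cST : #|` S `\ T| = (Q ^ 2 - 1)%N.
  by rewrite -cardS (cardfsD1 T S) TS add1n subn1.
have := @eq_card_fibers _ _ (fun B => (T + B)%VS) (S `\ T) Q.-1 _.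
rewrite cST => h; have {h}/h : forall M, M \in (fun B => (T + B)%VS) @` (S `\ T) ->
    #|` [fset B in S `\ T | (T + B)%VS == M]| = Q.-1.
  move=> _ /imfsetP[B /= + ->]; rewrite in_fsetD1 => /andP[BT BS].
  have TB : T != B by rewrite eq_sym.
  rewrite -(cardL TS BS TB).
  rewrite (cardfsD1 T [fset Z in S | (Z <= T + B)%VS]).
  rewrite -/(on _) in_on TS addvSl add1n /=.
  congr #|` _|; apply/fsetP => Z; rewrite !inE /=.
  case ZT: (Z == T) => //=; case ZS: (Z \in S) => //=; apply/eqP/idP => [<-|ZM].
    exact: addvSr.
  apply: line_join => //; rewrite ?addvSl 1?eq_sym ?ZT //.
  exact: join_is_line.
by move: #|` _| Q_gt2 => k; case: (Q) => // j; rewrite expnS expn1 /=; nia.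
Qed.

(** Suppose that the sum is smaller than [U]. It contains the 2Q-1 elements on the two lines [M] and
    [X + Z]. An element [T] outside it would be joined to them by 2Q-1 different lines, more than
    the Q+1 lines through [T]. So all elements lie in the sum, whose size, at most Q^3/q, is too
    small for the Q^2(Q-1) nonzero vectors that they cover. *)
Lemma line_span M Z : is_line M -> Z \in S -> ~~ (Z <= M)%VS -> (M + Z)%VS = U.
Proof.
move=> lM ZS ZM; have [X [Y [XS YS XY eM]]] := lM.
apply/eqP; rewrite eqEdim subv_add line_sub // subU //= dimU leqNgt.
apply/negP => lt; have XZ : X != Z by apply: contraNneq ZM => <-; rewrite eM addvSl.
have XM : (X <= M)%VS by rewrite eM addvSl.
have lM' := join_is_line XS ZS XZ.
pose D := on M `|` on (X + Z).
have cD : #|` D| = (2 * Q - 1)%N.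
  rewrite cardfsU !line_card // (_ : _ `&` _ = [fset X]) ?cardfs1; first by lia.
  apply/fsetP => W; rewrite in_fsetI !in_on in_fset1.
  apply/idP/eqP => [/andP[/andP[WS WM] /andP[_ WM']]|->]; last by rewrite XS XM addvSl.
  apply/eqP; apply: contraT => WX; case/negP: ZM.
  by rewrite -(line_join lM WS XS WX WM XM) (line_join lM' WS XS WX WM') ?addvSl ?addvSr.
have DP A : A \in D -> A \in S /\ (A <= M + Z)%VS.
  rewrite in_fsetU !in_on => /orP[/andP[AS AM]|/andP[AS AM]]; split=> //.
    by apply: subv_trans (addvSl _ _).
  by apply: subv_trans AM _; apply: addvS.
have all_in T : T \in S -> (T <= M + Z)%VS.
  move=> TS; apply: contraT => TP.
  have inj : {in D &, injective (fun A => (T + A)%VS)}.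
    move=> A B /DP[AS AP] /DP[BS BP] e; apply/eqP; apply: contraT => AB.
    have TA : T != A by apply: contraNneq TP => ->.
    case/negP: TP; apply: (@subv_trans _ _ (A + B)%VS); last by rewrite subv_add AP.
    rewrite (line_join (join_is_line TS AS TA) AS BS AB) ?addvSl ?addvSr //.
    by rewrite e addvSr.
  have : (fun A => (T + A)%VS) @` D `<=` (fun B => (T + B)%VS) @` (S `\ T).
    apply/fsubsetP => _ /imfsetP[A /= /DP[AS AP] ->]; apply/imfsetP; exists A => //=.
    by rewrite in_fsetD1 AS andbT; apply: contraNneq TP => <-.
  move/fsubset_leq_card; rewrite card_imfset_in // lines_through // cD.
  by clear -Q_gt2; move: Q_gt2; move: (Q) => k; lia.
have := @card_cover F m 0%VS n S.
rewrite cardS dimv0 expn0 => h.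
have : (q ^ \dim (M + Z) * q <= Q ^ 3)%N.
  by rewrite -expnSr -expnM mulnC leq_exp2l ?q_gt1 //; rewrite mulnC.
have : (Q ^ 2 * (Q - 1) < q ^ \dim (M + Z))%N.
  rewrite -h.
  - rewrite -card_vs_set; apply: proper_card; apply/properP; split.
      apply/subsetP => v; rewrite !inE => /andP[_ /hasP[X' X'S]].
      by apply/subvP; apply: all_in.
    by exists 0; rewrite !inE mem0v.
  - by move=> X' X'S; rewrite sub0v dimS.
  - by move=> X' Y' X'S Y'S XY'; rewrite capS // subvv.
have := q_gt1 F; move: (q ^ _)%N => N' ; move: Q_gt2; move: (Q) => k.
by rewrite !expnS expn0 muln1; nia.
Qed.

Lemma line_cap0 M Z : is_line M -> Z \in S -> ~~ (Z <= M)%VS -> (M :&: Z)%VS = 0%VS.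
Proof.
move=> lM ZS ZM; have := dimv_sum_cap M Z.
rewrite line_span // (line_dim lM) (dimS ZS) dimU => e.
by apply/eqP; rewrite -dimv_eq0; lia.
Qed.

Lemma exists_off M : is_line M -> exists2 T, T \in S & ~~ (T <= M)%VS.
Proof.
move=> lM; have : S `\` on M != fset0.
  rewrite -cardfs_gt0 cardfsDS ?cardS ?line_card //; first by move: Q_gt2; nia.
  by apply/fsubsetP => Z; rewrite in_on => /andP[].
case/fset0Pn => T; rewrite in_fsetD in_on => /andP[+ TS]; rewrite TS /=.
by exists T.
Qed.

Definition parallel M M' := forall Z, Z \in S -> (Z <= M)%VS -> ~~ (Z <= M')%VS.

(** Of the Q+1 lines through [T], at most Q pass through an element on [M]. *)
Lemma exists_parallel M T : is_line M -> T \in S -> ~~ (T <= M)%VS ->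
  exists M', [/\ is_line M', (T <= M')%VS & parallel M M'].
Proof.
move=> lM TS TM.
have [M' /imfsetP[B /= + eM'] nM'] : exists2 M', M' \in (fun B => (T + B)%VS) @` (S `\ T) &
    M' \notin (fun A => (T + A)%VS) @` on M.
  apply/fsubsetPn/negP => /fsubset_leq_card; rewrite lines_through //.
  by have := card_imfset_le (fun A => (T + A)%VS) (on M); rewrite line_card //; lia.
rewrite in_fsetD1 => /andP[BT BS]; have TB : T != B by rewrite eq_sym.
have lM' := join_is_line TS BS TB.
exists M'; rewrite eM' addvSl; split=> // Z ZS ZM; apply: contra nM' => ZM'.
apply/imfsetP; exists Z; first by rewrite /= in_on ZS.
rewrite (line_join lM' TS ZS) ?addvSl //.
by apply: contraNneq TM => ->.
Qed.

(* The hole of a line is its point at infinity: the vectors of [M] covered by no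
   element of [S], together with 0. *)
Definition hole I M := \dim I = n /\
  forall v, (v \in I) = (v \in M) && ((v == 0) || all (fun Z : {vspace V} => v \notin Z) S).

Lemma hole_uniq I I' M : hole I M -> hole I' M -> I = I'.
Proof. by case=> _ h [_ h']; apply/vspaceP => v; rewrite h h'. Qed.

(** An element not on [M] meets [M] in 0, so only the Q elements on [M] cover vectors of it: Q^2 - 1
    - Q(Q-1) = Q-1 nonzero vectors remain. *)
Lemma card_hole_vectors M : is_line M ->
  #|[set v in M | (v != 0) && all (fun Z : {vspace V} => v \notin Z) S]| = (Q - 1)%N.
Proof.
move=> lM; have := @card_cover F m 0%VS n (on M).
rewrite line_card // dimv0 expn0 => h.
have cM := card_vs_set M; rewrite line_dim // in cM.
set A := [set v in M | _].
pose B := [set v : V | (v \notin (0%VS : {vspace V})) && has (fun X : {vspace V} => v \in X) (on M)].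
have cB : #|B| = (Q * (Q - 1))%N.
  apply: h => [X|X Y]; rewrite !in_on => /andP[XS XM].
    by rewrite sub0v dimS.
  by case/andP => YS YM XY; rewrite capS // subvv.
have BA0 : B :&: A = set0.
  apply/setP => v; rewrite !inE memv0; apply/negbTE/negP.
  case/andP => /andP[_ /hasP[Z]]; rewrite in_on => /andP[ZS _] vZ /and3P[_ _].
  by move/allP/(_ Z ZS); rewrite vZ.
have : [set v in M] = 0 |: (B :|: A).
  apply/setP => v; rewrite !inE memv0.
  have [-> |v0] := eqVneq v 0; first by rewrite mem0v.
  rewrite /=; case vM: (v \in M) => /=; last first.
    rewrite orbF; apply/esym/negbTE/negP => /hasP[Z]; rewrite in_on => /andP[_ /subvP ZM].
    by move/ZM; rewrite vM.
  case: (boolP (all _ _)); first by rewrite orbT.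
  rewrite -has_predC orbF => /hasP[Z ZS /= /negPn vZ]; apply/esym/hasP.
  exists Z => //; rewrite in_on ZS; apply: contraT => ZM.
  have := line_cap0 lM ZS ZM; move/vspaceP/(_ v); rewrite memv_cap vM vZ memv0.
  by rewrite (negPf v0).
move/(congr1 (fun D : {set V} => #|D|)); rewrite cardsU1 cardsU BA0 cards0 subn0.
rewrite !inE mem0v eqxx /= andbF add1n.
rewrite cM cB mulnC expnM; move: Q_gt2 #|A|; move: (Q) => k kg a.
by rewrite !expnS expn0 muln1 mulnBr muln1; nia.
Qed.

(** This is why the uncovered vectors form a subspace. The intersection has dimension at least n, as
    both lines lie in [U]. Its nonzero vectors are uncovered, since an element through one of them
    would be on both lines, and there are only Q-1 uncovered vectors. *)
Lemma parallel_cap M M' : is_line M -> is_line M' -> parallel M M' ->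
  hole (M :&: M') M.
Proof.
move=> lM lM' par.
pose A := [set v in M | (v != 0) && all (fun Z : {vspace V} => v \notin Z) S].
have sub : [set v in (M :&: M')%VS] \subset 0 |: A.
  apply/subsetP => v; rewrite !inE memv_cap => /andP[vM vM'].
  have [//|v0] := eqVneq v 0; rewrite vM /=; apply/allP => Z ZS; apply/negP => vZ.
  have h N : is_line N -> v \in N -> (Z <= N)%VS.
    move=> lN vN; apply: contraT => ZN; have := line_cap0 lN ZS ZN.
    by move/vspaceP/(_ v); rewrite memv_cap vN vZ memv0 (negPf v0).
  by have := par Z ZS (h M lM vM); rewrite h.
have dI : (n <= \dim (M :&: M'))%N.
  have := dimv_sum_cap M M'; rewrite (line_dim lM) (line_dim lM').
  have := dimvS (_ : M + M' <= U)%VS; rewrite subv_add !line_sub // dimU => /(_ isT).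
  by lia.
have cA : #|0 |: A| = Q.
  by rewrite cardsU1 card_hole_vectors // !inE eqxx andbF; move: Q_gt2; lia.
have eA : [set v in (M :&: M')%VS] = 0 |: A.
  apply/eqP; rewrite eqEcard sub cA card_vs_set.
  by rewrite leq_exp2l ?q_gt1.
split; last first.
  move=> v; have := congr1 (fun D : {set V} => v \in D) eA; rewrite !inE => ->.
  by have [-> |_] := eqVneq v 0; rewrite ?mem0v.
have := card_vs_set (M :&: M'); rewrite eA cA => /eqP.
by rewrite eqn_exp2l ?q_gt1 // => /eqP.
Qed.

Lemma parallelC M M' : parallel M M' -> parallel M' M.
Proof. by move=> h Z ZS ZM'; apply/negP => /(h Z ZS); rewrite ZM'. Qed.

Lemma exists_hole M : is_line M -> exists I, hole I M.
Proof.
move=> lM; have [T TS TM] := exists_off lM.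
have [M' [lM' _ par]] := exists_parallel lM TS TM.
by exists (M :&: M')%VS; apply: parallel_cap.
Qed.

Lemma hole_sub I M : hole I M -> (I <= M)%VS.
Proof. by case=> _ h; apply/subvP => v; rewrite h => /andP[]. Qed.

Lemma hole_cap0 I M Z : hole I M -> Z \in S -> (I :&: Z)%VS = 0%VS.
Proof.
case=> _ h ZS; apply/eqP; rewrite -subv0; apply/subvP => v.
rewrite memv_cap h memv0 => /andP[/andP[_ /orP[//|/allP/(_ Z ZS)]]] nv vZ.
by rewrite vZ in nv.
Qed.

Lemma lines_meet M M' I : is_line M -> is_line M' -> M != M' -> hole I M ->
  (exists2 Z, Z \in S & (M :&: M')%VS = Z) \/ (M :&: M')%VS = I /\ hole I M'.
Proof.
move=> lM lM' MM' hI.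
case: (boolP (has (fun Z => (Z <= M)%VS && (Z <= M')%VS) S)).
  case/hasP => Z ZS /andP[ZM ZM']; left; exists Z => //.
  have [Y YS YM] : exists2 Y, Y \in S & (Y <= M')%VS && ~~ (Y <= M)%VS.
    have [A [B [AS BS AB eM]]] := lM'.
    case AM: (A <= M)%VS; last by exists A => //; rewrite AM eM addvSl.
    case BM: (B <= M)%VS; last by exists B => //; rewrite BM eM addvSr.
    by case/eqP: MM'; rewrite eM (line_join lM AS BS AB).
  case/andP: YM => YM' YM; apply/eqP; rewrite eq_sym eqEdim subv_cap ZM ZM' /=.
  have := dimv_sum_cap M M'; rewrite (line_dim lM) (line_dim lM') (dimS ZS).
  have -> : (M + M' = U)%VS.
    apply/eqP; rewrite eqEsubv subv_add !line_sub //=.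
    by rewrite -(line_span lM YS YM) addvS.
  by rewrite dimU; lia.
move/hasPn => none; right.
have par : parallel M M'.
  by move=> Z ZS ZM; have := none Z ZS; rewrite ZM.
have h := parallel_cap lM lM' par.
have h' := parallel_cap lM' lM (parallelC par).
have e := hole_uniq h hI; rewrite e; split=> //.
by rewrite -e capvC.
Qed.

Lemma lines_meet_at M M' Z : is_line M -> is_line M' -> M != M' -> Z \in S ->
  (Z <= M)%VS -> (Z <= M')%VS -> (M :&: M')%VS = Z.
Proof.
move=> lM lM' MM' ZS ZM ZM'; have [I hI] := exists_hole lM.
have sZ : (Z <= M :&: M')%VS by rewrite subv_cap ZM.
case: (lines_meet lM lM' MM' hI) => [[T TS e]|[e _]].
  by apply/eqP; rewrite eq_sym eqEdim sZ e (dimS TS) (dimS ZS) leqnn.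
have := hole_cap0 hI ZS; rewrite -e (capv_idPr sZ) => Z0.
by have := dimS ZS; rewrite Z0 dimv0; move: n_gt0; lia.
Qed.

Lemma hole_join I M Z : is_line M -> hole I M -> Z \in S -> is_line (Z + I).
Proof.
move=> lM hI ZS; have [dI _] := hI.
have ZI : (Z :&: I)%VS = 0%VS by rewrite capvC (hole_cap0 hI).
case ZM: (Z <= M)%VS.
  by rewrite (join_eq _ dI ZI ZM (hole_sub hI)) ?(dimS ZS) ?(line_dim lM).
have [M' [lM' ZM' par]] := exists_parallel lM ZS (negbT ZM).
suff -> : (Z + I)%VS = M' by [].
apply: join_eq; rewrite ?(dimS ZS) ?(line_dim lM') //.
by rewrite -(hole_uniq (parallel_cap lM lM' par) hI) capvSr.
Qed.

(* A family of subspaces closed under sums and intersections which contains the points of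
   a projective line and two more points contains every point not on the line joining
   these two, as the intersection of two lines, and then the remaining points. *)
Section Closure.

Variable st : {vspace V} -> Prop.
Hypothesis stD : forall X Y, st X -> st Y -> st (X + Y)%VS.
Hypothesis stI : forall X Y, st X -> st Y -> st (X :&: Y)%VS.
Variables (M0 I0 J O X1 X3 : {vspace V}).
Hypotheses (lM0 : is_line M0) (hI0 : hole I0 M0) (OS : O \in S) (OM0 : (O <= M0)%VS).
Hypotheses (X1S : X1 \in S) (X1M0 : ~~ (X1 <= M0)%VS) (hJ : hole J (O + X1)).
Hypotheses (X3S : X3 \in S) (X3M0 : ~~ (X3 <= M0)%VS) (X3N0 : ~~ (X3 <= O + X1)%VS).
Hypothesis stM0 : forall Z, Z \in S -> (Z <= M0)%VS -> st Z.
Hypotheses (stI0 : st I0) (stX1 : st X1) (stJ : st J).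

Lemma closure_join A Z : \dim A = n -> (A :&: M0)%VS = 0%VS -> st A ->
  is_line (Z + A) -> st (Z + A).
Proof.
move=> dA AM0 sA lZA.
have ne : M0 != (Z + A)%VS.
  apply/eqP => e; move: AM0; rewrite e (capv_idPl (addvSr _ _)) => A0.
  by move: dA; rewrite A0 dimv0; move: n_gt0; lia.
have [Y [dY sY YM0 YZA]] :
    exists Y, [/\ \dim Y = n, st Y, (Y <= M0)%VS & (Y <= Z + A)%VS].
  exists (M0 :&: (Z + A))%VS; rewrite capvSl capvSr.
  case: (lines_meet lM0 lZA ne hI0) => [[Y YS e]|[-> _]]; last first.
    by case: hI0 => dI0 _; split.
  rewrite e; split; rewrite ?(dimS YS) //.
  by apply: stM0; rewrite // -e capvSl.
have YA : (Y :&: A)%VS = 0%VS.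
  by apply/eqP; rewrite -subv0 -AM0 subv_cap capvSr (subv_trans (capvSl _ _)).
rewrite -(join_eq dY dA YA YZA (addvSr _ _)) ?(line_dim lZA) //.
exact: stD.
Qed.

Lemma closure_all Z : Z \in S -> st Z.
Proof.
have OX1 : O != X1 by apply: contraNneq X1M0 => <-.
have lN0 := join_is_line OS X1S OX1.
have MN : M0 != (O + X1)%VS by apply: contraNneq X1M0 => ->; rewrite addvSr.
have [dJ _] := hJ; have JN0 := hole_sub hJ.
have capMN := lines_meet_at lM0 lN0 MN OS OM0 (addvSl _ _).
have JM0 : (J :&: M0)%VS = 0%VS.
  apply/eqP; rewrite -subv0 -(hole_cap0 hJ OS) subv_cap capvSl -capMN subv_cap.
  by rewrite capvSr (subv_trans (capvSl _ _)).
have capM0 X : X \in S -> ~~ (X <= M0)%VS -> (X :&: M0)%VS = 0%VS.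
  by move=> XS XM0; rewrite capvC line_cap0.
(* [T] is the intersection of its joins with [X1] and [J], two different points of the line
   [O + X1]. *)
have step1 T : T \in S -> ~~ (T <= O + X1)%VS -> st T.
  move=> TS TN0; have TX1 : T != X1 by apply: contraNneq TN0 => ->; rewrite addvSr.
  have l1 := join_is_line TS X1S TX1; have l2 := hole_join lN0 hJ TS.
  have X1J : (X1 :&: J)%VS = 0%VS by rewrite capvC (hole_cap0 hJ).
  have ne : (T + X1)%VS != (T + J)%VS.
    apply: contraNneq TN0 => e.
    rewrite -(join_eq (dimS X1S) dJ X1J (addvSr _ _) JN0 (line_dim lN0)).
    by rewrite (@join_eq X1 J (T + X1)) ?(dimS X1S) ?(line_dim l1) ?addvSl ?addvSr // e addvSr.
  rewrite -(lines_meet_at l1 l2 ne TS (addvSl _ _) (addvSl _ _)).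
  by apply: stI; apply: closure_join => //; [apply: dimS | apply: capM0].
move=> ZS; case ZN: (Z <= O + X1)%VS; last by apply: step1; rewrite ?ZN.
(* On the line [O + X1] those two joins coincide, so the join with [X3] is intersected with that
   line instead. *)
have ZX3 : Z != X3 by apply: contraNneq X3N0 => <-.
have l3 := join_is_line ZS X3S ZX3.
have ne : (Z + X3)%VS != (O + X1)%VS by apply: contraNneq X3N0 => <-; rewrite addvSr.
rewrite -(lines_meet_at l3 lN0 ne ZS (addvSl _ _) ZN).
apply: stI; last by apply: stD => //; apply: stM0.
by apply: closure_join; rewrite ?(dimS X3S) ?capM0 //; apply: step1.
Qed.

End Closure.
End NormalPartialSpread.

(** * Actions of an extension field on subspaces *)

Section Actions.

Variables (F : fieldType) (V : vectType F) (L : fieldExtType F).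
Implicit Types (A T : L -> 'End(V)) (H X Y Z : {vspace V}).

(** The maps are endomorphisms of the whole space, constrained only on [H], so that an action on the
    span of a pseudo-oval and a global one have the same type. The third clause with c = 1 makes 1
    act as the identity. *)
Definition action_on A H : Prop :=
  [/\ forall a b v, v \in H -> A (a + b) v = A a v + A b v,
      forall a b v, v \in H -> A (a * b) v = A a (A b v),
      forall c v, v \in H -> A c%:A v = c *: v
    & forall a v, v \in H -> A a v \in H].

Definition stable A X : Prop := forall a v, v \in X -> A a v \in X.

Lemma stableD A X Y : stable A X -> stable A Y -> stable A (X + Y).
Proof.
move=> sX sY a v /memv_addP[x xX [y yY ->]].
by rewrite linearD memv_add ?sX ?sY.
Qed.

Lemma stableI A X Y : stable A X -> stable A Y -> stable A (X :&: Y).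
Proof.
by move=> sX sY a v; rewrite !memv_cap => /andP[vX vY]; rewrite sX ?sY.
Qed.

Section Orbits.

Variables (A : L -> 'End(V)) (H : {vspace V}).
Hypothesis actA : action_on A H.

Lemma act1 v : v \in H -> A 1 v = v.
Proof. by case: actA => _ _ aF _ vH; rewrite -(scale1r 1) aF // scale1r. Qed.

Lemma act0 v : v \in H -> A 0 v = 0.
Proof. by case: actA => _ _ aF _ vH; rewrite -(scale0r 1) aF // scale0r. Qed.

Lemma actN a v : v \in H -> A (- a) v = - A a v.
Proof.
by move=> vH; apply/eqP; rewrite -addr_eq0; case: actA => aD _ _ _; rewrite -aD // addNr act0.
Qed.

Lemma actK a v : a != 0 -> v \in H -> A a^-1 (A a v) = v.
Proof. by case: actA => _ aM _ _ a0 vH; rewrite -aM // mulVf // act1. Qed.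

Lemma act_eq0 a v : v \in H -> v != 0 -> A a v = 0 -> a = 0.
Proof.
move=> vH v0 e; apply/eqP; apply: contraNT v0 => a0.
by rewrite -(actK a0 vH) e linear0.
Qed.

Lemma act_inj a b v : v \in H -> v != 0 -> A a v = A b v -> a = b.
Proof.
move=> vH v0 e; apply/eqP; rewrite -subr_eq0; apply/eqP/(act_eq0 vH v0).
by case: actA => aD _ _ _; rewrite aD // actN // e subrr.
Qed.

(** The map sending a to [A a x] is injective and linear from [L] to [X], and both have the same
    dimension. *)
Lemma act_orbit X x y : (X <= H)%VS -> stable A X -> \dim X = \dim {:L} ->
  x \in X -> x != 0 -> y \in X -> exists a, y = A a x.
Proof.
move=> XH sX dX xX x0 yX; have xH := subvP XH x xX.
have lin : linear (fun a => A a x).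
  move=> c a b; case: actA => aD aM aF aH.
  by rewrite -mulr_algl aD // aM // aF // aH.
pose fm := GRing.isLinear.Build F L V *:%R (fun a => A a x) lin.
pose f : {linear L -> V} := HB.pack (fun a => A a x) fm.
have fE a : linfun f a = A a x by rewrite lfunE.
have k0 : (fullv :&: lker (linfun f))%VS = 0%VS.
  apply/eqP; rewrite -subv0 capfv; apply/subvP => a.
  by rewrite memv_ker fE memv0 => /eqP/(act_eq0 xH x0) ->.
have : (limg (linfun f) == X)%VS.
  rewrite eqEdim limg_dim_eq // dX leqnn andbT; apply/subvP => _ /memv_imgP[a _ ->].
  by rewrite fE sX.
by move/eqP => e; move: yX; rewrite -e => /memv_imgP[a _ ->]; exists a; rewrite fE.
Qed.

End Orbits.

(** * Extending an action from a subspace to the whole space *)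

Section Extension.

Variables (T : L -> 'End(V)) (H X Y Z : {vspace V}).
Hypotheses (actT : action_on T H) (XH : (X <= H)%VS) (sX : stable T X).
Hypotheses (HY : (H :&: Y)%VS = 0%VS) (HYf : (H + Y)%VS = fullv).
Hypotheses (dXY : \dim X = \dim Y) (dXZ : \dim X = \dim Z).
Hypotheses (ZX : (Z :&: X)%VS = 0%VS) (ZY : (Z :&: Y)%VS = 0%VS).
Hypothesis (ZXY : (Z <= X + Y)%VS).

Let XY : (X :&: Y)%VS = 0%VS.
Proof. by apply/eqP; rewrite -subv0 -HY capvS. Qed.

Let YH : (Y :&: H)%VS = 0%VS. Proof. by rewrite capvC. Qed.
Let XZ : (X :&: Z)%VS = 0%VS. Proof. by rewrite capvC. Qed.
Let YZ : (Y :&: Z)%VS = 0%VS. Proof. by rewrite capvC. Qed.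

Let XYE : (Y + Z)%VS = (X + Y)%VS.
Proof.
apply/eqP; rewrite eqEdim subv_add addvSr ZXY /=.
by rewrite !dimv_disjoint_sum // -dXY -dXZ.
Qed.

Let XYE' : (X + Z)%VS = (X + Y)%VS.
Proof.
apply/eqP; rewrite eqEdim subv_add addvSl ZXY /=.
by rewrite !dimv_disjoint_sum // -dXY -dXZ.
Qed.

(* Z is the graph of a linear isomorphism from X to Y, up to sign. *)
Let mu := daddv_pi Y Z.
Let nu := daddv_pi X Z.

Let pi_other (A B : {vspace V}) v : (A :&: B)%VS = 0%VS -> v \in B -> daddv_pi A B v = 0.
Proof.
move=> AB vB; have := @daddv_pi_add _ _ A B v AB.
rewrite (@daddv_pi_id _ _ B A v) ?(capvC B) // memvE (subv_trans _ (addvSr _ _)) // => /(_ isT).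
by move/(congr1 (fun w => w - v)); rewrite addrK subrr.
Qed.

Let subZ (A B : {vspace V}) v : (A :&: B)%VS = 0%VS -> v \in (A + B)%VS ->
  v - daddv_pi A B v \in B.
Proof.
move=> AB vAB; rewrite -{1}(daddv_pi_add AB vAB) addrC addKr; exact: memv_pi.
Qed.

Let muX x : x \in X -> x - mu x \in Z.
Proof.
move=> xX; apply: subZ => //; rewrite XYE.
by rewrite memvE (subv_trans _ (addvSl _ _)).
Qed.

Let nuY y : y \in Y -> y - nu y \in Z.
Proof.
move=> yY; apply: subZ => //; rewrite XYE'.
by rewrite memvE (subv_trans _ (addvSr _ _)).
Qed.

Let muZ x y : x \in X -> y \in Y -> x - y \in Z -> mu x = y.
Proof.
move=> xX yY xyZ; have -> : x = y + (x - y) by rewrite addrC subrK.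
by rewrite linearD /= /mu (pi_other YZ xyZ) addr0 daddv_pi_id.
Qed.

Let nuZ x y : x \in X -> y \in Y -> y - x \in Z -> nu y = x.
Proof.
move=> xX yY xyZ; have -> : y = x + (y - x) by rewrite addrC subrK.
by rewrite linearD /= /nu (pi_other XZ xyZ) addr0 daddv_pi_id.
Qed.

Let muK x : x \in X -> nu (mu x) = x.
Proof.
move=> xX; apply: nuZ => //; first exact: memv_pi.
by rewrite -opprB memvN muX.
Qed.

Let nuK y : y \in Y -> mu (nu y) = y.
Proof.
move=> yY; apply: muZ => //; first exact: memv_pi.
by rewrite -opprB memvN nuY.
Qed.

Let S (c : L) : 'End(V) :=
  (T c \o daddv_pi H Y)%VF + (mu \o T c \o nu \o daddv_pi Y H)%VF.

Let SE c v : S c v = T c (daddv_pi H Y v) + mu (T c (nu (daddv_pi Y H v))).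
Proof. by rewrite /S add_lfunE !comp_lfunE. Qed.

Let SH c v : v \in H -> S c v = T c v.
Proof.
by move=> vH; rewrite SE daddv_pi_id // (pi_other YH vH) !linear0 addr0.
Qed.

Let SY c v : v \in Y -> S c v = mu (T c (nu v)).
Proof.
by move=> vY; rewrite SE (pi_other HY vY) linear0 add0r daddv_pi_id.
Qed.

(** On [Y] the action is that on [X], transported along the isomorphism [mu]. It preserves [Z]
    because it commutes with this isomorphism, whose graph, up to sign, is [Z]. *)
Lemma extend_action : exists S : L -> 'End(V),
  [/\ action_on S fullv, forall c v, v \in H -> S c v = T c v,
      stable S Y & stable S Z].
Proof.
have [aD aM aF aH] := actT; have sub := subvP XH.
have nX y : nu y \in X by apply: memv_pi.
exists S; split=> //.
- split=> [a b v _|a b v _|c v _|a v _]; last by rewrite memvf.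
  + rewrite !SE aD ?memv_pi // aD ?sub // linearD /=.
    by rewrite addrACA.
  + have hH : daddv_pi H Y v \in H by apply: memv_pi.
    rewrite [S b v]SE linearD /= (SH a (aH b _ hH)) (SY a (memv_pi _ _ _)).
    by rewrite muK ?sX // SE aM // aM ?sub.
  + rewrite SE aF ?memv_pi // aF ?sub // linearZ /= nuK ?memv_pi // -scalerDr.
    by rewrite daddv_pi_add // HYf memvf.
- by move=> a v vY; rewrite SY // memv_pi.
move=> a z zZ; have [x xX [y yY ez]] := memv_addP (subvP ZXY z zZ).
have nuy : nu y = - x by apply: nuZ; rewrite ?memvN // opprK addrC -ez.
rewrite ez linearD /= SH ?sub // SY // nuy !linearN /=.
by apply: muX; apply: sX.
Qed.

End Extension.

(** * The action defined by a field reduction *)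

Section Identification.

Variables (r : nat) (H : {vspace V}) (phi : 'rV[L]_r -> V).
Hypothesis idphi : is_identification H phi.

Let phi_ex (v : V) : exists x, phi x == projv H v.
Proof.
by case: idphi => _ _ _ /(_ (projv H v))[h _]; have [x <-] := h (memv_proj H v); exists x.
Qed.

Let psi (v : V) : 'rV[L]_r := xchoose (phi_ex v).

Let psiK v : phi (psi v) = projv H v.
Proof. exact/eqP/(xchooseP (phi_ex v)). Qed.

(** Scalar multiplication on the coordinate space is carried over by [phi]; composing with the
    projection onto [H] makes it an endomorphism of all of [V]. *)
Lemma identification_action : exists A : L -> 'End(V),
  action_on A H /\ forall a x, A a (phi x) = phi (a *: x).
Proof.
have [phiD phiZ phi_inj phiH] := idphi.
have phi_mem x : phi x \in H by apply/phiH; exists x.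
have phiK x : psi (phi x) = x by apply: phi_inj; rewrite psiK projv_id.
have lin a : linear (fun v => phi (a *: psi v)).
  move=> c u v; rewrite -phiZ -phiD; congr phi.
  rewrite scalerA -[_ * a]mulrC -scalerA -scalerDr; congr (_ *: _).
  by apply: phi_inj; rewrite phiD phiZ !psiK linearP.
pose f a : {linear V -> V} := HB.pack (fun v => phi (a *: psi v))
  (GRing.isLinear.Build F V V *:%R (fun v => phi (a *: psi v)) (lin a)).
have fE a v : linfun (f a) v = phi (a *: psi v) by rewrite lfunE.
exists (fun a => linfun (f a)); split=> [|a x]; last by rewrite fE phiK.
split=> [a b v vH|a b v vH|c v vH|a v vH]; rewrite ?fE //.
- by rewrite scalerDl phiD.
- by rewrite phiK scalerA.
- by rewrite phiZ psiK projv_id.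
Qed.

End Identification.

End Actions.

(** * Endomorphisms preserving Q stable subspaces of a line *)

Section Eigen.

Variables (F : finFieldType) (m n : nat).
Local Notation V := 'rV[F]_m.
Local Notation q := #|F|.
Local Notation Q := (q ^ n)%N.
Variables (L : fieldExtType F) (A : L -> 'End(V)) (M : {vspace V}).
Variables (D : {fset {vspace V}}) (g : 'End(V)).
Implicit Types (X Y Z : {vspace V}) (x y v w : V).
Hypothesis Q_gt3 : (3 < Q)%N.
Hypothesis dimL : \dim {:L} = n.
Hypothesis dimM : \dim M = (2 * n)%N.
Hypothesis actA : action_on A M.
Hypothesis dimD : forall X, X \in D -> \dim X = n.
Hypothesis subD : forall X, X \in D -> (X <= M)%VS.
Hypothesis capD : forall X Y, X \in D -> Y \in D -> X != Y -> (X :&: Y)%VS = 0%VS.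
Hypothesis cardD : #|` D| = Q.
Hypothesis stD : forall X, X \in D -> stable A X.
Hypothesis gD : forall X v, X \in D -> v \in X -> g v \in X.

Let addD Y Z : Y \in D -> Z \in D -> Y != Z -> (Y + Z)%VS = M.
Proof.
move=> YD ZD YZ; apply/eqP; rewrite eqEdim subv_add !subD //=.
by rewrite dimv_disjoint_sum ?capD // dimM (dimD YD) (dimD ZD) mul2n addnn.
Qed.

Let capP X Y v : X \in D -> Y \in D -> X != Y -> v \in X -> v \in Y -> v = 0.
Proof.
move=> XD YD XY vX vY; apply/eqP; rewrite -memv0 -(capD XD YD XY).
by rewrite memv_cap vX.
Qed.

(** The vectors [w] of [Y] for which [x + w] lies in an element of [D] other than [Y], one for each
    such element. *)
Let mates Y x : {fset V} := (fun Z => - daddv_pi Y Z x) @` (D `\ Y).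

Let matesP Y x w : x \in M -> Y \in D -> w \in mates Y x ->
  w \in Y /\ exists2 Z, Z \in D & x + w \in Z.
Proof.
move=> xM YD /imfsetP[Z /= + ->]; rewrite in_fsetD1 => /andP[ZY ZD].
have YZ : Y != Z by rewrite eq_sym.
split; first by rewrite memvN memv_pi.
exists Z => //; rewrite -{1}(@daddv_pi_add _ _ Y Z x) ?capD ?addD //.
by rewrite addrC addKr memv_pi.
Qed.

(** If two elements gave the same [w], then [x + w] would lie in both and vanish, so [x] would lie
    in [Y]. The count includes [w = 0], which comes from [X] itself. *)
Let card_mates X Y x : X \in D -> Y \in D -> X != Y -> x \in X -> x != 0 ->
  #|` mates Y x| = (Q - 1)%N.
Proof.
move=> XD YD XY xX x0; have xM : x \in M := subvP (subD XD) x xX.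
rewrite /mates card_imfset_in; last first.
  move=> Z Z'; rewrite !in_fsetD1 => /andP[ZY ZD] /andP[Z'Y Z'D] /= e.
  apply/eqP; apply: contraT => ZZ'.
  have YZ : Y != Z by rewrite eq_sym.
  have YZ' : Y != Z' by rewrite eq_sym.
  have mZ : x - daddv_pi Y Z x \in Z.
    by rewrite -{1}(@daddv_pi_add _ _ Y Z x) ?capD ?addD // addrC addKr memv_pi.
  have mZ' : x - daddv_pi Y Z x \in Z'.
    by rewrite e -{1}(@daddv_pi_add _ _ Y Z' x) ?capD ?addD // addrC addKr memv_pi.
  have /eqP := capP ZD Z'D ZZ' mZ mZ'; rewrite subr_eq0 => /eqP ex.
  by case/eqP: x0; apply: (capP XD YD XY xX); rewrite ex memv_pi.
by rewrite -cardD (cardfsD1 Y D) YD add1n subn1.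
Qed.

Let eig X x : X \in D -> x \in X -> exists a, g x = A a x.
Proof.
move=> XD xX; have [-> |x0] := eqVneq x 0; first by exists 0; rewrite !linear0.
apply: (act_orbit actA (subD XD)) => //; rewrite ?dimD ?dimL //; first exact: stD.
exact: gD.
Qed.

(** Since [x + y] is an eigenvector too, its eigenvalue can be compared with [a] and [b] in the
    components along [X] and [Y]. *)
Let eig_mates X Y x y a b : X \in D -> Y \in D -> X != Y -> x \in X -> x != 0 ->
  y != 0 -> y \in mates Y x -> g x = A a x -> g y = A b y -> a = b.
Proof.
move=> XD YD XY xX x0 y0 ym ea eb; have xM : x \in M := subvP (subD XD) x xX.
have [yY [Z ZD xyZ]] := matesP xM YD ym.
have yM : y \in M := subvP (subD YD) y yY.
have [c ec] := eig ZD xyZ.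
have e0 : A a x - A c x = A c y - A b y.
  apply/eqP; rewrite subr_eq addrAC eq_sym subr_eq eq_sym -ea -eb -linearD /= ec.
  by rewrite linearD addrC.
have z0 : A a x - A c x = 0.
  apply: (capP XD YD XY); first by rewrite memvB // stD.
  by rewrite e0 memvB // stD.
have ac : a = c by apply: (act_inj actA xM x0); apply/eqP; rewrite -subr_eq0 z0.
rewrite ac; apply: (act_inj actA yM y0); apply/eqP.
by rewrite -subr_eq0 -e0 z0.
Qed.

Let nz_fset (S : {fset V}) : (1 < #|` S|)%N -> exists2 y, y \in S & y != 0.
Proof. by move=> gt1; apply: card_ge2_fset. Qed.

(** The mates of [x] and of [x'] are two sets of Q-1 vectors among the Q vectors of [Y], so at least
    Q-2 > 1 are common, and one of these is nonzero. Its eigenvalue equals both [a] and [b]. *)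
Let eig_eq X Y x x' a b : X \in D -> Y \in D -> X != Y -> x \in X -> x != 0 ->
  x' \in X -> x' != 0 -> g x = A a x -> g x' = A b x' -> a = b.
Proof.
move=> XD YD XY xX x0 x'X x'0 ea eb.
pose Yf := [fset v in Y].
have cYf : #|` Yf| = Q by rewrite card_finset card_vs dimD.
have sub z : z \in X -> mates Y z `<=` Yf.
  move=> zX; apply/fsubsetP => w /(matesP (subvP (subD XD) z zX) YD)[wY _].
  by rewrite !inE.
have [y + y0] : exists2 y, y \in mates Y x `&` mates Y x' & y != 0.
  apply: nz_fset; have := cardfsUI (mates Y x) (mates Y x').
  have : (#|` mates Y x `|` mates Y x'| <= #|` Yf|)%N.
    by apply: fsubset_leq_card; rewrite fsubUset !sub.
  rewrite cYf (card_mates XD YD XY xX x0) (card_mates XD YD XY x'X x'0).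
  by move: Q_gt3; move: #|` _| #|` _| (Q) => i j k; clear; lia.
rewrite in_fsetI => /andP[yx yx'].
have [yY _] := matesP (subvP (subD XD) x xX) YD yx.
have [c ec] := eig YD yY.
rewrite (eig_mates XD YD XY xX x0 y0 yx ea ec).
by rewrite (eig_mates XD YD XY x'X x'0 y0 yx' eb ec).
Qed.

(* Every vector of an element of [D] is an eigenvector of [g] over [L]; two of them from
   different elements have the same eigenvalue as soon as their sum lies in a third one. *)
Lemma eigen_scalar : exists a, forall v, v \in M -> g v = A a v.
Proof.
have gt1 : (1 < #|` D|)%N by rewrite cardD; apply: leq_trans Q_gt3.
have [X XD _] := card_ge2_fset gt1 0%VS.
have [Y YD YX] := card_ge2_fset gt1 X; have XY : X != Y by rewrite eq_sym.
have n0 : (0 < n)%N by move: Q_gt3; case: (n) => //; rewrite expn0.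
have [x xX x0] : exists2 x, x \in X & x != 0.
  exists (vpick X); first exact: memv_pick.
  by rewrite vpick0 -dimv_eq0 dimD // -lt0n.
have [a ea] := eig XD xX; exists a.
have hX x' : x' \in X -> g x' = A a x'.
  move=> x'X; have [-> |x'0] := eqVneq x' 0; first by rewrite !linear0.
  have [b eb] := eig XD x'X.
  by rewrite (eig_eq XD YD XY xX x0 x'X x'0 ea eb).
have hY y : y \in Y -> g y = A a y.
  move=> yY; have [-> |y0] := eqVneq y 0; first by rewrite !linear0.
  have [b eb] := eig YD yY; rewrite eb.
  have [z zm z0] : exists2 z, z \in mates X y & z != 0.
    apply: nz_fset; rewrite (card_mates YD XD YX yY y0).
    by move: Q_gt3; move: (Q) => k; clear; lia.
  have [zX _] := matesP (subvP (subD YD) y yY) XD zm.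
  by rewrite (eig_mates YD XD YX yY y0 z0 zm eb (hX z zX)).
move=> v; rewrite -(addD XD YD XY) => /memv_addP[u uX [w wY ->]].
by rewrite !linearD /= hX // hY.
Qed.

End Eigen.

(** * Field reduction *)

Section Reduction.

Variables (F : fieldType) (V : vectType F) (L : fieldExtType F) (r : nat).
Variables (H : {vspace V}) (phi : 'rV[L]_r -> V).
Hypothesis idphi : is_identification H phi.
Implicit Types (W P : {vspace 'rV[L]_r}) (X Y : {vspace V}).

Lemma phi0 : phi 0 = 0.
Proof.
case: idphi => phiD _ _ _; apply: (addrI (phi 0)).
by rewrite -phiD !addr0.
Qed.

Lemma reduction_line w : w != 0 -> exists X,
  is_reduction_of phi <[w]> X /\ \dim X = \dim {:L}.
Proof.
move=> w0; have [phiD phiZ phi_inj _] := idphi.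
have lin : linear (fun a => phi (a *: w)).
  by move=> c a b; rewrite -mulr_algl scalerDl phiD -scalerA phiZ.
pose fm := GRing.isLinear.Build F L V *:%R (fun a => phi (a *: w)) lin.
pose f : {linear L -> V} := HB.pack (fun a => phi (a *: w)) fm.
have fE a : linfun f a = phi (a *: w) by rewrite lfunE.
exists (limg (linfun f)); split.
  move=> y; split=> [/memv_imgP[a _ ->]|[_ /vlineP[a ->] <-]].
    by exists (a *: w); rewrite ?fE // memvZ ?memv_line.
  by rewrite -fE memv_img ?memvf.
apply: limg_dim_eq; apply/eqP; rewrite -subv0 capfv; apply/subvP => a.
rewrite memv_ker fE memv0 -phi0 => /eqP/phi_inj/eqP.
by rewrite scaler_eq0 (negPf w0) orbF.
Qed.

Lemma reduction_add W W' X X' : is_reduction_of phi W X -> is_reduction_of phi W' X' ->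
  is_reduction_of phi (W + W') (X + X').
Proof.
have [phiD _ _ _] := idphi; move=> h h' y; split.
  case/memv_addP => x /h[w wW <-] [x' /h'[w' w'W <-] ->].
  by exists (w + w'); rewrite ?memv_add.
case=> _ /memv_addP[w wW [w' w'W ->]] <-; rewrite phiD memv_add //.
  by apply/h; exists w.
by apply/h'; exists w'.
Qed.

Lemma reduction_mem W X x : is_reduction_of phi W X -> (phi x \in X) = (x \in W).
Proof.
have [_ _ phi_inj _] := idphi; move=> h; apply/idP/idP => [/h[w wW /phi_inj <-] //|xW].
by apply/h; exists x.
Qed.

Lemma reduction_sub W W' X X' : is_reduction_of phi W X -> is_reduction_of phi W' X' ->
  (X <= X')%VS = (W <= W')%VS.
Proof.
move=> h h'; apply/subvP/subvP => s y.
  by rewrite -(reduction_mem y h) -(reduction_mem y h') => /s.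
by case/h => w /s wW <-; rewrite (reduction_mem w h').
Qed.

Lemma reduction_uniq W X X' : is_reduction_of phi W X -> is_reduction_of phi W X' -> X = X'.
Proof.
move=> h h'; apply/eqP; rewrite eqEsubv (reduction_sub h h') (reduction_sub h' h).
by rewrite subvv.
Qed.

Lemma reduction_exists W : exists X, is_reduction_of phi W X /\
  \dim X = (\dim W * \dim {:L})%N.
Proof.
suff gen (s : seq 'rV[L]_r) : free s -> exists X, is_reduction_of phi <<s>> X /\
    \dim X = (\dim <<s>> * \dim {:L})%N.
  have bW := vbasisP W; rewrite -(span_basis bW).
  exact: gen (basis_free bW).
elim: s => [|w s IH] fs.
  exists 0%VS; rewrite span_nil !dimv0; split=> // y; rewrite memv0; split.
    by move/eqP ->; exists 0; rewrite ?mem0v ?phi0.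
  by case=> x; rewrite memv0 => /eqP -> <-; rewrite phi0.
move: (fs); rewrite free_cons => /andP[ws /IH[X [hX dX]]].
have w0 : w != 0 by apply: contraNneq ws => ->; rewrite mem0v.
have [Y [hY dY]] := reduction_line w0.
exists (Y + X)%VS; rewrite span_cons; split; first exact: reduction_add.
have c0 : (<[w]> :&: <<s>>)%VS = 0%VS.
  apply/eqP; rewrite -subv0; apply/subvP => v; rewrite memv_cap memv0.
  case/andP => /vlineP[c ->] cws; rewrite scaler_eq0; apply/orP; left.
  by apply: contraNT ws => c0; rewrite -[w](scalerK c0) memvZ.
rewrite !dimv_disjoint_sum // ?dY ?dX ?dim_vline ?w0 ?mulnDl ?mul1n //.
apply/eqP; rewrite -subv0; apply/subvP => y; rewrite memv_cap memv0.
case/andP => /hY[x xw <-]; rewrite (reduction_mem x hX) => xs.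
have : x \in (<[w]> :&: <<s>>)%VS by rewrite memv_cap xw.
by rewrite c0 memv0 => /eqP ->; rewrite phi0.
Qed.

Lemma reduction_dim W X : is_reduction_of phi W X -> \dim X = (\dim W * \dim {:L})%N.
Proof.
by move=> h; have [Y [hY dY]] := reduction_exists W; rewrite (reduction_uniq h hY).
Qed.

End Reduction.

(** * Elementary weak eggs satisfy the conditions *)

(** The results on caps are proved over a finite field; an extension of finite degree of [F] is one,
    with Q elements. *)
Lemma cap_good_point (F : finFieldType) (L : fieldExtType F)
    (C : {fset {vspace 'rV[L]_4}}) (Q := (#|F| ^ \dim {:L})%N) :
  (3 < Q)%N -> is_cap C -> #|` C| = (Q ^ 2 + 1)%N ->
  exists P t, [/\ P \in C,
    forall X Y, X \in C -> Y \in C -> uniq [:: P; X; Y] ->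
      #|` [fset Z in C | (Z <= P + X + Y)%VS]| = (Q + 1)%N,
    \dim t = 3, ~~ (P <= t)%VS & (4 < #|` [fset Z in C | (Z <= t)%VS]|)%N].
Proof.
have eK : #|FinFieldExtType L| = Q.
  rewrite /Q -(card_vspace (T := finvect_type L)).
  by apply/esym; apply: (card_vspacef (T := finvect_type L)).
rewrite -eK => Q3 capC cC.
have [P PC gP] := @ovoid_good_point (FinFieldExtType L) C capC cC (ltnW Q3).
have [t [dt Pt ct]] := @exists_big_plane (FinFieldExtType L) C capC cC P Q3 PC gP.
by exists P, t.
Qed.

Section ReductionSets.

Variables (F : finFieldType) (k : nat).
Local Notation V := 'rV[F]_k.
Variables (L : fieldExtType F) (r : nat).
Variables (H : {vspace V}) (phi : 'rV[L]_r -> V).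
Hypothesis idphi : is_identification H phi.
Implicit Types (W P : {vspace 'rV[L]_r}) (X Y : {vspace V}).

Lemma reduction_pt P X w : is_reduction_of phi P X -> \dim P = 1%N ->
  phi w = vpick X -> P = <[w]>%VS.
Proof.
move=> hX dP ew.
have wP : w \in P by rewrite -(reduction_mem idphi w hX) ew memv_pick.
have w0 : w != 0.
  apply: contraTneq isT => w0; move: ew; rewrite w0 (phi0 idphi) => /esym/eqP.
  rewrite vpick0 => /eqP X0; have := reduction_dim idphi hX.
  rewrite X0 dimv0 dP mul1n => /esym/eqP; rewrite dimv_eq0 => /eqP L0.
  by have := memvf (1 : L); rewrite L0 memv0 oner_eq0.
by apply/eqP; rewrite eq_sym eqEdim -memvE wP dim_vline w0 dP.
Qed.

Lemma reduction_inverse : exists f : {vspace V} -> {vspace 'rV[L]_r},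
  forall P X, \dim P = 1%N -> is_reduction_of phi P X -> f X = P.
Proof.
(* The second disjunct provides a witness for every subspace, so that the inverse is a total
   function. It is used only on images of points, which lie in [H]. *)
have ex (X : {vspace V}) : exists w, (phi w == vpick X) || ~~ (vpick X \in H).
  case XH: (vpick X \in H); last by exists 0; rewrite orbT.
  by case: idphi => _ _ _ /(_ (vpick X))[/(_ XH)[w <-] _]; exists w; rewrite eqxx.
exists (fun X => <[xchoose (ex X)]>%VS) => P X dP hX.
apply/esym/(reduction_pt hX dP).
have XH : vpick X \in H.
  by case: idphi => _ _ _ phiH; apply/phiH; have /hX[w _ <-] := memv_pick X; exists w.
by have /orP[/eqP //|] := xchooseP (ex X) => /negP[].
Qed.

Variables (S : {fset {vspace V}}) (C : {fset {vspace 'rV[L]_r}}).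
Hypothesis capC : is_cap C.
Hypothesis redS : forall X, X \in S <-> exists2 P, P \in C & is_reduction_of phi P X.

Lemma reduction_of_pt P : P \in C -> exists2 X, X \in S & is_reduction_of phi P X.
Proof.
by move=> PC; have [X [hX _]] := reduction_exists idphi P; exists X => //; apply/redS; exists P.
Qed.

Lemma card_reduction W Y : is_reduction_of phi W Y ->
  #|` [fset X in S | (X <= Y)%VS]| = #|` [fset P in C | (P <= W)%VS]|.
Proof.
move=> hY; have [f hf] := reduction_inverse.
have dC P : P \in C -> \dim P = 1%N by case: capC => h _; apply: h.
rewrite -(@card_imfset_in _ _ f [fset X in S | (X <= Y)%VS]).
  congr #|` _|; apply/fsetP => P; rewrite in_sep; apply/imfsetP/andP.
    case=> X /=; rewrite in_sep => /andP[/redS[P' P'C hX] XY] ->.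
    by rewrite (hf P') ?dC // -(reduction_sub idphi hX hY).
  case=> PC PW; have [X XS hX] := reduction_of_pt PC.
  exists X; last by rewrite (hf P) ?dC.
  by rewrite /= in_sep XS (reduction_sub idphi hX hY).
move=> X X'; rewrite !in_sep => /andP[/redS[P PC hX] _] /andP[/redS[P' P'C hX'] _].
rewrite (hf P) ?dC // (hf P') ?dC // => e; rewrite -e in hX'.
exact: (reduction_uniq idphi hX hX').
Qed.

Lemma card_reduction_full : #|` S| = #|` C|.
Proof.
have [Y [hY _]] := reduction_exists idphi fullv.
have := card_reduction hY.
have -> : [fset P in C | (P <= fullv)%VS] = C.
  by apply/fsetP => P; rewrite in_sep subvf andbT.
suff -> : [fset X in S | (X <= Y)%VS] = S by [].
apply/fsetP => X; rewrite in_sep; case XS: (X \in S) => //=.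
by have [/(_ XS)[P PC hX] _] := redS X; rewrite (reduction_sub idphi hX hY) subvf.
Qed.

End ReductionSets.

Section Forward.

Variables (F : finFieldType) (n : nat).
Local Notation V := 'rV[F]_(4 * n).
Local Notation Q := (#|F| ^ n)%N.
Variables (L : fieldExtType F) (phi : 'rV[L]_4 -> V).
Variables (S : {fset {vspace V}}) (C : {fset {vspace 'rV[L]_4}}).
Hypothesis dimL : \dim {:L} = n.
Hypothesis idphi : is_identification fullv phi.
Hypothesis capC : is_cap C.
Hypothesis redS : forall X, X \in S <-> exists2 P, P \in C & is_reduction_of phi P X.
Hypothesis capS : is_pseudo_cap n S.
Implicit Types (X Y Z U : {vspace V}) (P W : {vspace 'rV[L]_4}).

Lemma reduction_span3 X Y Z U : X \in S -> Y \in S -> Z \in S -> uniq [:: X; Y; Z] ->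
  \dim U = (3 * n)%N -> (X <= U)%VS -> (Y <= U)%VS -> (Z <= U)%VS ->
  (X + Y + Z)%VS = U.
Proof.
move=> XS YS ZS u dU XU YU ZU; apply/eqP; rewrite eqEdim !subv_add XU YU ZU dU.
by case: capS => _ /(_ X Y Z XS YS ZS u) ->; rewrite leqnn.
Qed.

(** Three elements of [O] span [U], so [U] is the reduction of the plane [W] spanned by their
    points. A basis of [W] identifies it with the coordinate space of PG(2), and the points of the
    cap that correspond to [O] are pulled back to it. *)
Lemma elementary_section O U : \dim U = (3 * n)%N -> (O `<=` S) -> contained_in O U ->
  (2 < #|` O|)%N -> is_elementary_pseudo_oval O.
Proof.
move=> dU /fsubsetP OS OU gt2.
have [X [Y [Z [XO YO ZO u]]]] := card_gt2_fset gt2.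
have eU := reduction_span3 (OS X XO) (OS Y YO) (OS Z ZO) u dU (OU X XO) (OU Y YO) (OU Z ZO).
have spanO : span_of O = U.
  apply/eqP; rewrite eqEsubv; apply/andP; split.
    rewrite /span_of big_seq; elim/big_ind: _ => [|A B AU BU|T TO]; last exact: OU.
      exact: sub0v.
    by rewrite subv_add AU.
  have sub T : T \in O -> (T <= span_of O)%VS.
    by move=> TO; rewrite /span_of (big_fsetD1 T) //= addvSl.
  by rewrite -eU !subv_add !sub.
have [[P PC hP] [P' P'C hP'] [P'' P''C hP'']] :
  [/\ exists2 P, P \in C & is_reduction_of phi P X,
      exists2 P, P \in C & is_reduction_of phi P Y
    & exists2 P, P \in C & is_reduction_of phi P Z].
  by split; apply/redS; apply: OS.
pose W := (P + P' + P'')%VS.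
have hW : is_reduction_of phi W U.
  by rewrite -eU; apply: (reduction_add idphi _ hP''); apply: (reduction_add idphi hP hP').
have dW : \dim W = 3.
  have n0 : (0 < n)%N by rewrite -dimL adim_gt0.
  by have := reduction_dim idphi hW; rewrite dU dimL => /eqP; rewrite eqn_pmul2r // => /eqP.
have [b bW] : exists b : 3.-tuple 'rV[L]_4, basis_of W b.
  by move: (vbasis W) (vbasisP W); rewrite dW => b; exists b.
have lin : linear (fun x : 'rV[L]_3 => \sum_i x 0 i *: b`_i).
  move=> a x y; rewrite scaler_sumr -big_split /=; apply: eq_bigr => i _.
  by rewrite !mxE scalerDl scalerA.
pose g : {linear 'rV[L]_3 -> 'rV[L]_4} := HB.pack (fun x : 'rV[L]_3 => \sum_i x 0 i *: b`_i)
  (GRing.isLinear.Build L 'rV[L]_3 'rV[L]_4 *:%R (fun x : 'rV[L]_3 => \sum_i x 0 i *: b`_i) lin).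
have gE x : linfun g x = \sum_i x 0 i *: b`_i by rewrite lfunE.
have g0 : lker (linfun g) == 0%VS.
  rewrite -subv0; apply/subvP => x; rewrite memv_ker gE memv0 => /eqP e.
  apply/eqP/rowP => i; rewrite mxE.
  by have /freeP fb := basis_free bW; rewrite (fb (fun i => x 0 i) e).
have gW : limg (linfun g) = W.
  apply/eqP; rewrite eqEsubv; apply/andP; split.
    apply/subvP => _ /memv_imgP[x _ ->]; rewrite gE; apply: memv_suml => i _.
    by rewrite memvZ // (basis_mem bW) // mem_nth ?size_tuple.
  apply/subvP => w wW; rewrite (coord_basis bW wW).
  rewrite (_ : \sum_i _ = linfun g (\row_i coord b i w)) ?memv_img ?memvf // gE.
  by apply: eq_bigr => i _; rewrite mxE.
have gK T : (T <= W)%VS -> (linfun g @: (linfun g @^-1: T))%VS = T.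
  by move=> TW; rewrite lpreimK // gW.
have gdim (T : {vspace 'rV[L]_3}) : \dim (linfun g @: T) = \dim T.
  by apply: limg_dim_eq; rewrite (eqP g0) capv0.
have dC T : T \in C -> \dim T = 1%N by case: capC => h _; apply: h.
have [f hf] := reduction_inverse idphi.
have fO X' : X' \in O -> [/\ f X' \in C, is_reduction_of phi (f X') X' & (f X' <= W)%VS].
  move=> X'O; have /redS[T TC hT] := OS X' X'O.
  rewrite (hf T) ?dC //; split=> //.
  by rewrite -(reduction_sub idphi hT hW) OU.
rewrite /is_elementary_pseudo_oval spanO.
exists L, (phi \o linfun g), ((fun X' => (linfun g @^-1: f X')%VS) @` O).
have [phiD phiZ phi_inj _] := idphi.
split=> //.
- split=> [x y|c x|x y|y] /=.
  + by rewrite linearD phiD.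
  + by rewrite linearZ phiZ.
  + by move/phi_inj; apply/lker0P.
  + split=> [/hW[w]|[x <-]].
      by rewrite -gW => /memv_imgP[x _ ->] <-; exists x.
    by apply/hW; exists (linfun g x); rewrite // -gW memv_img ?memvf.
- split=> [T /imfsetP[X' /= /fO[fC _ fW] ->]|].
    by rewrite -gdim gK // dC.
  move=> T T' T'' /imfsetP[A /= /fO[AC _ AW] eA] /imfsetP[B /= /fO[BC _ BW] eB].
  case/imfsetP => [D /= /fO[DC _ DW] eD] u'.
  rewrite -gdim !limgD eA eB eD !gK //; case: capC => _; apply=> //.
  apply: (@map_uniq _ _ (fun T => (linfun g @^-1: T)%VS)).
  by rewrite /= -eA -eB -eD.
- move=> X'; split=> [X'O|[_ /imfsetP[Y' /= Y'O ->] hY']].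
    have [_ hX' fW] := fO X' X'O.
    exists (linfun g @^-1: f X')%VS; first by apply/imfsetP; exists X'.
    move=> y; split=> [/hX'[w]|[x]]; last first.
      by rewrite -memv_preim => xf <-; apply/hX'; exists (linfun g x).
    by rewrite -{1}(gK _ fW) => /memv_imgP[x xf ->] <-; exists x.
have [_ hX' fW] := fO Y' Y'O.
suff -> : X' = Y' by [].
apply/vspaceP => y; apply/idP/idP => [/hY'[x]|/hX'[w]].
  by rewrite -memv_preim => xf <-; apply/hX'; exists (linfun g x).
by rewrite -{1}(gK _ fW) => /memv_imgP[x xf ->] <-; apply/hY'; exists x.
Qed.

(** [E] comes from a good point of the cap, and [U] from a plane missing that point and containing
    at least five points of the cap. *)
Lemma elementary_conditions : (4 < Q)%N -> #|` S| = (#|F| ^ (2 * n) + 1)%N ->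
  exists E E1 E2 E3 E4 E5 : {vspace V},
    [/\ E \in S,
        [/\ E1 \in S, E2 \in S, E3 \in S, E4 \in S & E5 \in S],
        uniq [:: E1; E2; E3; E4; E5]
      & [/\ is_good_at S E,
            exists U : {vspace V},
              [/\ \dim U = (3 * n)%N,
                  (U :&: E)%VS = 0%VS
                & [/\ (E1 <= U)%VS, (E2 <= U)%VS, (E3 <= U)%VS,
                      (E4 <= U)%VS & (E5 <= U)%VS]]
          & forall O : {fset {vspace V}},
              is_pseudo_oval_of S O -> E \in O ->
              [\/ E1 \in O, E2 \in O | E3 \in O] ->
              is_elementary_pseudo_oval O]].
Proof.
move=> Q4 cS.
have cC : #|` C| = ((#|F| ^ \dim {:L}) ^ 2 + 1)%N.
  by rewrite -(card_reduction_full idphi capC redS) cS dimL -expnM mulnC.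
have Q3 : (3 < #|F| ^ \dim {:L})%N by rewrite dimL ltnW.
have [P [t [PC gP dt Pt ct]]] := cap_good_point Q3 capC cC.
rewrite dimL in gP.
have dC T : T \in C -> \dim T = 1%N by case: capC => h _; apply: h.
have [E ES hE] := reduction_of_pt idphi redS PC.
have [U [hU dU]] := reduction_exists idphi t.
have [f hf] := reduction_inverse idphi.
pose SU := [fset X in S | (X <= U)%VS].
have cSU : (4 < #|` SU|)%N by rewrite (card_reduction idphi capC redS hU).
have [E1 [E2 [E3 [E4 [E5 [h1 h2 h3 h4 [h5 u]]]]]]] : exists E1 E2 E3 E4 E5,
    [/\ E1 \in SU, E2 \in SU, E3 \in SU, E4 \in SU & E5 \in SU /\
     uniq [:: E1; E2; E3; E4; E5]].
  have := fset_uniq SU; have mem X : (X \in SU) = (X \in enum_fset SU) by [].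
  move: cSU mem; case: (enum_fset SU) => [|X1 [|X2 [|X3 [|X4 [|X5 s]]]]] //= _ mem us.
  exists X1, X2, X3, X4, X5; rewrite !mem !in_cons !eqxx !orbT; split=> //; split=> //.
  have := take_uniq 5; move/(_ _ (X1 :: X2 :: X3 :: X4 :: X5 :: s)) => /=.
  by rewrite take0; apply.
move: h1 h2 h3 h4 h5; rewrite !in_sep.
move=> /andP[s1 u1] /andP[s2 u2] /andP[s3 u3] /andP[s4 u4] /andP[s5 u5].
exists E, E1, E2, E3, E4, E5; split=> //; split.
- move=> U' dU' EU' [X [Y [XS YS uXY XU YU]]].
  have eU := reduction_span3 ES XS YS uXY dU' EU' XU YU.
  have [PX PXC hX] := (redS X).1 XS; have [PY PYC hY] := (redS Y).1 YS.
  have hU' : is_reduction_of phi (P + PX + PY) U'.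
    by rewrite -eU; apply: (reduction_add idphi _ hY); apply: (reduction_add idphi hE hX).
  rewrite (card_reduction idphi capC redS hU') gP //.
  move: uXY; rewrite /= !inE !negb_or !andbT => /andP[/andP[EX EY] XY].
  apply/andP; split; [apply/andP; split|].
  + by apply: contraNneq EX => e; rewrite e in hE; apply/eqP; apply: (reduction_uniq idphi hE hX).
  + by apply: contraNneq EY => e; rewrite e in hE; apply/eqP; apply: (reduction_uniq idphi hE hY).
  + by apply: contraNneq XY => e; rewrite e in hX; apply/eqP; apply: (reduction_uniq idphi hX hY).
- exists U; split; [by rewrite dU dt dimL | | by split].
  apply/eqP; rewrite -subv0; apply/subvP => v; rewrite memv_cap memv0.
  case/andP => /hU[w wt <-]; rewrite (reduction_mem idphi w hE) => wP.
  have : w \in (t :&: P)%VS by rewrite memv_cap wt.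
  by rewrite (pt_capv (dC P PC) Pt) memv0 => /eqP ->; rewrite (phi0 idphi).
move=> O [OS cO [U' dU' OU']] _ _; apply: (elementary_section dU' OS OU').
by rewrite cO addn1 ltnS; apply: leq_trans Q4.
Qed.

End Forward.

(** * The conditions imply elementarity *)

Section Reverse.

Variables (F : finFieldType) (n : nat).
Local Notation V := 'rV[F]_(4 * n).
Local Notation q := #|F|.
Local Notation Q := (q ^ n)%N.
Variables (S : {fset {vspace V}}) (E U : {vspace V}).
Implicit Types (X Y Z R M : {vspace V}).
Hypothesis n_gt0 : (0 < n)%N.
Hypothesis Q_gt5 : (5 < Q)%N.
Hypothesis capS : is_pseudo_cap n S.
Hypothesis cardS : #|` S| = (q ^ (2 * n) + 1)%N.
Hypothesis ES : E \in S.
Hypothesis goodE : is_good_at S E.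
Hypothesis dimU : \dim U = (3 * n)%N.
Hypothesis UE : (U :&: E)%VS = 0%VS.

Lemma card_pcap : #|` S| = (Q ^ 2 + 1)%N.
Proof. by rewrite cardS [(2 * n)%N]mulnC expnM. Qed.

Lemma pcap_dim X : X \in S -> \dim X = n.
Proof. by case: capS => h _; apply: h. Qed.

Lemma pcap_dim3 X Y Z : X \in S -> Y \in S -> Z \in S -> X != Y -> X != Z -> Y != Z ->
  \dim (X + Y + Z) = (3 * n)%N.
Proof.
move=> XS YS ZS XY XZ YZ; case: capS => _; apply=> //=.
by rewrite !inE negb_or XY XZ YZ.
Qed.

Lemma pcap_third X Y : exists Z, [/\ Z \in S, Z != X & Z != Y].
Proof.
have : S `\` [fset X; Y] != fset0.
  rewrite -cardfs_gt0 cardfsD card_pcap subn_gt0.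
  apply: leq_ltn_trans (fsubset_leq_card (fsubsetIr _ _)) _.
  rewrite cardfs2 addn1; case: (_ != _) => /=; move: Q_gt5; clear;
  by move: (Q) => k; rewrite expnS expn1; nia.
case/fset0Pn => Z; rewrite in_fsetD in_fset2 negb_or => /andP[/andP[ZX ZY] ZS].
by exists Z.
Qed.

Lemma pcap_dim2 X Y : X \in S -> Y \in S -> X != Y -> \dim (X + Y) = (2 * n)%N.
Proof.
move=> XS YS XY; have [Z [ZS ZX ZY]] := pcap_third X Y.
have := pcap_dim3 XS YS ZS XY; rewrite eq_sym ZX eq_sym ZY => /(_ isT isT).
have := dimv_sum_cap (X + Y) Z; have := dimv_sum_cap X Y.
rewrite (pcap_dim XS) (pcap_dim YS) (pcap_dim ZS); clear; lia.
Qed.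

Lemma pcap_cap X Y : X \in S -> Y \in S -> X != Y -> (X :&: Y)%VS = 0%VS.
Proof.
move=> XS YS XY; apply/eqP; rewrite -dimv_eq0.
have := dimv_sum_cap X Y; rewrite pcap_dim2 // (pcap_dim XS) (pcap_dim YS); clear; lia.
Qed.

Lemma pcap_indep X Y Z : X \in S -> Y \in S -> Z \in S -> X != Y -> X != Z -> Y != Z ->
  ~~ (X <= Y + Z)%VS.
Proof.
move=> XS YS ZS XY XZ YZ; apply/negP => sub.
have := pcap_dim3 XS YS ZS XY XZ YZ.
rewrite -addvA (addv_idPr sub) pcap_dim2 //; move: n_gt0; clear; lia.
Qed.

Lemma sumUE : (U + E)%VS = fullv.
Proof.
have dV : \dim {:V} = (1 * (4 * n))%N by rewrite dimvf dim_matrix.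
apply/eqP; rewrite eqEdim subvf dV.
rewrite dimv_disjoint_sum // dimU (pcap_dim ES); clear; lia.
Qed.

(** * Projection of the pseudo-cap from E onto U *)

Definition prj : 'End(V) := daddv_pi U E.
Definition bar X : {vspace V} := (prj @: X)%VS.

Lemma EU : (E :&: U)%VS = 0%VS. Proof. by rewrite capvC. Qed.

Lemma prjU v : prj v \in U. Proof. exact: memv_pi. Qed.

Lemma prj_id v : v \in U -> prj v = v. Proof. exact: daddv_pi_id. Qed.

Lemma prjD v : exists2 e, e \in E & v = prj v + e.
Proof.
exists (daddv_pi E U v); first exact: memv_pi.
by rewrite daddv_pi_add // sumUE memvf.
Qed.

Lemma prjE v : v \in E -> prj v = 0.
Proof.
move=> vE; have [e eE ev] := prjD v.
apply/eqP; rewrite -memv0 -UE memv_cap prjU /=.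
by rewrite -[prj v](addrK e) -ev memvB.
Qed.

Lemma barE X : (E + bar X)%VS = (E + X)%VS.
Proof.
apply/eqP; rewrite eqEsubv !subv_add !addvSl /=; apply/andP; split.
  apply/subvP => _ /memv_imgP[x xX ->]; have [e eE ev] := prjD x.
  have -> : prj x = - e + x by rewrite {2}ev addrC addrK.
  by rewrite memv_add ?memvN.
apply/subvP => x xX; have [e eE ->] := prjD x.
by rewrite addrC memv_add // memv_img.
Qed.

Lemma bar_sub X : (bar X <= U)%VS.
Proof. by apply/subvP => _ /memv_imgP[x _ ->]; apply: prjU. Qed.

Lemma bar_id X : (X <= U)%VS -> bar X = X.
Proof.
move=> /subvP XU; apply/vspaceP => v; apply/memv_imgP/idP => [[x xX ->]|vX].
  by rewrite prj_id ?XU.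
by exists v; rewrite // prj_id ?XU.
Qed.

Lemma subE_bar X M : (M <= U)%VS -> (X <= E + M)%VS = (bar X <= M)%VS.
Proof.
move=> MU; apply/idP/idP => [XM|XM].
  apply/subvP => _ /memv_imgP[x xX ->].
  have /memv_addP[e eE [w wM ->]] := subvP XM x xX.
  by rewrite linearD /= prjE // add0r prj_id // (subvP MU).
by apply: subv_trans (addvSr E _) _; rewrite -barE addvS.
Qed.

Definition bars := bar @` (S `\ E).

Lemma barsP Z : reflect (exists X, [/\ X \in S, X != E & Z = bar X]) (Z \in bars).
Proof.
apply: (iffP (imfsetP _ _ _ _)) => [[X /= + ->]|[X [XS XE ->]]].
  by rewrite in_fsetD1 => /andP[XE XS]; exists X.
by exists X; rewrite //= in_fsetD1 XE.
Qed.

Lemma bar_in X : X \in S -> X != E -> bar X \in bars.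
Proof. by move=> XS XE; apply/barsP; exists X. Qed.

Lemma dim_bar X : X \in S -> X != E -> \dim (bar X) = n.
Proof.
move=> XS XE; have EX : E != X by rewrite eq_sym.
have c0 : (E :&: bar X)%VS = 0%VS.
  by apply/eqP; rewrite -subv0 -EU capvS ?bar_sub.
have := dimv_disjoint_sum c0; rewrite barE pcap_dim2 // (pcap_dim ES).
by rewrite mul2n -addnn => /addnI.
Qed.

Lemma addE_bar X Y : (E + (bar X + bar Y))%VS = (E + X + Y)%VS.
Proof. by rewrite addvA barE -addvA [(X + _)%VS]addvC addvA barE -addvA [(Y + _)%VS]addvC addvA. Qed.

Lemma cap_bar X Y : X \in S -> Y \in S -> X != E -> Y != E -> X != Y ->
  (bar X :&: bar Y)%VS = 0%VS.
Proof.
move=> XS YS XE YE XY; apply/eqP; rewrite -dimv_eq0.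
have := dimv_sum_cap (bar X) (bar Y); rewrite (dim_bar XS XE) (dim_bar YS YE).
have EX : E != X by rewrite eq_sym.
have EY : E != Y by rewrite eq_sym.
have := dimv_sum_cap E (bar X + bar Y).
rewrite addE_bar (pcap_dim3 ES XS YS) // (pcap_dim ES); clear; lia.
Qed.

Lemma bar_inj X Y : X \in S -> Y \in S -> X != E -> Y != E -> bar X = bar Y -> X = Y.
Proof.
move=> XS YS XE YE e; apply/eqP; apply: contraT => XY.
have := cap_bar XS YS XE YE XY; rewrite -e capvv => b0.
by have := dim_bar XS XE; rewrite b0 dimv0; move: n_gt0; clear; lia.
Qed.

Lemma card_section X Y : X \in S -> Y \in S -> X != E -> Y != E -> X != Y ->
  #|` [fset Z in S | (Z <= E + X + Y)%VS]| = (Q + 1)%N.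
Proof.
move=> XS YS XE YE XY; have EX : E != X by rewrite eq_sym.
have EY : E != Y by rewrite eq_sym.
apply: goodE; first exact: pcap_dim3.
  by rewrite -addvA addvSl.
exists X, Y; split; rewrite ?addvSr //; first by rewrite /= !inE negb_or EX EY XY.
by apply: subv_trans (addvSl _ Y); apply: addvSr.
Qed.

(** A join of two projections corresponds to the (3n-1)-space that it spans with [E]. Goodness gives
    Q+1 elements in this space, and all but [E] project to elements of the join. *)
Lemma bars_spread : normal_spread n U bars.
Proof.
split.
- by apply: leq_trans Q_gt5.
- exact: dimU.
- by move=> _ /barsP[X [XS XE ->]]; apply: dim_bar.
- by move=> _ /barsP[X [XS XE ->]]; apply: bar_sub.
- move=> _ _ /barsP[X [XS XE ->]] /barsP[Y [YS YE ->]] XY; apply: cap_bar => //.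
  by apply: contraNneq XY => ->.
- rewrite /bars card_imfset_in; last first.
    move=> X Y; rewrite !in_fsetD1 => /andP[XE XS] /andP[YE YS]; exact: bar_inj.
  have := cardfsD1 E S; by rewrite ES card_pcap addn1 add1n => -[<-].
move=> _ _ /barsP[X [XS XE ->]] /barsP[Y [YS YE ->]] XY'.
have XY : X != Y by apply: contraNneq XY' => ->.
have cs := card_section XS YS XE YE XY.
have sE : E \in [fset Z in S | (Z <= E + X + Y)%VS].
  by rewrite in_sep ES -addvA addvSl.
have MU : (bar X + bar Y <= U)%VS by rewrite subv_add !bar_sub.
have -> : [fset Z in bars | (Z <= bar X + bar Y)%VS] =
    bar @` ([fset Z in S | (Z <= E + X + Y)%VS] `\ E).
  apply/fsetP => Z; rewrite in_sep; apply/andP/imfsetP.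
    case=> /barsP[R [RS RE ->]] sub; exists R => //=.
    by rewrite in_fsetD1 RE in_sep RS -addE_bar subE_bar.
  case=> R /=; rewrite in_fsetD1 in_sep -addE_bar subE_bar // => /and3P[RE RS sub] ->.
  by rewrite bar_in.
rewrite card_imfset_in; last first.
  move=> R R'; rewrite !in_fsetD1 !in_sep => /and3P[RE RS _] /and3P[R'E R'S _].
  exact: bar_inj.
by move: cs; rewrite (cardfsD1 E) sE add1n addn1 => -[].
Qed.

Let sp := bars_spread.
Local Notation line := (is_line bars).

Definition osec M := [fset X in S | (X <= E + M)%VS].

Lemma line_osec M : line M -> exists X Y, [/\ X \in S, Y \in S, X != E, Y != E & X != Y] /\
  [/\ M = (bar X + bar Y)%VS, (E + M)%VS = (E + X + Y)%VS & \dim (E + M) = (3 * n)%N].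
Proof.
case=> _ [_ [/barsP[X [XS XE ->]] /barsP[Y [YS YE ->]] XY' ->]].
have XY : X != Y by apply: contraNneq XY' => ->.
have EX : E != X by rewrite eq_sym.
have EY : E != Y by rewrite eq_sym.
by exists X, Y; rewrite addE_bar pcap_dim3.
Qed.

Lemma osec_oval M : line M -> is_pseudo_oval_of S (osec M).
Proof.
move=> /line_osec[X [Y [[XS YS XE YE XY] [_ eM dM]]]]; split.
- by apply/fsubsetP => Z; rewrite in_sep => /andP[].
- by rewrite /osec eM card_section.
by exists (E + M)%VS => // Z; rewrite in_sep => /andP[].
Qed.

Lemma E_osec M : E \in osec M.
Proof. by rewrite in_sep ES addvSl. Qed.

Lemma mem_osec X M : X \in S -> (M <= U)%VS -> (X \in osec M) = (bar X <= M)%VS.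
Proof. by move=> XS MU; rewrite in_sep XS subE_bar. Qed.

Lemma span_osec M : line M -> span_of (osec M) = (E + M)%VS.
Proof.
move=> /line_osec[X [Y [[XS YS XE YE XY] [_ eM dM]]]].
apply/eqP; rewrite eqEsubv; apply/andP; split.
  rewrite /span_of big_seq; elim/big_ind: _ => [|A B AU BU|T].
  - exact: sub0v.
  - by rewrite subv_add AU.
  by rewrite in_sep => /andP[].
have sub T : T \in osec M -> (T <= span_of (osec M))%VS.
  by move=> TO; rewrite /span_of (big_fsetD1 T) //= addvSl.
rewrite {1}eM !subv_add sub ?E_osec // !sub // in_sep ?XS ?YS eM ?addvSr //.
by apply: subv_trans (addvSl _ Y); apply: addvSr.
Qed.

Lemma line_action M : line M -> is_elementary_pseudo_oval (osec M) ->
  exists (L : fieldExtType F) (T : L -> 'End(V)),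
    [/\ \dim {:L} = n, action_on T (E + M) &
      forall X, X \in S -> (X <= E + M)%VS -> stable T X].
Proof.
move=> lM; rewrite /is_elementary_pseudo_oval span_osec //.
case=> L [phi [C [dL idphi capC hC]]].
have [T [actT hT]] := identification_action idphi.
exists L, T; split=> // X XS XM a v vX.
have /hC[P PC hX] : X \in osec M by rewrite in_sep XS.
have /hX[w wP ew] := vX; rewrite -ew hT.
by apply/hX; exists (a *: w); rewrite ?memvZ.
Qed.

(** * Comparing the global action with that of one pseudo-oval *)

Section Propagation.

Variables (L : fieldExtType F) (A : L -> 'End(V)).
Hypotheses (stE : stable A E) (stU : stable A U).

Lemma prj_act a v : prj (A a v) = A a (prj v).
Proof.
have [e eE ev] := prjD v; rewrite {1}ev !linearD /= (prjE (stE a eE)) addr0.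
by rewrite prj_id // stU // prjU.
Qed.

Lemma stable_bar X : stable A X -> stable A (bar X).
Proof.
by move=> sX a _ /memv_imgP[x xX ->]; rewrite -prj_act memv_img ?sX.
Qed.

(** The projections themselves will all be stable; what has to be propagated is the stability of the
    element of [S] above each of them. *)
Definition good X := forall R, R \in S -> R != E -> bar R = X -> stable A R.

Hypothesis stB : forall Z, Z \in bars -> stable A Z.

(* The action of [K] given by the pseudo-oval and the action of [L] induce the same
   scalars on [M]; corresponding scalars then agree modulo [E], hence exactly on the
   three given elements, hence on their span. *)
Lemma good_line M X Y Z : line M -> is_elementary_pseudo_oval (osec M) ->
  X \in bars -> Y \in bars -> Z \in bars -> uniq [:: X; Y; Z] ->
  (X <= M)%VS -> (Y <= M)%VS -> (Z <= M)%VS -> good X -> good Y -> good Z ->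
  forall W, W \in bars -> (W <= M)%VS -> good W.
Proof.
move=> lM eM XB YB ZB u XM YM ZM gX gY gZ.
have [K [T [dK actT stT]]] := line_action lM eM.
have MU := line_sub sp lM.
have [TD TM TF TH] := actT.
have ME v : v \in M -> v \in (E + M)%VS by apply/subvP; apply: addvSr.
have stTE : stable T E by apply: stT; rewrite ?addvSl.
have prjT a v : v \in (E + M)%VS -> prj (T a (prj v)) = prj (T a v).
  case/memv_addP => e eE [w wM ->].
  rewrite !linearD /= (prjE eE) (prj_id (subvP MU w wM)) !linear0 add0r.
  by rewrite (prjE (stTE a e eE)) add0r.
have prjM v : v \in (E + M)%VS -> prj v \in M.
  case/memv_addP => e eE [w wM ->].
  by rewrite linearD /= prjE // add0r prj_id // (subvP MU).
(* The action induced by [T] modulo [E], where the quotient of [E + M] by [E] is identified with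
   [M]. *)
pose T' a : 'End(V) := (prj \o T a)%VF.
have T'E a v : T' a v = prj (T a v) by rewrite comp_lfunE.
have actT' : action_on T' M.
  split=> [a b v vM|a b v vM|c v vM|a v vM]; rewrite ?T'E.
  - by rewrite TD ?ME // linearD.
  - by rewrite TM ?ME // prjT // TH ?ME.
  - by rewrite TF ?ME // prj_id // memvZ // (subvP MU).
  - by rewrite prjM // TH ?ME.
have stT' W : W \in on bars M -> stable T' W.
  rewrite in_on => /andP[/barsP[R [RS RE ->]] RM] a _ /memv_imgP[x xR ->].
  have RH : (R <= E + M)%VS by rewrite subE_bar.
  by rewrite T'E prjT ?(subvP RH) // memv_img // stT.
have inD W : W \in on bars M -> W \in bars by rewrite in_on => /andP[].
have Q3 : (3 < Q)%N by apply: leq_trans Q_gt5.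
have scal a : exists b, forall v, v \in M -> A a v = prj (T b v).
  have dimD W : W \in on bars M -> \dim W = n by move/inD; apply: (ns_dim sp).
  have subD W : W \in on bars M -> (W <= M)%VS by rewrite in_on => /andP[].
  have capD W W' : W \in on bars M -> W' \in on bars M -> W != W' -> (W :&: W')%VS = 0%VS.
    by move=> /inD WB /inD W'B; apply: (ns_cap sp).
  have gD W v : W \in on bars M -> v \in W -> A a v \in W.
    by move=> /inD WB; apply: stB.
  have [b hb] := eigen_scalar Q3 dK (line_dim sp lM) actT' dimD subD capD
    (line_card sp lM) stT' gD.
  by exists b => v vM; rewrite hb // T'E.
(* The difference lies in [R], which is stable under both actions, and in [E], because its
   projection vanishes; [R] and [E] meet in 0. *)
have agree a b R v : (forall v, v \in M -> A a v = prj (T b v)) ->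
    R \in S -> R != E -> (R <= E + M)%VS -> stable A R -> v \in R -> A a v = T b v.
  move=> hb RS RE RH sR vR; have vH := subvP RH v vR.
  have d1 : A a v - T b v \in R by rewrite memvB ?sR ?stT.
  have d0 : prj (A a v - T b v) = 0.
    by rewrite linearB /= prj_act -(prjT b v vH) hb ?subrr ?prjM.
  have [e eE ee] := prjD (A a v - T b v).
  apply/eqP; rewrite -subr_eq0 -memv0 -(pcap_cap RS ES RE) memv_cap d1.
  by rewrite ee d0 add0r.
have rep W : W \in bars -> (W <= M)%VS -> exists R, [/\ R \in S, R != E, W = bar R & (R <= E + M)%VS].
  by move=> /barsP[R [RS RE ->]] WM; exists R; rewrite subE_bar.
have [X' [X'S X'E eX X'H]] := rep X XB XM.
have [Y' [Y'S Y'E eY Y'H]] := rep Y YB YM.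
have [Z' [Z'S Z'E eZ Z'H]] := rep Z ZB ZM.
have sX' : stable A X' by apply: gX.
have sY' : stable A Y' by apply: gY.
have sZ' : stable A Z' by apply: gZ.
have sumE : (X' + Y' + Z')%VS = (E + M)%VS.
  have [_ [_ [_ [_ _ dM]]]] := line_osec lM.
  apply/eqP; rewrite eqEdim !subv_add X'H Y'H Z'H dM.
  move: u; rewrite /= !inE negb_or andbT => /andP[/andP[XY XZ] YZ].
  rewrite pcap_dim3 //.
  - by apply: contraNneq XY => e; rewrite eX eY e.
  - by apply: contraNneq XZ => e; rewrite eX eZ e.
  - by apply: contraNneq YZ => e; rewrite eY eZ e.
move=> W WB WM R RS RE eW a v vR; have [b hb] := scal a.
have RH : (R <= E + M)%VS by rewrite subE_bar // eW.
have := subvP RH v vR; rewrite -sumE => /memv_addP[_ /memv_addP[x xX [y yY ->]] [z zZ ev]].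
suff -> : A a v = T b v by apply: stT.
rewrite ev !linearD /= (agree a b X') // (agree a b Y') //.
by rewrite (agree a b Z').
Qed.

End Propagation.

(** * The global action and its propagation to all elements *)

Section Main.

Variables A1 A2 A3 A4 A5 R0 : {vspace V}.
Hypothesis A1S : A1 \in S.
Hypothesis A2S : A2 \in S.
Hypothesis A3S : A3 \in S.
Hypothesis A4S : A4 \in S.
Hypothesis A5S : A5 \in S.
Hypothesis A1U : (A1 <= U)%VS.
Hypothesis A2U : (A2 <= U)%VS.
Hypothesis A3U : (A3 <= U)%VS.
Hypothesis A4U : (A4 <= U)%VS.
Hypothesis A5U : (A5 <= U)%VS.
Hypothesis uA : uniq [:: A1; A2; A3; A4; A5].
Hypothesis elem : forall O : {fset {vspace V}},
  is_pseudo_oval_of S O -> E \in O -> [\/ A1 \in O, A2 \in O | A3 \in O] ->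
  is_elementary_pseudo_oval O.
Hypotheses (R0B : R0 \in bars) (R024 : (R0 <= A2 + A4)%VS) (R035 : (R0 <= A3 + A5)%VS).

Let neE X : X \in S -> (X <= U)%VS -> X != E.
Proof.
move=> XS XU; apply/eqP => XE; have := UE; rewrite -XE (capv_idPr XU) => X0.
by have := pcap_dim XS; rewrite X0 dimv0; move: n_gt0; clear; lia.
Qed.

Let fixB X : X \in S -> (X <= U)%VS -> X \in bars.
Proof. by move=> XS XU; rewrite -(bar_id XU) bar_in ?neE. Qed.

Let A1B : A1 \in bars := fixB A1S A1U.
Let A2B : A2 \in bars := fixB A2S A2U.
Let A3B : A3 \in bars := fixB A3S A3U.
Let A4B : A4 \in bars := fixB A4S A4U.
Let A5B : A5 \in bars := fixB A5S A5U.

Let uAE : [/\ [/\ A1 != A2, A1 != A3, A1 != A4 & A1 != A5],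
  [/\ A2 != A3, A2 != A4 & A2 != A5], A3 != A4 /\ A3 != A5 & A4 != A5].
Proof.
move: uA; rewrite /= !inE !negb_or -!andbA.
by case/and5P=> -> -> -> -> /and5P[-> -> -> -> /andP[-> /andP[-> _]]].
Qed.

Let l24 : line (A2 + A4).
Proof. by case: uAE => _ [_ h _] _ _; apply: join_is_line. Qed.
Let l35 : line (A3 + A5).
Proof. by case: uAE => _ _ [_ h] _; apply: join_is_line. Qed.
Let l21 : line (A2 + A1).
Proof. by case: uAE => -[h _ _ _] _ _ _; apply: join_is_line; rewrite // eq_sym. Qed.

Let A1_24 : ~~ (A1 <= A2 + A4)%VS.
Proof. by case: uAE => -[? _ ? _] [_ ? _] _ _; apply: pcap_indep. Qed.
Let A1_35 : ~~ (A1 <= A3 + A5)%VS.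
Proof. by case: uAE => -[_ ? _ ?] _ [_ ?] _; apply: pcap_indep. Qed.
Let A3_24 : ~~ (A3 <= A2 + A4)%VS.
Proof. by case: uAE => _ [? ? _] [? _] _; apply: pcap_indep; rewrite // eq_sym. Qed.
Let A5_24 : ~~ (A5 <= A2 + A4)%VS.
Proof. by case: uAE => _ [_ ? ?] _ ?; apply: pcap_indep; rewrite // eq_sym. Qed.
Let A3_21 : ~~ (A3 <= A2 + A1)%VS.
Proof. by case: uAE => -[? ? _ _] [? _ _] _ _; apply: pcap_indep; rewrite // eq_sym. Qed.

Let elem_line M : line M -> [|| (A1 <= M)%VS, (A2 <= M)%VS | (A3 <= M)%VS] ->
  is_elementary_pseudo_oval (osec M).
Proof.
move=> lM h; apply: elem; rewrite ?E_osec //; first exact: osec_oval.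
have MU := line_sub sp lM.
rewrite !mem_osec // !bar_id //; case/or3P: h => ->.
- exact: Or31.
- exact: Or32.
exact: Or33.
Qed.

(** The field is that of the pseudo-oval over the line [A2 + A4]. To extend its action over [A1],
    the hole [J] of the line [A2 + A1] serves as the graph between [A2] and [A1]. This choice is
    forced, since an action stabilising all elements on that line permutes the nonzero vectors they
    cover and hence preserves the hole. *)
Lemma base_action : exists (L : fieldExtType F) (A : L -> 'End(V)),
  [/\ \dim {:L} = n, action_on A fullv, stable A E /\ stable A U,
      forall Z, Z \in bars -> stable A Z
    & forall X, X \in S -> (X <= E + (A2 + A4))%VS -> stable A X].
Proof.
pose M0 := (A2 + A4)%VS; rewrite -/M0; have lM0 : line M0 := l24.
have [L [T [dL actT stT]]] : exists (L : fieldExtType F) (T : L -> 'End(V)),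
    [/\ \dim {:L} = n, action_on T (E + M0) &
      forall X, X \in S -> (X <= E + M0)%VS -> stable T X].
  by apply: (line_action lM0); apply: elem_line; rewrite // addvSl orbT.
have [J hJ] := exists_hole sp l21; have [dJ _] := hJ.
have [I hI] := exists_hole sp lM0; have [dI hIv] := hI.
have sumU : (M0 + A1)%VS = U by apply: (line_span sp).
have M0U : (M0 <= U)%VS := line_sub sp lM0.
have HYf : (E + M0 + A1)%VS = fullv by rewrite -addvA sumU addvC sumUE.
have A2M0 : (A2 <= M0)%VS by apply: addvSl.
have A4M0 : (A4 <= M0)%VS by apply: addvSr.
have A2H : (A2 <= E + M0)%VS by apply: subv_trans A2M0 _; apply: addvSr.
have dH : \dim (E + M0) = (3 * n)%N.
  by have [_ [_ [_ [_ _ ->]]]] := line_osec lM0.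
have HY : ((E + M0) :&: A1)%VS = 0%VS.
  apply/eqP; rewrite -dimv_eq0; have := dimv_sum_cap (E + M0) A1.
  have dV : \dim {:V} = (1 * (4 * n))%N by rewrite dimvf dim_matrix.
  by rewrite HYf dV dH (pcap_dim A1S); clear; lia.
have st2 : stable T A2 by apply: stT.
have dXY : \dim A2 = \dim A1 by rewrite !pcap_dim.
have dXZ : \dim A2 = \dim J by rewrite pcap_dim.
have JX := hole_cap0 hJ A2B; have JY := hole_cap0 hJ A1B.
have JXY := hole_sub hJ.
have [A [actA AT st1 stJ]] :=
  extend_action actT A2H st2 HY HYf dXY dXZ JX JY JXY.
have stH X : X \in S -> (X <= E + M0)%VS -> stable A X.
  by move=> XS XH a v vX; rewrite AT ?(subvP XH) //; apply: stT vX.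
have stE : stable A E by apply: stH; rewrite ?addvSl.
have stM0 : stable A M0.
  apply: stableD; apply: stH => //; apply: subv_trans A4M0 _; exact: addvSr.
have stU : stable A U by rewrite -sumU; apply: stableD.
exists L, A; split=> //.
have stM0Z Z : Z \in bars -> (Z <= M0)%VS -> stable A Z.
  move=> /barsP[R [RS RE ->]] RM; apply: (stable_bar stE stU).
  by apply: stH; rewrite // subE_bar.
(* A nonzero scalar acts invertibly on [M0] and preserves the elements on it, so it cannot move an
   uncovered vector into an element. *)
have stI : stable A I.
  move=> a v; rewrite !hIv => /andP[vM /orP[/eqP->|/allP vn]].
    by rewrite linear0 mem0v eqxx.
  rewrite stM0 //=; have [-> |a0] := eqVneq a 0.
    by rewrite (act0 actA) ?memvf // eqxx.
  have [-> //|Av0] := eqVneq (A a v) 0; apply/allP => Z ZB; apply/negP => AvZ.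
  have ZM0 : (Z <= M0)%VS.
    apply: contraT => ZM; have := line_cap0 sp lM0 ZB ZM.
    by move/vspaceP/(_ (A a v)); rewrite memv_cap stM0 // AvZ memv0 (negPf Av0).
  case/negP: (vn Z ZB); rewrite -(actK actA a0 (memvf v)).
  exact: stM0Z.
apply: (@closure_all _ _ _ _ _ sp (stable A) _ _ M0 I J A2 A1 A3) => //.
- by move=> X Y; apply: stableD.
- by move=> X Y; apply: stableI.
Qed.

Lemma all_good (L : fieldExtType F) (A : L -> 'End(V)) :
  stable A E -> stable A U ->
  (forall Z, Z \in bars -> stable A Z) ->
  (forall X, X \in S -> (X <= E + (A2 + A4))%VS -> stable A X) ->
  forall X, X \in S -> stable A X.
Proof.
move=> stE stU stB st24.
have gl := good_line stE stU stB.
have goodU X : X \in S -> (X <= U)%VS -> good A X.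
  move=> XS XU R RS RE; rewrite -[RHS](bar_id XU) => /(bar_inj RS XS RE (neE XS XU)) ->.
  by rewrite -(bar_id XU); apply: stB; apply: bar_in; rewrite ?neE.
have g24 Z : Z \in bars -> (Z <= A2 + A4)%VS -> good A Z.
  move=> ZB ZM R RS RE eZ; apply: st24 => //.
  by rewrite subE_bar ?eZ // (line_sub sp l24).
have [[n12 n13 n14 n15] [n23 n24 n25] [n34 n35] n45] := uAE.
have g35 Z : Z \in bars -> (Z <= A3 + A5)%VS -> good A Z.
  apply: (gl _ A3 A5 R0 l35); rewrite ?addvSl ?addvSr //.
  - by apply: elem_line; rewrite // addvSl !orbT.
  - rewrite /= !inE negb_or n35 andbT /=; apply/andP; split.
      by apply: contraNneq A3_24 => ->.
    by apply: contraNneq A5_24 => ->.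
  - exact: goodU.
  - exact: goodU.
  - exact: g24.
have [I hI] := exists_hole sp l24.
have [J hJ] := exists_hole sp l35.
(* An element on none of these three lines is joined to [A1] by a line which meets the
   lines 24 and 35 in two different elements. *)
pose M1 := (A1 + I)%VS; pose M2 := (A1 + J)%VS; pose M3 := (A1 + R0)%VS.
have A1R0 : A1 != R0 by apply: contraNneq A1_24 => ->.
have l1 : line M1 := hole_join sp l24 hI A1B.
have l2 : line M2 := hole_join sp l35 hJ A1B.
have l3 : line M3 := join_is_line A1B R0B A1R0.
have joinA1 B X : \dim B = n -> (A1 :&: B)%VS = 0%VS -> X \in bars -> A1 != X ->
    (B <= A1 + X)%VS -> (X <= A1 + B)%VS.
  move=> dB AB XB A1X sub.
  rewrite (join_eq (pcap_dim A1S) dB AB (addvSl _ _) sub) ?addvSr //.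
  by apply: (line_dim sp); apply: join_is_line.
have step Z : Z \in bars -> ~~ (Z <= M1)%VS -> ~~ (Z <= M2)%VS -> ~~ (Z <= M3)%VS ->
    good A Z.
  move=> ZB Z1 Z2 Z3.
  have A1Z : A1 != Z by apply: contraNneq Z1 => <-; apply: addvSl.
  have lZ := join_is_line A1B ZB A1Z.
  have ne24 : (A2 + A4)%VS != (A1 + Z)%VS by apply: contraNneq A1_24 => ->; apply: addvSl.
  have ne35 : (A3 + A5)%VS != (A1 + Z)%VS by apply: contraNneq A1_35 => ->; apply: addvSl.
  case: (lines_meet sp l24 lZ ne24 hI) => [[B BB eB]|[eB _]]; last first.
    have [dI _] := hI; case/negP: Z1; apply: joinA1 => //.
      by rewrite capvC (hole_cap0 hI).
    by rewrite -eB capvSr.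
  case: (lines_meet sp l35 lZ ne35 hJ) => [[D DB eD]|[eD _]]; last first.
    have [dJ _] := hJ; case/negP: Z2; apply: joinA1 => //.
      by rewrite capvC (hole_cap0 hJ).
    by rewrite -eD capvSr.
  have B24 : (B <= A2 + A4)%VS by rewrite -eB capvSl.
  have BZ : (B <= A1 + Z)%VS by rewrite -eB capvSr.
  have D35 : (D <= A3 + A5)%VS by rewrite -eD capvSl.
  have DZ : (D <= A1 + Z)%VS by rewrite -eD capvSr.
  have A1D : A1 != D by apply: contraNneq A1_35 => ->.
  have A1B' : A1 != B by apply: contraNneq A1_24 => ->.
  have BD : B != D.
    apply: contraNneq Z3 => BD; rewrite -BD in D35.
    have ne : (A2 + A4)%VS != (A3 + A5)%VS by apply: contraNneq A3_24 => ->; apply: addvSl.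
    have eR := lines_meet_at sp l24 l35 ne R0B R024 R035.
    have eB' := lines_meet_at sp l24 l35 ne BB B24 D35.
    have BR : B = R0 by rewrite -eB'.
    apply: joinA1 => //.
    - exact: ns_dim sp _ R0B.
    - exact: ns_cap sp _ _ A1B R0B A1R0.
    - by rewrite -BR.
  apply: (gl _ A1 B D lZ _ A1B BB DB); rewrite ?addvSl ?addvSr //.
  - by apply: elem_line; rewrite // addvSl.
  - by rewrite /= !inE negb_or A1B' A1D BD.
  - exact: goodU.
  - exact: g24.
  - exact: g35.
have stepD m : line m -> (A2 <= m)%VS -> ~~ (A1 <= m)%VS ->
    forall Z, Z \in bars -> (Z <= m)%VS -> good A Z.
  move=> lm A2m A1m.
  have one M : line M -> (A1 <= M)%VS -> (#|` on bars m `&` on bars M| <= 1)%N.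
    move=> lM A1M; rewrite leqNgt; apply/negP => gt1.
    have [X XD _] := card_ge2_fset gt1 0%VS; have [Y YD YX] := card_ge2_fset gt1 X.
    move: XD YD; rewrite !in_fsetI !in_on.
    move=> /andP[/andP[XB Xm] /andP[_ XM]] /andP[/andP[YB Ym] /andP[_ YM]].
    case/negP: A1m; rewrite -(line_join sp lm YB XB YX Ym Xm).
    by rewrite (line_join sp lM YB XB YX YM XM).
  pose G := on bars m `\` (on bars M1 `|` on bars M2 `|` on bars M3).
  (* A line missing [A1] shares at most one element with each of the three lines through [A1], so at
     least Q-3 elements remain. This is where Q > 5 is needed. *)
  have cG : (2 < #|` G|)%N.
    have := cardfsID (on bars M1 `|` on bars M2 `|` on bars M3) (on bars m).
    rewrite (line_card sp lm) -/G !fsetIUr.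
    have := one M1 l1 (addvSl _ _); have := one M2 l2 (addvSl _ _).
    have := one M3 l3 (addvSl _ _).
    set B1 := _ `&` on bars M1; set B2 := _ `&` on bars M2; set B3 := _ `&` on bars M3.
    have leU (C D : {fset {vspace V}}) : (#|` C `|` D| <= #|` C| + #|` D|)%N.
      by rewrite cardfsU leq_subr.
    have := leU (B1 `|` B2) B3; have := leU B1 B2.
    move: Q_gt5; move: (Q) => k; move: #|` B1 `|` B2 `|` B3| #|` B1 `|` B2|.
    move: #|` B1| #|` B2| #|` B3| #|` G|; clear; lia.
  have [X [Y [Z [XG YG ZG u]]]] := card_gt2_fset cG.
  have GP W : W \in G -> [/\ W \in bars, (W <= m)%VS & good A W].
    rewrite in_fsetD !in_fsetU !in_on !negb_or -!andbA => /and5P[h1 h2 h3 WB Wm].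
    by split=> //; apply: step => //; [move: h1|move: h2|move: h3]; rewrite WB.
  have [[XB Xm gX] [YB Ym gY] [ZB Zm gZ]] := And3 (GP X XG) (GP Y YG) (GP Z ZG).
  apply: (gl _ X Y Z lm) => //.
  by apply: elem_line; rewrite // A2m orbT.
have off12 Z : Z \in bars -> ~~ (Z <= A2 + A1)%VS -> good A Z.
  move=> ZB Z12; have A2Z : A2 != Z by apply: contraNneq Z12 => <-; apply: addvSl.
  have lZ := join_is_line A2B ZB A2Z.
  apply: (stepD _ lZ (addvSl _ _)) => //; last exact: addvSr.
  apply: contra Z12 => A1Z; have n21 : A2 != A1 by rewrite eq_sym.
  by rewrite (line_join sp lZ A2B A1B n21 (addvSl _ _) A1Z) addvSr.
have allB Z : Z \in bars -> good A Z.
  move=> ZB; case Z12: (Z <= A2 + A1)%VS; last by apply: off12; rewrite ?Z12.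
  have A3Z : A3 != Z by apply: contraNneq A3_21 => ->.
  have lZ := join_is_line A3B ZB A3Z.
  (* The line [A3 + Z] meets [A2 + A1] only in [Z], so its other Q-1 elements are already
     settled. *)
  have cG : (2 < #|` on bars (A3 + Z) `\ Z|)%N.
    have := cardfsD1 Z (on bars (A3 + Z)); rewrite (line_card sp lZ) in_on ZB addvSr.
    by move: Q_gt5; move: (Q) #|` _| => k j; clear; lia.
  have [X [Y [W [XG YG WG u]]]] := card_gt2_fset cG.
  have GP T : T \in on bars (A3 + Z) `\ Z -> [/\ T \in bars, (T <= A3 + Z)%VS & good A T].
    rewrite in_fsetD1 in_on => /and3P[TZ TB Tm]; split=> //; apply: off12 => //.
    apply/negP => T12; case/negP: A3_21.
    rewrite -(line_join sp l21 TB ZB TZ T12 Z12).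
    by rewrite (line_join sp lZ TB ZB TZ Tm (addvSr _ _)) addvSl.
  have [[XB Xm gX] [YB Ym gY] [WB Wm gW]] := And3 (GP X XG) (GP Y YG) (GP W WG).
  apply: (gl _ X Y W lZ _ XB YB WB u Xm Ym Wm gX gY gW _ ZB (addvSr _ _)).
  by apply: elem_line; rewrite // addvSl !orbT.
move=> X XS; have [->//|XE] := eqVneq X E.
exact: (allB _ (bar_in XS XE) X XS XE).
Qed.

End Main.

(** The action makes [V] a vector space over [L]. Nonzero vectors of four elements that span [V]
    form a basis of it, which gives the identification; every element of [S] is stable of dimension
    n over [F], so it is the orbit of any of its nonzero vectors, that is, a point over [L]. *)
Lemma elementary_of_action (L : fieldExtType F) (A : L -> 'End(V))
    (B : 'I_4 -> {vspace V}) : \dim {:L} = n -> action_on A fullv ->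
  (forall X, X \in S -> stable A X) -> (forall i, B i \in S) ->
  (\sum_i B i)%VS = fullv -> is_elementary_in n 4 fullv S.
Proof.
move=> dL actA stS BS sumB; have [aD aM aF aH] := actA.
pose e i := vpick (B i).
have nzp X : X \in S -> vpick X != 0.
  move=> XS; rewrite vpick0 -dimv_eq0 (pcap_dim XS) -lt0n; exact: n_gt0.
have eB i : e i \in B i by apply: memv_pick.
have orb X x y : X \in S -> x \in X -> x != 0 -> y \in X -> exists a, y = A a x.
  move=> XS xX x0 yX; apply: (act_orbit actA (subvf X) (stS X XS) _ xX x0 yX).
  by rewrite dL pcap_dim.
have dirB : directv (\sum_i B i).
  rewrite directvEgeq /= sumB.
  have dV : \dim {:V} = (1 * (4 * n))%N by rewrite dimvf dim_matrix.
  rewrite dV mul1n (eq_bigr (fun=> n)) => [|i _]; last exact: pcap_dim.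
  by rewrite sum_nat_const card_ord.
pose phi (x : 'rV[L]_4) : V := \sum_i A (x 0 i) (e i).
have phiD : {morph phi : x y / x + y}.
  move=> x y; rewrite /phi -big_split /=; apply: eq_bigr => i _.
  by rewrite mxE aD ?memvf.
have phiM a x : phi (a *: x) = A a (phi x).
  rewrite /phi linear_sum /=; apply: eq_bigr => i _.
  by rewrite mxE aM ?memvf.
have phiB x : phi (- x) = - phi x.
  by rewrite -scaleN1r phiM (actN actA) ?memvf // (act1 actA) ?memvf.
have phi_eq0 x : phi x = 0 -> x = 0.
  move=> e0; apply/rowP => i; rewrite mxE.
  move/directv_sum_independent: dirB => /(_ (fun i => A (x 0 i) (e i))).
  move/(_ (fun i _ => stS _ (BS i) _ _ (eB i)) e0 i isT).
  by apply: (act_eq0 actA (memvf _)); apply: nzp.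
have phi_inj : injective phi.
  move=> x y exy; apply/eqP; rewrite -subr_eq0; apply/eqP/phi_eq0.
  by rewrite phiD phiB exy subrr.
have phi_sur v : exists x, phi x == v.
  have : v \in (\sum_i B i)%VS by rewrite sumB memvf.
  case/memv_sumP => us usB ->.
  have ex i : exists a, us i == A a (e i).
    by have [a ->] := orb _ _ _ (BS i) (eB i) (nzp _ (BS i)) (usB i isT); exists a.
  exists (\row_i xchoose (ex i)); apply/eqP/eq_bigr => i _.
  by rewrite mxE -(eqP (xchooseP (ex i))).
pose psi v := xchoose (phi_sur v).
have psiK v : phi (psi v) = v by apply/eqP/(xchooseP (phi_sur v)).
pose f X := <[psi (vpick X)]>%VS.
have idphi : is_identification fullv phi.
  split=> //; first by move=> c x; rewrite phiM aF ?memvf.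
  by move=> y; split=> [_|_]; [exists (psi y) | rewrite memvf].
have fX X : X \in S -> is_reduction_of phi (f X) X.
  move=> XS y; split=> [yX|[_ /vlineP[a ->] <-]].
    have [a ->] := orb _ _ _ XS (memv_pick X) (nzp X XS) yX.
    by exists (a *: psi (vpick X)); rewrite ?memvZ ?memv_line // phiM psiK.
  by rewrite phiM psiK stS ?memv_pick.
have df X : X \in S -> \dim (f X) = 1%N.
  move=> XS; rewrite dim_vline; case: eqP => // p0.
  by have := nzp X XS; rewrite -(psiK (vpick X)) p0 (phi0 idphi) eqxx.
exists L, phi, (f @` S); split=> //.
- split=> [_ /imfsetP[X /= XS ->]|]; first exact: df.
  move=> _ _ _ /imfsetP[X /= XS ->] /imfsetP[Y /= YS ->] /imfsetP[Z /= ZS ->] u.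
  have hXYZ : is_reduction_of phi (f X + f Y + f Z) (X + Y + Z).
    apply: (reduction_add idphi _ (fX Z ZS)).
    exact: (reduction_add idphi (fX X XS) (fX Y YS)).
  have := reduction_dim idphi hXYZ; case: capS => _ ->.
  + by rewrite dL => /eqP; rewrite eqn_pmul2r // => /eqP.
  + exact: XS.
  + exact: YS.
  + exact: ZS.
  exact: (map_uniq (f := f)).
- move=> X; split=> [XS|[_ /imfsetP[Y /= YS ->] hX]].
    by exists (f X); [apply/imfsetP; exists X | apply: fX].
by rewrite (reduction_uniq idphi hX (fX Y YS)).
Qed.

Lemma elementary_of_conditions (A1 A2 A3 A4 A5 : {vspace V}) :
  [/\ A1 \in S, A2 \in S, A3 \in S, A4 \in S & A5 \in S] ->
  [/\ (A1 <= U)%VS, (A2 <= U)%VS, (A3 <= U)%VS, (A4 <= U)%VS & (A5 <= U)%VS] ->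
  uniq [:: A1; A2; A3; A4; A5] ->
  (forall O : {fset {vspace V}}, is_pseudo_oval_of S O -> E \in O ->
    [\/ A1 \in O, A2 \in O | A3 \in O] -> is_elementary_pseudo_oval O) ->
  is_elementary_weak_egg S.
Proof.
move=> [s1 s2 s3 s4 s5] [u1 u2 u3 u4 u5] uA elem.
have main B1 B2 R : B1 \in S -> B2 \in S -> (B1 <= U)%VS -> (B2 <= U)%VS ->
    uniq [:: B1; B2; A3; A4; A5] ->
    (forall O : {fset {vspace V}}, is_pseudo_oval_of S O -> E \in O ->
      [\/ B1 \in O, B2 \in O | A3 \in O] -> is_elementary_pseudo_oval O) ->
    R \in bars -> (R <= B2 + A4)%VS -> (R <= A3 + A5)%VS -> is_elementary_weak_egg S.
  move=> t1 t2 v1 v2 uB elB RB R24 R35.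
  have [L [A [dL actA [stE stU] stB st24]]] :=
    base_action t1 t2 s3 s4 v1 v2 u3 u4 uB elB.
  have stS := all_good t1 t2 s3 s4 s5 v1 v2 u3 u4 u5 uB elB RB R24 R35 stE stU stB st24.
  pose B (i : 'I_4) := nth 0%VS [:: E; B1; B2; A4] i.
  apply: (elementary_of_action (B := B) dL actA stS).
    by case=> [[|[|[|[|]]]]].
  have [/andP[n12 n14] n24] : (B1 != B2) && (B1 != A4) /\ B2 != A4.
    by move: uB; rewrite /= !inE !negb_or -!andbA => /and5P[-> _ -> _ /and5P[_ -> _ _ _]].
  have eU : (B1 + B2 + A4)%VS = U.
    by apply/eqP; rewrite eqEdim !subv_add v1 v2 u4 dimU pcap_dim3 ?leqnn.
  by rewrite !big_ord_recl big_ord0 /B /= addv0 [(B1 + _)%VS]addvA eU addvC sumUE.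
have [n12 n13 n14 n15 [n23 n24 n25 n34 [n35 n45]]] :
  [/\ A1 != A2, A1 != A3, A1 != A4, A1 != A5 &
   [/\ A2 != A3, A2 != A4, A2 != A5, A3 != A4 & A3 != A5 /\ A4 != A5]].
  move: uA; rewrite /= !inE !negb_or -!andbA.
  by case/and5P=> -> -> -> -> /and5P[-> -> -> -> /andP[-> /andP[-> _]]].
have nE X : X \in S -> (X <= U)%VS -> X != E.
  move=> XS XU; apply/eqP => XE; have := UE; rewrite -XE (capv_idPr XU) => X0.
  by have := pcap_dim XS; rewrite X0 dimv0; move: n_gt0; clear; lia.
have inB X : X \in S -> (X <= U)%VS -> X \in bars.
  by move=> XS XU; rewrite -(bar_id XU) bar_in ?nE.
have l24 : line (A2 + A4) by apply: join_is_line; rewrite ?inB.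
have l14 : line (A1 + A4) by apply: join_is_line; rewrite ?inB.
have l35 : line (A3 + A5) by apply: join_is_line; rewrite ?inB.
have ind X Y Z : X \in S -> Y \in S -> Z \in S -> X != Y -> X != Z -> Y != Z ->
  ~~ (X <= Y + Z)%VS := @pcap_indep X Y Z.
(* The line 35 is not parallel to both 24 and 14. *)
have [J hJ] := exists_hole sp l35.
have ne24 : (A3 + A5)%VS != (A2 + A4)%VS.
  by apply: contraNneq (ind A3 A2 A4 s3 s2 s4 _ n34 n24) => [<-|]; rewrite ?addvSl // eq_sym.
have ne14 : (A3 + A5)%VS != (A1 + A4)%VS.
  by apply: contraNneq (ind A3 A1 A4 s3 s1 s4 _ n34 n14) => [<-|]; rewrite ?addvSl // eq_sym.
case: (lines_meet sp l35 l24 ne24 hJ) => [[R RB eR]|[_ h24]].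
  have R35 : (R <= A3 + A5)%VS by rewrite -eR capvSl.
  have R24 : (R <= A2 + A4)%VS by rewrite -eR capvSr.
  exact: (main A1 A2 R s1 s2 u1 u2 uA elem RB R24 R35).
case: (lines_meet sp l35 l14 ne14 hJ) => [[R RB eR]|[_ h14]].
  have R35 : (R <= A3 + A5)%VS by rewrite -eR capvSl.
  have R14 : (R <= A1 + A4)%VS by rewrite -eR capvSr.
  have uA' : uniq [:: A2; A1; A3; A4; A5].
    by rewrite (perm_uniq (permEl (perm_catCA [:: A2] [:: A1] [:: A3; A4; A5]))).
  apply: (main A2 A1 R s2 s1 u2 u1 uA' _ RB R14 R35) => O hO EO h.
  by apply: elem hO EO _; case: h => h; [apply: Or32|apply: Or31|apply: Or33].
have ne : (A2 + A4)%VS != (A1 + A4)%VS.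
  by apply: contraNneq (ind A2 A1 A4 s2 s1 s4 _ n24 n14) => [<-|]; rewrite ?addvSl // eq_sym.
(* If both lines were parallel to 35, its hole would lie on both, hence in their intersection [A4],
   which a hole meets only in 0. *)
have e4 := lines_meet_at sp l24 l14 ne (inB A4 s4 u4) (addvSr _ _) (addvSr _ _).
have JA4 : (J <= A4)%VS by rewrite -e4 subv_cap (hole_sub h24) (hole_sub h14).
have := hole_cap0 hJ (inB A4 s4 u4); rewrite (capv_idPl JA4) => J0.
have : (0 < \dim J)%N by case: hJ => -> _; exact: n_gt0.
by rewrite J0 dimv0.
Qed.
End Reverse.

Theorem theorem4p2 (F : finFieldType) (n : nat) (hn : (1 < n)%N)
    (hq : (4 < #|F| ^ n)%N) (EE : {fset {vspace 'rV[F]_(4 * n)}})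
    (hEE : is_weak_egg EE) :
  is_elementary_weak_egg EE <->
  exists E E1 E2 E3 E4 E5 : {vspace 'rV[F]_(4 * n)},
    [/\ E \in EE,
        [/\ E1 \in EE, E2 \in EE, E3 \in EE, E4 \in EE & E5 \in EE],
        uniq [:: E1; E2; E3; E4; E5]
      & [/\ is_good_at EE E,
            exists U : {vspace 'rV[F]_(4 * n)},
              [/\ \dim U = (3 * n)%N,
                  (U :&: E)%VS = 0%VS
                & [/\ (E1 <= U)%VS, (E2 <= U)%VS, (E3 <= U)%VS,
                      (E4 <= U)%VS & (E5 <= U)%VS]]
          & forall O : {fset {vspace 'rV[F]_(4 * n)}},
              is_pseudo_oval_of EE O -> E \in O ->
              [\/ E1 \in O, E2 \in O | E3 \in O] ->
              is_elementary_pseudo_oval O]].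
Proof.
have [capE cardE] := hEE; split.
  case=> L [phi [C [dL idphi capC redE]]].
  exact: (elementary_conditions dL idphi capC redE capE hq cardE).
case=> E [E1 [E2 [E3 [E4 [E5 [ES E15 u [gE [U [dU UE subU]] elem]]]]]]].
have Q5 : (5 < #|F| ^ n)%N := exponent_gt5 (finNzRing_gt1 F) hn hq.
exact: (elementary_of_conditions (ltnW hn) Q5 capE cardE ES gE dU UE E15 subU u elem).
Qed.
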